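(* Let $\{F_n\}_{n\ge1}$ be a sequence of random variables in the second Wiener chaos with $\mathbb{E}[F_n^2]=1$ for all $n\ge1$. Let $F_\infty = N_1\times N_2$, where $N_1,N_2$ are independent standard Gaussian random variables, and let $P_6(x)=x^6-55x^4+331x^2-61$. Then $\mathbb{E}[P_6(F_n)]\ge 0$ for all $n$, $\mathbb{E}[P_6(F_\infty)]=0$, and, as $n\to\infty$, the following statements are equivalent: (I) $F_n$ converges in distribution to $F_\infty$; (II) $\mathbb{E}[F_n^4]\to 9$ and $\mathbb{E}[F_n^6]\to 225$; (III) $\mathbb{E}[P_6(F_n)]\to \mathbb{E}[P_6(F_\infty)]=0$. Furthermore, there is a constant $C>0$, independent of $n$, such that for every $n\ge1$ $$d_{W_2}(F_n,F_\infty)\le C\sqrt{\mathbb{E}[P_6(F_n)]}\le C\sqrt{\big(\mathbb{E}[F_n^6]-225\big)-55\big(\mathbb{E}[F_n^4]-9\big)}.$$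
   Context: The second Wiener chaos is that of an isonormal Gaussian process over a real separable Hilbert space, i.e. the space of double Wiener–Itô integrals $I_2(f)$ of symmetric kernels $f$; each such element has the law of $\sum_{k\ge1}\lambda_k(N_k^2-1)$ with $(N_k)$ i.i.d. standard Gaussian and $(\lambda_k)$ a square-summable real sequence (the series converging in $L^2$). The Wasserstein-2 distance between two probability measures $Q_1,Q_2$ on $\mathbb{R}$ is $d_{W_2}(Q_1,Q_2)=\inf \mathbb{E}[(X_1-X_2)^2]^{1/2}$, the infimum being over all random pairs $(X_1,X_2)$ defined on a common probability space with marginal laws $Q_1$ and $Q_2$; $d_{W_2}(F,G)$ for random variables means the distance between their laws. *)

(* Defs.v *)
From HB Require Import structures.
From mathcomp Require Import all_boot all_order all_algebra.
From mathcomp Require Import all_classical all_reals all_analysis.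

Set Implicit Arguments.
Unset Strict Implicit.
Unset Printing Implicit Defensive.

Import Order.TTheory GRing.Theory Num.Theory.
Import numFieldNormedType.Exports.

Local Open Scope classical_set_scope.
Local Open Scope ring_scope.
Local Open Scope ereal_scope.

(* The norm of [H] is the one induced by [ip], so a [completeNormedModType]
   carrying such an [ip] is a real Hilbert space. *)
Record is_inner_product (R : realType) (H : normedModType R)
    (ip : H -> H -> R) : Prop := {
  ip_sym : forall g h : H, ip g h = ip h g ;
  ip_linear : forall (a : R) (f g h : H),
    ip (a *: f + g)%R h = (a * ip f h + ip g h)%R ;
  ip_norm : forall h : H, ip h h = (`|h| ^+ 2)%R }.

Definition separable_space (T : topologicalType) : Prop :=
  exists D : set T, countable D /\ dense D.

Section laws.
Context {R : realType}.

(* Laws are compared on measurable sets only: on other sets the value of a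
   measure carries no meaning. *)
Definition has_law d (T : measurableType d) (P : probability T R) (Y : T -> R)
    (Q : set R -> \bar R) : Prop :=
  forall A : set R, measurable A -> P (Y @^-1` A) = Q A.

(* Degenerate Gaussians are included as Dirac masses: the library's
   [normal_prob m 0] is the uniform law on [0, 1]. *)
Definition gaussian d (T : measurableType d) (P : probability T R)
    (Y : T -> R) : Prop :=
  (exists m s : R, s != 0%R /\ has_law P Y (normal_prob m s)) \/
  (exists m : R, has_law P Y (\d_ m)).

Definition standard_gaussian d (T : measurableType d) (P : probability T R)
    (Y : T -> R) : Prop :=
  has_law P Y (normal_prob 0 1).

Definition independent_RV d (T : measurableType d) (P : probability T R)
    (Y Z : T -> R) : Prop :=
  forall A B : set R, measurable A -> measurable B ->
    P (Y @^-1` A `&` Z @^-1` B) = P (Y @^-1` A) * P (Z @^-1` B).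

Definition cvg_in_distribution d (T : measurableType d) (P : probability T R)
    (Y : nat -> {RV P >-> R})
    d' (T' : measurableType d') (P' : probability T' R) (Z : {RV P' >-> R}) :
    Prop :=
  forall f : R -> R, continuous f ->
    (exists M : R, forall x : R, (`|f x| <= M)%R) ->
    'E_P[fun w => f (Y n w)] @[n --> \oo] --> 'E_P'[fun w => f (Z w)].

Definition wasserstein2 (Q1 Q2 : set R -> \bar R) : \bar R :=
  ereal_inf [set c : \bar R |
    exists (d : measure_display) (S : measurableType d) (Q : probability S R)
           (X1 X2 : {RV Q >-> R}),
      [/\ has_law Q X1 Q1, has_law Q X2 Q2 &
          c = sqrte 'E_Q[fun w => ((X1 w - X2 w) ^+ 2)%R]]].

End laws.

Section wiener_chaos.
Context {R : realType} (H : normedModType R) (ip : H -> H -> R).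
Context d (T : measurableType d) (P : probability T R).

(* The first clause is joint Gaussianity of the family [X]. *)
Record isonormal (X : H -> {RV P >-> R}) : Prop := {
  isonormal_gaussian : forall (m : nat) (c : 'I_m -> R) (h : 'I_m -> H),
    gaussian P (fun w => (\sum_(i < m) c i * X (h i) w)%R) ;
  isonormal_centered : forall h : H, 'E_P[X h] = 0 ;
  isonormal_cov : forall g h : H,
    'E_P[fun w => (X g w * X h w)%R] = (ip g h)%:E }.

(* The closed linear span, in L^2(P), of the variables [He_2 (X h)] with
   [`|h| = 1], where [He_2 x = x ^ 2 - 1] is the second Hermite polynomial.
   As [He_2 (X h) = I_2 (h (x) h)], the linear span consists of the double
   Wiener-Ito integrals of finite-rank symmetric kernels, and its closure of
   the [I_2 f] for all symmetric kernels [f]. *)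
Definition second_wiener_chaos (X : H -> {RV P >-> R}) (F : {RV P >-> R}) :
    Prop :=
  forall e : R, (0 < e)%R ->
    exists (m : nat) (c : 'I_m -> R) (h : 'I_m -> H),
      (forall i : 'I_m, (`|h i| = 1)%R) /\
      'E_P[fun w => ((F w - \sum_(i < m) c i * (X (h i) w ^+ 2 - 1)) ^+ 2)%R]
        < e%:E.

End wiener_chaos.

Definition P6 {R : realType} (x : R) : R :=
  (x ^+ 6 - 55 * x ^+ 4 + 331 * x ^+ 2 - 61)%R.

(* Main.v *)
Require Import Defs.
From HB Require Import structures.
From mathcomp Require Import all_boot all_order all_algebra.
From mathcomp Require Import sesquilinear spectral complex.
From mathcomp Require Import all_classical all_reals all_analysis.
From mathcomp Require Import measurable_realfun ring lra zify.

Set Implicit Arguments.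
Unset Strict Implicit.
Unset Printing Implicit Defensive.

Import Order.TTheory GRing.Theory Num.Theory.
Import numFieldNormedType.Exports.

(* Every element of the second chaos is an L^2 limit of finite forms
   [S = \sum_v l_v (X_v ^ 2 - 1)] over orthonormal families [v] (spectral
   theorem), and, normalising [E S ^ 2 = 2 \sum_v l_v ^ 2 = 1],
     [E (P6 S) = 3840 \sum_v l_v ^ 2 (l_v ^ 2 - 1/4) ^ 2
                 + 640 (\sum_v l_v ^ 3) ^ 2 >= 0].
   When this defect is small, every [l_v] is close to 0 or to 1/2 or -1/2; the
   normalisation and the smallness of the cubic sum then leave exactly one
   coefficient near 1/2 and one near -1/2.  As [(X_u ^ 2 - X_v ^ 2) / 2] is the
   product of the independent standard Gaussians [(X_u +- X_v) / sqrt 2], this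
   couples [S] with a copy of [F_oo] at squared cost at most the defect; when
   the defect is not small, the product coupling suffices.  The coupling gives
   (III) => (I), bounded eighth moments give (I) => (II), and (II) => (III) is
   linear. *)

(** Two obstacles shape the proof. An isonormal process states joint Gaussianity only through the
    laws of linear combinations, so joint laws, independence and moments of forms are all extracted
    from exponential moments: a weight [W] with [E (W e^{tY}) = 0] for every [t] annihilates the
    polynomials in [Y], then its cosines, then its indicators. And the infinite spectral expansion
    of [F] is never built: facts are proved for finite forms with bounds free of the number of
    terms, then carried over by [L^2] approximation. Moments of order four and six do not pass to
    [L^2] limits by themselves, so a uniform bound on the eighth moment comes first; this is why the
    moment formulas go up to order eight. The coefficients of [P6] are what produces a sum of
    squares: with [p_k] the sum of the [l_v ^ k], the moments give
    [3840 p_6 - 1920 p_4 + 120 + 640 p_3^2], and [p_2 = 1/2] makes the first three terms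
    [3840 (p_6 - p_4 / 2 + p_2 / 16)]. The zeros 1/2 and -1/2 are the nonzero coefficients of the
    target; the cubic sum excludes two equal signs. *)

Local Open Scope classical_set_scope.
Local Open Scope ring_scope.

(** * Random variables with moments of all orders *)

Section tame.
Context {R : realType} d (T : measurableType d) (P : probability T R).
Implicit Types f g W Y : T -> R.

(** Integrability alone is not stable under products; finiteness of all moments is, so one side
    condition serves every linearity argument on polynomials and exponentials of Gaussians. *)
Definition tame f : Prop := measurable_fun setT f /\
  forall k, P.-integrable setT (EFin \o (fun w => f w ^+ k)).

Local Notation E f := (\int[P]_w f w).

Lemma le_integrable_real f g : measurable_fun setT f ->
  (forall w, `|f w| <= g w) -> P.-integrable setT (EFin \o g) ->
  P.-integrable setT (EFin \o f).
Proof.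
move=> mf fg ig; apply: le_integrable ig => //; first exact/measurable_EFinP.
by move=> w _ /=; rewrite lee_fin (le_trans (fg w))// ler_norm.
Qed.

Lemma tame_integrable f : tame f -> P.-integrable setT (EFin \o f).
Proof. by case=> _ /(_ 1%N). Qed.

Lemma tameX f k : tame f -> tame (fun w => f w ^+ k).
Proof.
move=> [mf tf]; split; first exact: measurable_funX.
move=> j; have := tf (k * j)%N; apply: eq_integrable => // w _ /=.
by rewrite exprM.
Qed.

Lemma tame_integrableX f k : tame f ->
  P.-integrable setT (EFin \o (fun w => f w ^+ k)).
Proof. by case. Qed.

Lemma tameM f g : tame f -> tame g -> tame (fun w => f w * g w).
Proof.
move=> [mf tf] [mg tg]; split; first exact: measurable_funM.
move=> k.
apply: (@le_integrable_real _ (fun w => f w ^+ (2 * k) + g w ^+ (2 * k))).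
- by apply: measurable_funX; exact: measurable_funM.
- move=> w; rewrite mulnC !exprM exprMn normrM.
  rewrite -(real_normK (num_real (f w ^+ k))) -(real_normK (num_real (g w ^+ k))).
  set a := `| _ |; set b := `| _ |.
  have : 0 <= a by exact: normr_ge0. have : 0 <= b by exact: normr_ge0. nra.
- have := integrableD measurableT (tf (2 * k)%N) (tg (2 * k)%N).
  by apply: eq_integrable => // w _.
Qed.

Lemma integrable_sum_real (I : Type) (s : seq I) (F : I -> T -> R) :
  (forall i, P.-integrable setT (EFin \o F i)) ->
  P.-integrable setT (EFin \o (fun w => \sum_(i <- s) F i w)).
Proof.
move=> iF; have := @integrable_sum _ _ _ P setT measurableT _ s xpredT
   (fun i => EFin \o F i) (fun i _ => iF i).
by apply: eq_integrable => // w _ /=; rewrite sumEFin.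
Qed.

Lemma integrableZ_real c f : P.-integrable setT (EFin \o f) ->
  P.-integrable setT (EFin \o (fun w => c * f w)).
Proof. by move=> /(integrableZl measurableT c); apply: eq_integrable. Qed.

Lemma integrableD_real f g : P.-integrable setT (EFin \o f) ->
  P.-integrable setT (EFin \o g) ->
  P.-integrable setT (EFin \o (fun w => f w + g w)).
Proof. by move=> a b; have := integrableD measurableT a b; exact: eq_integrable. Qed.

Lemma integrableB_real f g : P.-integrable setT (EFin \o f) ->
  P.-integrable setT (EFin \o g) ->
  P.-integrable setT (EFin \o (fun w => f w - g w)).
Proof. by move=> a b; have := integrableB measurableT a b; exact: eq_integrable. Qed.

Lemma tameD f g : tame f -> tame g -> tame (fun w => f w + g w).
Proof.
move=> tf tg; split; first exact: measurable_funD tf.1 tg.1.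
move=> k; suff : P.-integrable setT (EFin \o (fun w => \sum_(i < k.+1)
    'C(k, i)%:R * (f w ^+ (k - i) * g w ^+ i))).
  apply: eq_integrable => // w _ /=; rewrite exprDn; congr EFin.
  by apply: eq_bigr => i _; rewrite mulr_natl.
apply: integrable_sum_real => i; apply: integrableZ_real; apply: tame_integrable.
by apply: tameM; exact: tameX.
Qed.

Lemma tame_bounded f M : measurable_fun setT f -> (forall w, `|f w| <= M) ->
  tame f.
Proof.
move=> mf fM; split => // k; apply: (@le_integrable_real _ (cst (M ^+ k))).
- exact: measurable_funX.
- by move=> w; rewrite normrX lerXn2r// nnegrE (le_trans _ (fM w)).
- by apply: finite_measure_integrable_cst.
Qed.

Lemma tame_cst c : tame (cst c).
Proof. by apply: (@tame_bounded _ `|c|) => //; exact: measurable_cst. Qed.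

Lemma tameZ c f : tame f -> tame (fun w => c * f w).
Proof. by move=> tf; apply: (tameM (tame_cst c)). Qed.

Lemma tameN f : tame f -> tame (fun w => - f w).
Proof. by move=> /(tameZ (-1)); under eq_fun do rewrite mulN1r. Qed.

Lemma tameB f g : tame f -> tame g -> tame (fun w => f w - g w).
Proof. by move=> tf tg; apply: tameD => //; exact: tameN. Qed.

Lemma tame_sum (I : Type) (s : seq I) (F : I -> T -> R) :
  (forall i, tame (F i)) -> tame (fun w => \sum_(i <- s) F i w).
Proof.
move=> tF; elim: s => [|i s ih].
  by under eq_fun do rewrite big_nil; exact: tame_cst.
by under eq_fun do rewrite big_cons; exact: tameD.
Qed.

Lemma tame_le f g : measurable_fun setT f -> (forall w, `|f w| <= g w) ->
  tame g -> tame f.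
Proof.
move=> mf fg [mg tg]; split => // k; apply: le_integrable_real (tg k).
- exact: measurable_funX.
- by move=> w; rewrite normrX lerXn2r// nnegrE (le_trans _ (fg w)).
Qed.

Lemma tame_norm f : tame f -> tame (fun w => `|f w|).
Proof.
move=> [mf tf]; split; first exact: measurableT_comp.
move=> k; have := integrable_norm (tf k); apply: eq_integrable => // w _ /=.
by rewrite normrX.
Qed.

Lemma meanD f g : tame f -> tame g -> E (fun w => f w + g w) = E f + E g.
Proof. by move=> tf tg; apply: RintegralD => //; exact: tame_integrable. Qed.

Lemma meanB f g : tame f -> tame g -> E (fun w => f w - g w) = E f - E g.
Proof. by move=> tf tg; apply: RintegralB => //; exact: tame_integrable. Qed.

Lemma meanZ c f : tame f -> E (fun w => c * f w) = c * E f.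
Proof. by move=> tf; apply: RintegralZl => //; exact: tame_integrable. Qed.

Lemma mean_cst c : E (cst c) = c.
Proof. by rewrite Rintegral_cst//= probability_setT/= mulr1. Qed.

Lemma mean_sum (I : Type) (s : seq I) (F : I -> T -> R) :
  (forall i, tame (F i)) ->
  E (fun w => \sum_(i <- s) F i w) = \sum_(i <- s) E (F i).
Proof.
move=> tF; elim: s => [|i s ih].
  by under eq_fun do rewrite big_nil; rewrite big_nil mean_cst.
rewrite big_cons -ih -meanD//; last exact: tame_sum.
by congr Rintegral; apply/funext => w; rewrite big_cons.
Qed.

Lemma mean_ae f g : measurable_fun setT f -> measurable_fun setT g ->
  {ae P, forall w, f w = g w} -> E f = E g.
Proof.
move=> mf mg fg; congr fine; apply: ae_eq_integral => //; try exact/measurable_EFinP.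
by move: fg; apply: filterS => w -> _.
Qed.

Lemma mean_dct (f_ : nat -> T -> R) f g : (forall n, measurable_fun setT (f_ n)) ->
  measurable_fun setT f ->
  (forall w, f_ n w @[n --> \oo] --> f w) -> (forall n w, `|f_ n w| <= g w) ->
  P.-integrable setT (EFin \o g) -> E (f_ n) @[n --> \oo] --> E f.
Proof.
move=> mf_ mf ff fg ig.
have EF w : (EFin \o f_ ^~ w) n @[n --> \oo] --> (f w)%:E by apply: cvg_EFin; [exact: nearW|exact: ff].
have [itf _ +] := @dominated_convergence _ _ _ P setT measurableT
  (fun n => EFin \o f_ n) (EFin \o f) (EFin \o g)
  (fun n => proj2 (measurable_EFinP _ _) (mf_ n)) (proj2 (measurable_EFinP _ _) mf)
  (aeW _ (fun x _ => EF x)) ig (aeW _ (fun x n _ => fg n x)).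
move=> h; apply: fine_cvg; rewrite fineK//; exact: integrable_fin_num.
Qed.
End tame.

(** * Moment generating functions *)

Lemma expR_sub1_bounds {R : realType} (x : R) :
  x <= expR x - 1 <= x * expR x.
Proof.
rewrite lerBrDl expR_ge1Dx/= lerBlDr -lerBlDl -{1}(mul1r (expR x)) -mulrBl.
have := expR_ge1Dx (- x); rewrite expRN => h.
by rewrite -ler_pdivlMr ?expR_gt0// div1r.
Qed.

Lemma norm_expR_sub1 {R : realType} (x : R) :
  `|expR x - 1| <= `|x| * expR `|x|.
Proof.
have /andP[h1 h2] := expR_sub1_bounds x.
have [x0|x0] := leP 0 x.
  by rewrite (ger0_norm x0) ger0_norm// (le_trans x0).
have e1 : expR x <= 1 by rewrite expR_le1 ltW.
rewrite ler0_norm ?subr_le0// (ltr0_norm x0).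
have : 1 <= expR (- x) by rewrite -expR0 ler_expR oppr_ge0 ltW.
nra.
Qed.

Lemma cvg_exprn {R : realType} (u : nat -> R) (l : R) k :
  u n @[n --> \oo] --> l -> u n ^+ k @[n --> \oo] --> l ^+ k.
Proof.
move=> ul; apply: (@continuous_cvg _ _ _ _ _ u (fun x => x ^+ k)) => //.
exact: exprn_continuous.
Qed.

Section exp_quotient.
Context {R : realType}.

(* These quotients tend to [x]: they recover polynomial moments from
   exponential ones by dominated convergence. *)
Definition exp_quot (n : nat) (x : R) : R := n.+1%:R * (expR (x / n.+1%:R) - 1).

Lemma exp_quot_bounds n x :
  x <= exp_quot n x <= x * expR (x / n.+1%:R).
Proof.
have n0 : 0 < n.+1%:R :> R by rewrite ltr0n.
have /andP[h1 h2] := expR_sub1_bounds (x / n.+1%:R).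
rewrite /exp_quot -ler_pdivrMl// mulrC h1/=.
by rewrite -ler_pdivlMl// (le_trans h2)// mulrA (mulrC _^-1).
Qed.

Lemma exp_quot_norm n x : `|exp_quot n x| <= `|x| * expR `|x|.
Proof.
have n0 : 0 < n.+1%:R :> R by rewrite ltr0n.
rewrite /exp_quot normrM (gtr0_norm n0) -ler_pdivlMl//.
rewrite (le_trans (norm_expR_sub1 _))// normrM normfV (gtr0_norm n0).
rewrite [leRHS]mulrA (mulrC _^-1) ler_wpM2l ?mulr_ge0 ?invr_ge0//.
by rewrite ler_expR ler_piMr// invf_le1// ler1n.
Qed.

Lemma exp_quot_cvg (x_ : nat -> R) (x : R) : x_ n @[n --> \oo] --> x ->
  exp_quot n (x_ n) @[n --> \oo] --> x.
Proof.
move=> xx.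
apply: (@squeeze_cvgr _ _ _ _ x_ (fun n => x_ n * expR (x_ n / n.+1%:R))) => //.
  by apply: nearW => n; exact: exp_quot_bounds.
rewrite -[X in _ --> X]mulr1; apply: cvgM => //.
rewrite -[X in _ --> X](@expR0 R); apply: continuous_cvg; first exact: continuous_expR.
rewrite -[X in _ --> X](mulr0 x); apply: cvgM => //; exact: cvg_harmonic.
Qed.

Lemma measurable_exp_quot n : measurable_fun setT (exp_quot n).
Proof.
apply: measurable_funM => //; apply: measurable_funB => //.
by apply: measurableT_comp => //; apply: measurable_funM.
Qed.

End exp_quotient.

Section mgf.
Context {R : realType} d (T : measurableType d) (P : probability T R).
Local Notation E f := (\int[P]_w f w).
Implicit Types (W Y : T -> R).

Definition has_mgf Y : Prop := measurable_fun setT Y /\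
  forall t, P.-integrable setT (EFin \o (fun w => expR (t * Y w))).

Variables (Y : T -> R) (eY : has_mgf Y).

Lemma tame_expR t : tame P (fun w => expR (t * Y w)).
Proof.
have mY := eY.1; split.
  by apply: measurableT_comp => //; exact: measurable_funM.
move=> k; have := eY.2 (k%:R * t); apply: eq_integrable => // w _ /=.
by rewrite -mulrA expRM_natl.
Qed.

Lemma tame_expR_norm t : tame P (fun w => expR (`|t * Y w|)).
Proof.
have mY := eY.1; apply: tame_le (tameD (tame_expR t) (tame_expR (- t))).
  apply: measurableT_comp => //; apply: measurableT_comp => //.
  exact: measurable_funM.
move=> w; rewrite ger0_norm ?expR_ge0//.
have [h|h] := leP 0 (t * Y w); first by rewrite (ger0_norm h) lerDl expR_ge0.
by rewrite (ltr0_norm h) mulNr lerDr expR_ge0.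
Qed.

Lemma tame_mgf : tame P Y.
Proof.
have mY := eY.1; apply: tame_le (tame_expR_norm 1) => // w.
by rewrite mul1r (le_trans _ (expR_ge1Dx _))// lerDr.
Qed.

Let G w := `|Y w| * expR `|1 * Y w|.

Let tG : tame P G.
Proof. by apply: tameM; [exact/tame_norm/tame_mgf|exact: tame_expR_norm]. Qed.

Let mq n : measurable_fun setT (fun w => exp_quot n (Y w)).
Proof. exact: (measurableT_comp (measurable_exp_quot n) eY.1). Qed.

Let qG n w : `|exp_quot n (Y w)| <= G w.
Proof. by rewrite /G mul1r exp_quot_norm. Qed.

Let tq n : tame P (fun w => exp_quot n (Y w)).
Proof. exact: tame_le (mq n) (qG n) tG. Qed.

Let mean_exp_quot_cvg W k : tame P W ->
  E (fun w => W w * exp_quot n (Y w) ^+ k) @[n --> \oo] -->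
  E (fun w => W w * Y w ^+ k).
Proof.
move=> tW; apply: (@mean_dct _ _ _ _ _ _ (fun w => `|W w| * G w ^+ k)).
- by move=> n; apply: measurable_funM; [exact: tW.1|exact: measurable_funX].
- by apply: measurable_funM; [exact: tW.1|apply: measurable_funX; exact: eY.1].
- move=> w; apply: cvgM; first exact: cvg_cst.
  apply: cvg_exprn.
  by apply: exp_quot_cvg; exact: cvg_cst.
- move=> n w; rewrite normrM ler_wpM2l// normrX lerXn2r// nnegrE//.
  by rewrite mulr_ge0// expR_ge0.
- by apply: tame_integrable; apply: tameM; [exact: tame_norm|exact: tameX].
Qed.

Lemma expR_exp_quot n s y : exp_quot n y * expR (s * y) =
  n.+1%:R * (expR ((s + n.+1%:R^-1) * y) - expR (s * y)) :> R.
Proof. by rewrite /exp_quot mulrDl expRD (mulrC _^-1); ring. Qed.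

(** Differentiation under the integral, done discretely: [exp_quot n Y ^+ j] times an exponential is
    a combination of exponentials, so its mean against [W] vanishes by induction on [j] with the
    rate [s] left free; then [n] tends to infinity. *)
Lemma mgf_zero_moments W : tame P W ->
  (forall t, E (fun w => W w * expR (t * Y w)) = 0) ->
  forall k, E (fun w => W w * Y w ^+ k) = 0.
Proof.
move=> tW W0 k.
have H n j s : E (fun w => W w * exp_quot n (Y w) ^+ j * expR (s * Y w)) = 0.
  elim: j s => [|j ih] s; first by under eq_Rintegral do rewrite expr0 mulr1.
  have tj t : tame P (fun w => W w * exp_quot n (Y w) ^+ j * expR (t * Y w)).
    by apply: tameM; [apply: tameM => //; exact: tameX|exact: tame_expR].
  transitivity (E (fun w => n.+1%:R *
     (W w * exp_quot n (Y w) ^+ j * expR ((s + n.+1%:R^-1) * Y w) -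
      W w * exp_quot n (Y w) ^+ j * expR (s * Y w)))).
    apply: eq_Rintegral => w _.
    have H := expR_exp_quot n s (Y w).
    transitivity (W w * exp_quot n (Y w) ^+ j * (exp_quot n (Y w) * expR (s * Y w))).
      by rewrite exprSr; set a := _ ^+ j; ring.
    by rewrite H; ring.
  rewrite meanZ ?meanB//; last exact: tameB.
  by rewrite !ih subr0 mulr0.
have := @mean_exp_quot_cvg W k tW.
rewrite (_ : (fun _ => _) = cst 0); first by move=> /cvg_lim <- //; rewrite lim_cst.
apply/funext => n; rewrite -(H n k 0); apply: eq_Rintegral => w _.
by rewrite mul0r expR0 mulr1.
Qed.

Section stein.
Variables (m v : R).
Hypothesis Ymgf : forall t, E (fun w => expR (t * Y w)) =
  expR (m * t + v * t ^+ 2 / 2).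

Lemma mgf_stein0 t : E (fun w => Y w * expR (t * Y w)) =
  (m + v * t) * E (fun w => expR (t * Y w)).
Proof.
have te := tame_expR.
have := @mean_exp_quot_cvg (fun w => expR (t * Y w)) 1 (te t).
under eq_Rintegral do rewrite expr1 mulrC.
move=> /cvg_lim <- //; apply/cvg_lim => //.
(* The difference quotient of the Gaussian mgf [M] at [t] with step [1/(n+1)] is exactly
   [exp_quot n (m + v t + v/(2(n+1)))] times [M t]. *)
rewrite (_ : (fun _ => _) = (fun n => exp_quot n (m + v * t + v / 2 / n.+1%:R) *
   E (fun w => expR (t * Y w)))).
  apply: cvgM; last exact: cvg_cst.
  apply: exp_quot_cvg; rewrite -[X in _ --> X]addr0; apply: cvgD; first exact: cvg_cst.
  rewrite -[X in _ --> X](mulr0 (v / 2)); apply: cvgM; first exact: cvg_cst.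
  exact: cvg_harmonic.
apply/funext => n.
transitivity (E (fun w => n.+1%:R *
     (expR ((t + n.+1%:R^-1) * Y w) - expR (t * Y w)))).
  by apply: eq_Rintegral => w _; rewrite expr1 mulrC expR_exp_quot.
rewrite meanZ ?meanB//; last exact: tameB.
rewrite !Ymgf /exp_quot.
rewrite (_ : m * (t + n.+1%:R^-1) + v * (t + n.+1%:R^-1) ^+ 2 / 2 =
   (m + v * t + v / 2 / n.+1%:R) / n.+1%:R + (m * t + v * t ^+ 2 / 2)); last first.
  have n0 : n.+1%:R != 0 :> R by rewrite pnatr_eq0.
  by move: (n.+1%:R) n0 => N n0; field.
by rewrite expRD; ring.
Qed.

(** Gaussian integration by parts, [E (Y f(Y)) = E (m f(Y) + v f'(Y))], is proved for
    [f = g^j e^{sy}] with [g = exp_quot n]: such [f] are combinations of exponentials, where it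
    reduces to [mgf_stein0]. Letting [n] grow turns [g] into [y]. *)
Lemma mgf_stein k : E (fun w => Y w * Y w ^+ k) =
  E (fun w => m * Y w ^+ k + v * k%:R * Y w ^+ k.-1).
Proof.
have te := tame_expR.
have tY := tame_mgf.
pose g n w := exp_quot n (Y w).
(* [A n j s] times [e^{sY}] is [m f + v f'] at [Y], because the derivative of [exp_quot n] is
   [e^{y/(n+1)} = 1 + g/(n+1)]. *)
pose A n j s w : R := m * g n w ^+ j + v * j%:R * g n w ^+ j.-1 * (1 + g n w / n.+1%:R)
   + v * s * g n w ^+ j.
have tg n j : tame P (fun w => g n w ^+ j) by apply: tameX; exact: tq.
have tgn n : tame P (fun w => 1 + g n w / n.+1%:R).
  apply: tameD; first exact: tame_cst.
  by apply: tameM; [exact: tq|exact: tame_cst].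
have tA n j s : tame P (A n j s).
  apply: tameD; last exact: tameZ.
  apply: tameD; first exact: tameZ.
  by apply: tameM => //; exact: tameZ.
have H n j s : E (fun w => Y w * g n w ^+ j * expR (s * Y w)) =
   E (fun w => A n j s w * expR (s * Y w)).
  elim: j s => [|j ih] s.
    under eq_Rintegral do rewrite expr0 mulr1.
    rewrite mgf_stein0 -meanZ//; apply: eq_Rintegral => w _.
    by rewrite /A; ring.
  have tj t : tame P (fun w => Y w * g n w ^+ j * expR (t * Y w)).
    by apply: tameM => //; exact: tameM.
  have tAj i t : tame P (fun w => A n j i w * expR (t * Y w)) by exact: tameM.
  transitivity (E (fun w => n.+1%:R *
     (Y w * g n w ^+ j * expR ((s + n.+1%:R^-1) * Y w) -
      Y w * g n w ^+ j * expR (s * Y w)))).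
    apply: eq_Rintegral => w _.
    have H := expR_exp_quot n s (Y w).
    transitivity (Y w * g n w ^+ j * (g n w * expR (s * Y w))); first by rewrite exprSr; set a := _ ^+ j; ring.
    by rewrite H; ring.
  rewrite meanZ ?meanB//; last exact: tameB.
  rewrite !ih -meanB// -meanZ; last exact: tameB.
  apply: eq_Rintegral => w _.
  have n0 : n.+1%:R != 0 :> R by rewrite pnatr_eq0.
  have -> : expR ((s + n.+1%:R^-1) * Y w) = (1 + g n w / n.+1%:R) * expR (s * Y w).
    rewrite mulrDl expRD mulrC /g /exp_quot (mulrC _^-1).
    by move: (n.+1%:R) n0 => N n0; field.
  rewrite /A /=; move: (n.+1%:R) n0 => N n0.
  by case: j {ih tj tAj} => [|j]; rewrite /= ?expr0 ?exprS -?natr1;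
    [|set a := _ ^+ j]; field.
have h1 := @mean_exp_quot_cvg Y k tY.
have h2 : E (fun w => A n k 0 w) @[n --> \oo] -->
   E (fun w => m * Y w ^+ k + v * k%:R * Y w ^+ k.-1).
  apply: (@mean_dct _ _ _ _ _ _
     (fun w => `|m| * G w ^+ k + `|v * k%:R| * G w ^+ k.-1 * (1 + G w))).
  - by move=> n; exact: (tA n k 0).1.
  - apply: measurable_funD; apply: measurable_funM => //; apply: measurable_funX; exact: eY.1.
  - move=> w.
    have gY : g n w @[n --> \oo] --> Y w by apply: exp_quot_cvg; exact: cvg_cst.
    rewrite -[X in _ --> X]addr0; apply: cvgD; last first.
      rewrite (_ : (fun _ => _) = cst 0); first exact: cvg_cst.
      by apply/funext => n; rewrite mulr0 mul0r.
    apply: cvgD; first apply: cvgM; first exact: cvg_cst.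
      exact: cvg_exprn.
    rewrite -[X in _ --> X]mulr1; apply: cvgM.
      apply: cvgM; first exact: cvg_cst.
      exact: cvg_exprn.
    rewrite -[X in _ --> X]addr0; apply: cvgD; first exact: cvg_cst.
    by rewrite -[X in _ --> X](mulr0 (Y w)); apply: cvgM => //; exact: cvg_harmonic.
  - move=> n w; have G0 : 0 <= G w by rewrite mulr_ge0// expR_ge0.
    have gG := qG n w; rewrite /A mulr0 mul0r addr0.
    rewrite (le_trans (ler_normD _ _))// lerD//.
      by rewrite normrM ler_wpM2l// normrX lerXn2r.
    rewrite 2!normrM ler_pM// ?mulr_ge0//.
      by rewrite normrX ler_wpM2l// lerXn2r.
    rewrite (le_trans (ler_normD _ _))// normr1 lerD2l normrM normfV.
    rewrite (le_trans _ gG)// ler_piMr// normr_nat invf_le1 ?ler1n ?ltr0n//.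
  - apply: tame_integrable; apply: tameD; first exact/tameZ/tameX.
    apply: tameM; first exact/tameZ/tameX.
    by apply: tameD => //; exact: tame_cst.
move/cvg_lim : h1 => <- //; move/cvg_lim : h2 => <- //; congr (limn _).
apply/funext => n; have := H n k 0.
under eq_Rintegral do rewrite mul0r expR0 mulr1.
by under [RHS]eq_Rintegral do rewrite mul0r expR0 mulr1.
Qed.

End stein.

(** The bound [1/k!] on the coefficients dominates all partial sums by [e^{|tY|}], so the vanishing
    moments may be summed term by term. *)
Lemma moments_zero_series W (a : nat -> R) (S : R -> R) t : tame P W ->
  measurable_fun setT S ->
  (forall k, `|a k| <= (k`!%:R)^-1) ->
  (forall x, (\sum_(0 <= k < n) a k * x ^+ k) @[n --> \oo] --> S x) ->
  (forall k, E (fun w => W w * Y w ^+ k) = 0) ->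
  E (fun w => W w * S (t * Y w)) = 0.
Proof.
move=> tW mS a1 aS W0.
have mY := eY.1; have tY := tame_mgf.
have : E (fun w => W w * (\sum_(0 <= k < n) a k * (t * Y w) ^+ k)) @[n --> \oo] -->
    E (fun w => W w * S (t * Y w)).
  apply: (@mean_dct _ _ _ _ _ _ (fun w => `|W w| * expR `|t * Y w|)).
  - move=> n; apply: measurable_funM; first exact: tW.1.
    apply: (@measurable_sum _ _ _ _ _ (index_iota 0 n) (fun k w => a k * (t * Y w) ^+ k)) => k.
    by apply: measurable_funM => //; apply: measurable_funX; exact: measurable_funM.
  - apply: measurable_funM; first exact: tW.1.
    by apply: measurableT_comp => //; exact: measurable_funM.
  - by move=> w; apply: cvgM; [exact: cvg_cst|exact: aS].
  - move=> n w; rewrite normrM ler_wpM2l//.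
    apply: le_trans (ler_norm_sum _ _ _) _.
    apply: (@le_trans _ _ (series (exp_coeff `|t * Y w|) n)).
      apply: ler_sum => k _; rewrite normrM normrX mulrC /exp_coeff/=.
      by rewrite ler_wpM2l// exprn_ge0.
    apply: nondecreasing_cvgn_le; last exact: is_cvg_series_exp_coeff.
    by apply: nondecreasing_series => k _ _; exact: exp_coeff_ge0.
  - by apply: tame_integrable; apply: tameM; [exact: tame_norm|exact: tame_expR_norm].
rewrite (_ : (fun _ => _) = cst 0); first by move=> /cvg_lim <- //; rewrite lim_cst.
apply/funext => n.
transitivity (E (fun w => \sum_(0 <= k < n) (a k * t ^+ k * (W w * Y w ^+ k)))).
  apply: eq_Rintegral => w _; rewrite mulr_sumr; apply: eq_bigr => k _.
  by rewrite exprMn; ring.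
have tk k : tame P (fun w => W w * Y w ^+ k) by apply: tameM => //; exact: tameX.
rewrite mean_sum; last by move=> k; exact: tameZ.
by rewrite big1// => k _; rewrite meanZ// W0 mulr0.
Qed.

(** Passage from Laplace to Fourier without analytic continuation: the cosine and sine series are
    integrated term by term, and the phase [x] combines the two. *)
Lemma mgf_zero_cos W t x : tame P W ->
  (forall s, E (fun w => W w * expR (s * Y w)) = 0) ->
  E (fun w => W w * cos (t * Y w + x)) = 0.
Proof.
move=> tW W0; have W0k := mgf_zero_moments tW W0; have mY := eY.1.
have c0 : E (fun w => W w * cos (t * Y w)) = 0.
  apply: (@moments_zero_series W (fun n => (~~ odd n)%:R * (-1) ^+ n./2 * (n`!%:R)^-1)) => //.
  - exact: (continuous_measurable_fun (@continuous_cos R)).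
  - move=> k; rewrite 2!normrM normrX normrN1 expr1n mulr1 normfV !normr_nat.
    by case: odd; rewrite /= ?mul0r ?mul1r// invr_ge0.
  - move=> y; have := @is_cvg_series_cos_coeff R y.
    by rewrite cos.unlock cos_coeffE.
have s0 : E (fun w => W w * sin (t * Y w)) = 0.
  apply: (@moments_zero_series W (fun n => (odd n)%:R * (-1) ^+ n.-1./2 * (n`!%:R)^-1)) => //.
  - exact: (continuous_measurable_fun (@continuous_sin R)).
  - move=> k; rewrite 2!normrM normrX normrN1 expr1n mulr1 normfV !normr_nat.
    by case: odd; rewrite /= ?mul0r ?mul1r// invr_ge0.
  - move=> y; have := @is_cvg_series_sin_coeff R y.
    by rewrite sin.unlock sin_coeffE.
have tc : tame P (fun w => W w * cos (t * Y w)).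
  apply: tameM => //; apply: (@tame_bounded _ _ _ _ _ 1) => [|w]; last exact: cos_max.
  apply: measurableT_comp; first exact: (continuous_measurable_fun (@continuous_cos R)).
  exact: measurable_funM.
have ts : tame P (fun w => W w * sin (t * Y w)).
  apply: tameM => //; apply: (@tame_bounded _ _ _ _ _ 1) => [|w]; last exact: sin_max.
  apply: measurableT_comp; first exact: (continuous_measurable_fun (@continuous_sin R)).
  exact: measurable_funM.
transitivity (E (fun w => cos x * (W w * cos (t * Y w)) - sin x * (W w * sin (t * Y w)))).
  by apply: eq_Rintegral => w _; rewrite cosD; ring.
by rewrite meanB ?meanZ ?c0 ?s0 ?mulr0 ?subr0//; exact: tameZ.
Qed.

End mgf.

(** * Uniqueness for cosine transforms *)

Lemma bernoulli_ineq {R : realType} (x : R) k : 0 <= x <= 1 ->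
  1 - k%:R * x <= (1 - x) ^+ k.
Proof.
move=> /andP[x0 x1]; elim: k => [|k ih]; first by rewrite mul0r subr0 expr0.
rewrite exprS -natr1; apply: (@le_trans _ _ ((1 - x) * (1 - k%:R * x))).
  have k0 : 0 <= k%:R * x * x by rewrite !mulr_ge0.
  by rewrite -subr_ge0 (_ : _ - _ = k%:R * x * x)//; ring.
by rewrite ler_wpM2l// subr_ge0.
Qed.

(** [1 - p^n] is [1 - p] times a sum of [n] powers of [p], each at least [p^n]. *)
Lemma natr_mul_expr_le {R : realType} (p : R) n : 0 <= p <= 1 ->
  n%:R * p ^+ n * (1 - p) <= 1 - p ^+ n.
Proof.
move=> /andP[p0 p1]; elim: n => [|n ih]; first by rewrite !mul0r expr0 subrr.
have pn0 : 0 <= p ^+ n by rewrite exprn_ge0.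
have pn1 : p ^+ n <= 1 by rewrite exprn_ile1.
rewrite exprS -natr1.
move: (p ^+ n) (n%:R) ih pn0 pn1 => a N ih a0 a1.
have h : p * (N * a * (1 - p)) <= p * (1 - a) by rewrite ler_wpM2l.
have h2 : 0 <= (1 - p) * (1 - p * a).
  by rewrite mulr_ge0 ?subr_ge0// mulr_ile1.
lra.
Qed.

(** Writing [q = p^2] leaves a geometric factor [p^n] once [n p^n] is bounded by [1/(1-p)]. *)
Lemma cvg_natr_mul_expr {R : realType} (q : R) : 0 <= q < 1 ->
  n%:R * q ^+ n @[n --> \oo] --> 0.
Proof.
move=> /andP[q0 q1]; pose p := Num.sqrt q.
have p0 : 0 <= p by exact: sqrtr_ge0.
have p1 : p < 1 by rewrite -(@sqrtr1 R) ltr_sqrt.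
have p01 : 0 <= p <= 1 by rewrite p0 ltW.
have qE n : n%:R * q ^+ n = (n%:R * p ^+ n) * p ^+ n.
  by rewrite -mulrA -expr2 -exprM mulnC exprM sqr_sqrtr.
apply: (@squeeze_cvgr _ _ _ _ (cst 0) (fun n => (1 - p)^-1 * p ^+ n)).
- apply: nearW => n; rewrite /= mulr_ge0 ?exprn_ge0//= qE ler_wpM2r ?exprn_ge0//.
  rewrite -[leRHS]mul1r ler_pdivlMr ?subr_gt0//.
  by rewrite (le_trans (natr_mul_expr_le n p01))// gerBl exprn_ge0.
- exact: cvg_cst.
- rewrite -[X in _ --> X](mulr0 (1 - p)^-1); apply: cvgM; first exact: cvg_cst.
  by apply: cvg_expr; rewrite ger0_norm.
Qed.

(* Of order [n k ^- n], so that its product with [v ^ n] tends to 0 for [v < k]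
   and to infinity for [v >= k]. *)
Definition threshold_exponent {R : realType} (k : R) (n : nat) : nat :=
  (n * (Num.truncn (k^-1 ^+ n)).+1)%N.

(** Explicit polynomials in [v], bounded by 1, take the place of Stone-Weierstrass. For [v < k]
    Bernoulli's inequality gives the lower bound [1 - 2 n (v/k)^n]; for [v >= k] the estimate
    [1 - x <= e^{-x}] gives the upper bound [e^{-n}]. *)
Lemma cvg_threshold {R : realType} (k v : R) : 0 < k < 1 -> 0 <= v <= 1 ->
  (1 - v ^+ n) ^+ threshold_exponent k n @[n --> \oo] --> ((v < k)%R%:R : R).
Proof.
move=> /andP[k0 k1] /andP[v0 v1].
have vn0 n : 0 <= v ^+ n by rewrite exprn_ge0.
have vn1 n : v ^+ n <= 1 by rewrite exprn_ile1.
have kn1 n : 1 <= k^-1 ^+ n by rewrite exprn_ege1// invf_ge1// ltW.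
have [vk|kv] := ltP v k.
- apply: (@squeeze_cvgr _ _ _ _ (fun n => 1 - 2 * (n%:R * (v / k) ^+ n)) (cst 1)).
  + apply: nearW => n; apply/andP; split; last first.
      by rewrite /= exprn_ile1// ?subr_ge0// gerBl.
    apply: le_trans (bernoulli_ineq _ _); last by rewrite vn0 vn1.
    rewrite lerD2l lerN2 /threshold_exponent natrM exprMn.
    rewrite (_ : 2 * _ = n%:R * (2 * k^-1 ^+ n) * v ^+ n); last by ring.
    rewrite ler_wpM2r// ler_wpM2l// -natr1.
    have : (Num.truncn (k^-1 ^+ n))%:R <= k^-1 ^+ n.
      by rewrite truncn_le// (le_trans _ (kn1 n)).
    by have := kn1 n; lra.
  + rewrite -[X in _ --> X](subr0 1); apply: cvgB; first exact: cvg_cst.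
    rewrite -[X in _ --> X](mulr0 2); apply: cvgM; first exact: cvg_cst.
    apply: cvg_natr_mul_expr; rewrite divr_ge0//=; last exact: ltW.
    by rewrite ltr_pdivrMr// mul1r.
  + exact: cvg_cst.
- apply: (@squeeze_cvgr _ _ _ _ (cst 0) (fun n => expR (-1) ^+ n)).
  + apply: nearW => n; rewrite exprn_ge0 ?subr_ge0//=.
    apply: (@le_trans _ _ (expR (- (v ^+ n)) ^+ threshold_exponent k n)).
      by rewrite lerXn2r ?nnegrE ?subr_ge0// ?expR_ge0// expR_ge1Dx.
    rewrite -!expRM_natl ler_expR mulrN mulrN1 lerN2.
    rewrite /threshold_exponent natrM -mulrA ler_peMr//.
    apply: (@le_trans _ _ (k^-1 ^+ n * v ^+ n)).
      rewrite exprVn mulrC ler_pdivlMr ?exprn_gt0// mul1r.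
      by rewrite lerXn2r// nnegrE ltW.
    by rewrite ler_wpM2r// ltW// truncnS_gt.
  + exact: cvg_cst.
  + apply: cvg_expr; rewrite ger0_norm ?expR_ge0//.
Qed.

Section cosine_transform.
Context {R : realType} d (T : measurableType d) (P : probability T R).
Local Notation E f := (\int[P]_w f w).
Variables (W Y : T -> R) (tW : tame P W) (mY : measurable_fun setT Y).
Hypothesis W_cos : forall t x, E (fun w => W w * cos (t * Y w + x)) = 0.

Let mW : measurable_fun setT W. Proof. exact: tW.1. Qed.

Let mcos : measurable_fun setT (@cos R).
Proof. exact: (continuous_measurable_fun (@continuous_cos R)). Qed.

Let mcosY t x : measurable_fun setT (fun w => cos (t * Y w + x)).
Proof. by apply: measurableT_comp => //; apply: measurable_funD => //; exact: measurable_funM. Qed.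

Let tcosY t x : tame P (fun w => cos (t * Y w + x)).
Proof. by apply: (@tame_bounded _ _ _ _ _ 1) => // w; exact: cos_max. Qed.

(* Powers of [v] are trigonometric polynomials in [Y], whence the indicators of
   [v < k]; letting the period grow yields the indicators of [r < |Y - a|]. *)
Let v s x w : R := (1 + cos (s * Y w + x)) / 2.

Let v01 s x w : 0 <= v s x w <= 1.
Proof.
have := cos_geN1 (s * Y w + x); have := cos_le1 (s * Y w + x).
by rewrite /v; lra.
Qed.

Let mv s x : measurable_fun setT (v s x).
Proof. by apply: measurable_funM => //; exact: measurable_funD. Qed.

Let tv s x : tame P (v s x).
Proof.
apply: (@tame_bounded _ _ _ _ _ 1) => // w.
by have /andP[h0 h1] := v01 s x w; rewrite ger0_norm.
Qed.

Let cosM (a b : R) : cos a * cos b = (cos (a + b) + cos (a - b)) / 2.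
Proof. by rewrite cosD cosB; field. Qed.

(** A product of cosines is a sum of cosines, so multiplying by [v] stays within the functions
    annihilated by [W]; the frequency [t] and the phase [y] must stay free in the induction. *)
Let Wv_cos n s x t y : E (fun w => W w * v s x w ^+ n * cos (t * Y w + y)) = 0.
Proof.
elim: n t y => [|n ih] t y.
  by under eq_Rintegral do rewrite expr0 mulr1; exact: W_cos.
have tn t' y' : tame P (fun w => W w * v s x w ^+ n * cos (t' * Y w + y')).
  by apply: tameM => //; apply: tameM => //; exact: tameX.
transitivity (E (fun w => 2^-1 * (W w * v s x w ^+ n * cos (t * Y w + y)) +
  (4^-1 * (W w * v s x w ^+ n * cos ((t + s) * Y w + (y + x))) +
   4^-1 * (W w * v s x w ^+ n * cos ((t - s) * Y w + (y - x)))))).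
  apply: eq_Rintegral => w _.
  have H := cosM (t * Y w + y) (s * Y w + x).
  rewrite (_ : (t + s) * _ + _ = t * Y w + y + (s * Y w + x)); last by ring.
  rewrite (_ : (t - s) * _ + _ = t * Y w + y - (s * Y w + x)); last by ring.
  rewrite exprSr {2}/v; move: (_ ^+ n) => a.
  transitivity (W w * a * (2^-1 * cos (t * Y w + y) +
    2^-1 * (cos (t * Y w + y) * cos (s * Y w + x)))); first by field.
  by rewrite H; field.
have t2 c t' y' : tame P (fun w => c * (W w * v s x w ^+ n * cos (t' * Y w + y'))).
  exact: tameZ.
rewrite meanD//; last exact: tameD.
by rewrite meanD// !meanZ// !ih !mulr0 !addr0.
Qed.

Let Wv n K j s x : E (fun w => W w * ((1 - v s x w ^+ n) ^+ K * v s x w ^+ j)) = 0.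
Proof.
elim: K j => [|K ih] j.
  rewrite -(Wv_cos j s x 0 0); apply: eq_Rintegral => w _.
  by rewrite mul0r addr0 cos0 expr0 mul1r mulr1.
have tj i : tame P (fun w => W w * ((1 - v s x w ^+ n) ^+ K * v s x w ^+ i)).
  apply: tameM => //; apply: tameM; last exact: tameX.
  by apply: tameX; apply: tameB; [exact: tame_cst|exact: tameX].
transitivity (E (fun w => W w * ((1 - v s x w ^+ n) ^+ K * v s x w ^+ j) -
   W w * ((1 - v s x w ^+ n) ^+ K * v s x w ^+ (n + j)))).
  apply: eq_Rintegral => w _; rewrite exprD exprSr.
  by move: (_ ^+ n) (_ ^+ K) (_ ^+ j) => a b c; ring.
by rewrite meanB// !ih subr0.
Qed.

Lemma measurable_ltr_nat (f g : T -> R) : measurable_fun setT f ->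
  measurable_fun setT g -> measurable_fun setT (fun w => (f w < g w)%R%:R : R).
Proof.
move=> mf mg.
have mS : measurable [set w | f w < g w].
  rewrite (_ : mkset _ = (fun w => f w < g w) @^-1` [set true])//.
  by rewrite -[X in measurable X]setTI; exact: measurable_fun_ltr.
rewrite (_ : (fun _ => _) = \1_[set w | f w < g w]).
  exact: measurable_indic.
by apply/funext => w; rewrite indicE mem_setE.
Qed.

Let W_threshold k s x : 0 < k < 1 -> E (fun w => W w * (v s x w < k)%R%:R) = 0.
Proof.
move=> k01.
have : E (fun w => W w * ((1 - v s x w ^+ n) ^+ threshold_exponent k n * v s x w ^+ 0))
    @[n --> \oo] --> E (fun w => W w * (v s x w < k)%R%:R).
  apply: (@mean_dct _ _ _ _ _ _ (fun w => `|W w|)).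
  - move=> n; apply: measurable_funM => //; apply: measurable_funM.
      by apply: measurable_funX; apply: measurable_funB => //; exact: measurable_funX.
    exact: measurable_funX.
  - by apply: measurable_funM => //; exact: measurable_ltr_nat.
  - move=> w; apply: cvgM; first exact: cvg_cst.
    under eq_fun do rewrite expr0 mulr1; exact: cvg_threshold.
  - move=> n w; rewrite expr0 mulr1 normrM ler_piMr//.
    have /andP[v0 v1] := v01 s x w.
    have h0 : 0 <= v s x w ^+ n by rewrite exprn_ge0.
    have h1 : v s x w ^+ n <= 1 by rewrite exprn_ile1.
    rewrite ger0_norm; first by rewrite exprn_ile1 ?subr_ge0// gerBl.
    by rewrite exprn_ge0// subr_ge0.
  - exact/tame_integrable/tame_norm.
rewrite (_ : (fun _ => _) = cst 0); first by move=> /cvg_lim <- //; rewrite lim_cst.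
by apply/funext => n; rewrite Wv.
Qed.

Let mean_indic_cvg (f_ : nat -> T -> bool) (f : T -> bool) :
  (forall n, measurable_fun setT (fun w => (f_ n w)%:R : R)) ->
  measurable_fun setT (fun w => (f w)%:R : R) ->
  (forall w, \forall n \near \oo, f_ n w = f w) ->
  (forall n, E (fun w => W w * (f_ n w)%:R) = 0) ->
  E (fun w => W w * (f w)%:R) = 0.
Proof.
move=> mf_ mf ff f0.
have : E (fun w => W w * (f_ n w)%:R) @[n --> \oo] --> E (fun w => W w * (f w)%:R).
  apply: (@mean_dct _ _ _ _ _ _ (fun w => `|W w|)).
  - by move=> n; exact: measurable_funM.
  - exact: measurable_funM.
  - move=> w; apply: cvgM; first exact: cvg_cst.
    by apply: cvg_near_cst; have := ff w; apply: filterS => n ->.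
  - by move=> n w; rewrite normrM ler_piMr//; case: (f_ n w); rewrite /= ?normr0 ?normr1.
  - exact/tame_integrable/tame_norm.
rewrite (_ : (fun _ => _) = cst 0); first by move=> /cvg_lim <- //; rewrite lim_cst.
exact/funext.
Qed.

(** With frequency [1/L] and phase [-a/L], the condition [v < k] reads [cos (|Y-a|/L) < cos (r/L)],
    which is [r < |Y-a|] as soon as [|Y-a|/L <= pi]; each point satisfies this for large [L]. *)
Let W_dist a r : 0 < r -> E (fun w => W w * (r < `|Y w - a|)%R%:R) = 0.
Proof.
move=> r0; pose L n : R := n.+1%:R * (r + 1).
have L0 n : 0 < L n by rewrite mulr_gt0// addr_gt0.
have rL n : r / L n < 1.
  rewrite ltr_pdivrMr// mul1r /L (@lt_le_trans _ _ (r + 1))// ?ltrDl//.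
  by rewrite ler_peMl ?addr_ge0 ?(ltW r0)// ler1n.
have pi1 : 1 < pi :> R by have := @pi_ge2 R; lra.
pose k n := (1 + cos (r / L n)) / 2.
apply: (mean_indic_cvg (f_ := fun n w => v (L n)^-1 (- a / L n) w < k n)).
- by move=> n; apply: measurable_ltr_nat.
- apply: measurable_ltr_nat => //; apply: measurableT_comp => //.
  exact: measurable_funB.
- move=> w.
  have [N hN] : exists N : nat, `|Y w - a| <= N%:R.
    by exists (Num.truncn `|Y w - a|).+1; rewrite ltW// truncnS_gt.
  exists N => // n /= Nn; rewrite /v /k.
  rewrite (_ : _ * Y w + _ = (Y w - a) / L n); last by ring.
  rewrite -[in LHS](cos_norm ((Y w - a) / L n)) normrM normfV (gtr0_norm (L0 n)).
  have h1 : `|Y w - a| / L n <= 1.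
    rewrite ler_pdivrMr// mul1r (le_trans hN)// /L.
    have Nn1 : N%:R <= n.+1%:R :> R by rewrite ler_nat; exact: leqW.
    apply: le_trans Nn1 _.
    by rewrite ler_peMr// lerDr ltW.
  rewrite ltr_pM2r ?invr_gt0// ltrD2l ltr_cos ?ltr_pM2r ?invr_gt0//.
  + by rewrite in_itv/= divr_ge0//= ?ltW// (lt_trans (rL n)).
  + by rewrite in_itv/= divr_ge0//= ?(ltW (L0 n))// (le_trans h1)// ltW.
- move=> n; apply: W_threshold.
  have h2 : cos pi < cos (r / L n).
    rewrite ltr_cos ?in_itv/= ?lexx ?pi_ge0 ?andbT//; first by rewrite (lt_trans (rL n)).
    by rewrite divr_ge0//= ?ltW// (lt_trans (rL n)).
  have h3 : cos (r / L n) < cos 0.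
    rewrite ltr_cos ?in_itv/= ?lexx ?pi_ge0 ?andbT//; first by rewrite divr_gt0.
    by rewrite divr_ge0//= ?ltW// (lt_trans (rL n)).
  rewrite cospi in h2; rewrite cos0 in h3; rewrite /k; lra.
Qed.

(** The complement of the closed interval from [b] to [b + 2(n+1)] decreases to the open ray to the
    left of [b]. *)
Let W_ray b : E (fun w => W w * (Y w < b)%R%:R) = 0.
Proof.
apply: (mean_indic_cvg (f_ := fun n w => n.+1%:R < `|Y w - (b + n.+1%:R)|)).
- move=> n; apply: measurable_ltr_nat => //; apply: measurableT_comp => //.
  exact: measurable_funB.
- exact: measurable_ltr_nat.
- move=> w.
  have [N hN] : exists N : nat, `|Y w - b| <= N%:R.
    by exists (Num.truncn `|Y w - b|).+1; rewrite ltW// truncnS_gt.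
  exists N => // n /= Nn.
  have nN : `|Y w - b| <= n.+1%:R by rewrite (le_trans hN)// ler_nat; exact: leqW.
  move: nN; rewrite ler_norml => /andP[h1 h2].
  have [Yb|bY] := ltP (Y w) b.
    by rewrite ltr_normr; apply/orP; right; move: (n.+1%:R) => c in h1 h2 *; lra.
  apply/negbTE; rewrite -leNgt ler_norml.
  by move: (n.+1%:R) h1 h2 => c h1 h2; lra.
- by move=> n; exact: W_dist.
Qed.

Let set_integral B : measurable B ->
  E (fun w => W w * \1_B (Y w)) = fine (\int[P]_(w in Y @^-1` B) (W w)%:E)%E.
Proof.
move=> mB; rewrite [in RHS]integral_mkcond; congr fine; apply: eq_integral => w _.
rewrite restrict_EFin/= patchE indicE.
have -> : (w \in Y @^-1` B) = (Y w \in B) by apply/idP/idP => /set_mem h; exact/mem_set.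
by case: ifP; rewrite ?mulr1 ?mulr0.
Qed.

(** Fourier uniqueness for the signed measure of density [W], pushed forward by [Y]: open left rays
    are stable under intersection and generate the Borel sets, and Dynkin induction extends the
    vanishing from them. *)
Lemma cos_transform_zero B : measurable B -> E (fun w => W w * \1_B (Y w)) = 0.
Proof.
move=> mB; rewrite set_integral//.
have iW : P.-integrable setT (EFin \o W) by exact: tame_integrable.
have mYi A : measurable A -> measurable (Y @^-1` A).
  by move=> mA; rewrite -[X in measurable X]setTI; exact: mY.
have iWi A : measurable A -> P.-integrable (Y @^-1` A) (EFin \o W).
  by move=> mA; apply: integrableS iW => //; exact: mYi.
pose Q (A : set R) := measurable A -> (\int[P]_(w in Y @^-1` A) (W w)%:E = 0)%E.
suff : Q B by move=> /(_ mB) ->.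
have QT : Q setT.
  move=> _; rewrite preimage_setT.
  have : E W = 0.
    rewrite -[RHS](W_cos 0 0); apply: eq_Rintegral => w _.
    by rewrite mul0r addr0 cos0 mulr1.
  by rewrite /Rintegral => h; rewrite -[LHS]fineK ?h//; exact: integrable_fin_num.
have ME : @measurable _ R = <<s @RGenInftyO.G R >> by exact: RGenInftyO.measurableE.
have sB : (<<s @RGenInftyO.G R >>) B by rewrite -ME.
apply: (@dynkin_induction _ R (@RGenInftyO.G R) Q) sB => //.
- move=> _ _ [x ->] [y ->]; exists (Num.min x y).
  apply/seteqP; split=> z /=; rewrite !in_itv/= lt_min; first by move=> [-> ->].
  by move=> /andP[].
- move=> _ [x ->] mx.
  have : E (fun w => W w * \1_(`]-oo, x[%classic) (Y w)) = 0.
    rewrite -[RHS](W_ray x); apply: eq_Rintegral => w _.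
    by rewrite indicE mem_setE in_itv.
  rewrite set_integral// => h; rewrite -[LHS]fineK ?h//.
  by apply: integrable_fin_num; [exact: mYi|exact: iWi].
- move=> A mA QA _.
  have := QT measurableT; rewrite preimage_setT.
  rewrite -(setUv (Y @^-1` A)) integral_setU_EFin//.
  + by rewrite (QA mA) add0e preimage_setC.
  + exact: mYi.
  + exact/measurableC/mYi.
  + by rewrite setUv; exact: mW.
  + by apply/disj_setPS => w [].
- move=> F mF tF QF _; rewrite preimage_bigcup integral_bigcup//.
  + by rewrite eseries0// => i _ _; apply: QF.
  + by apply/trivIsetP => i j _ _ ij; rewrite -preimage_setI ((proj1 (@trivIsetP _ _ _ _) tF) i j)// preimage_set0.
  + by move=> k; exact: mYi.
  + rewrite -preimage_bigcup; apply: iWi; exact: bigcupT_measurable.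
Qed.

End cosine_transform.

(** * Isonormal processes *)

Section normal_law.
Context {R : realType}.

Lemma ge0_integral_normal_prob (m s : R) (f : R -> \bar R) : s != 0 ->
  measurable_fun setT f -> (forall x, 0 <= f x)%E ->
  (\int[normal_prob m s]_x f x =
   \int[lebesgue_measure]_x (f x * (normal_pdf m s x)%:E))%E.
Proof.
move=> s0 mf f0.
have dom := @normal_prob_dominates R m s.
rewrite -(Radon_Nikodym_SigmaFinite.change_of_variables dom)//.
have ir := Radon_Nikodym_SigmaFinite.f_integrable dom.
have mpdf : measurable_fun setT (fun x => (normal_pdf m s x)%:E).
  by apply/measurable_EFinP; exact: measurable_normal_pdf.
apply: ae_eq_integral => //.
- by apply: emeasurable_funM => //; exact: measurable_int ir.
- by apply: emeasurable_funM.
- apply: ae_eqe_mul2l; apply: integral_ae_eq => // A _ mA.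
  by rewrite -Radon_Nikodym_SigmaFinite.f_integral.
Qed.

Lemma normal_prob_mgf (m s t : R) : s != 0 ->
  (\int[normal_prob m s]_x (expR (t * x))%:E =
   (expR (m * t + s ^+ 2 * t ^+ 2 / 2))%:E)%E.
Proof.
move=> s0; rewrite ge0_integral_normal_prob//; last first.
  by apply/measurable_EFinP; apply: measurableT_comp => //.
(* Completing the square: tilting by [e^{tx}] shifts the mean to [m + s^2 t]. *)
transitivity (\int[lebesgue_measure]_x
  ((expR (m * t + s ^+ 2 * t ^+ 2 / 2))%:E * (normal_pdf (m + s ^+ 2 * t) s x)%:E))%E.
  apply: eq_integral => x _; rewrite -!EFinM; congr EFin.
  rewrite !normal_pdfE// mulrCA [RHS]mulrCA; congr (_ * _).
  rewrite /normal_fun -!expRD; congr expR; rewrite -mulr_natr.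
  by field.
rewrite ge0_integralZl//; first by rewrite integral_normal_pdf mule1.
- by apply/measurable_EFinP; exact: measurable_normal_pdf.
- by move=> x _; rewrite lee_fin normal_pdf_ge0.
Qed.

End normal_law.

Section law_integral.
Context {R : realType} d (T : measurableType d) (P : probability T R).

Lemma ge0_integral_has_law (Y : T -> R)
    (Q : {measure set (measurableTypeR R) -> \bar R})
    (f : R -> \bar R) : measurable_fun setT Y -> has_law P Y Q ->
  measurable_fun setT f -> (forall x, 0 <= f x)%E ->
  (\int[P]_w f (Y w) = \int[Q]_x f x)%E.
Proof.
move=> mY lY mf f0.
have mY' : measurable_fun setT (Y : T -> measurableTypeR R) by exact: mY.
have mf' : measurable_fun setT (f : measurableTypeR R -> \bar R) by exact: mf.
rewrite -(@ge0_integral_pushforward _ _ T (measurableTypeR R) R Y mY' P setT f)//.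
by apply: eq_measure_integral => A mA _; rewrite -lY.
Qed.

(** A single mgf formula covers Dirac masses through [s = 0]; the law is asserted for [s != 0] only,
    because [normal_prob m 0] is not a Dirac mass. *)
Lemma gaussian_mgf (Y : T -> R) : measurable_fun setT Y -> gaussian P Y ->
  exists m s, [/\ s != 0 -> has_law P Y (normal_prob m s), has_mgf P Y &
    forall t, \int[P]_w expR (t * Y w) = expR (m * t + s ^+ 2 * t ^+ 2 / 2)].
Proof.
move=> mY gY.
have [m [s [sL I]]] : exists m s, (s != 0 -> has_law P Y (normal_prob m s)) /\
   forall t, (\int[P]_w (expR (t * Y w))%:E =
     (expR (m * t + s ^+ 2 * t ^+ 2 / 2))%:E)%E.
  have mexp t : measurable_fun setT (fun x : R => (expR (t * x))%:E).
    by apply/measurable_EFinP; apply: measurableT_comp => //; exact: measurable_funM.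
  have pexp t (x : R) : (0 <= (expR (t * x))%:E)%E by rewrite lee_fin expR_ge0.
  case: gY => [[m [s [s0 lY]]]|[m lY]].
    exists m, s; split => // t.
    by rewrite -normal_prob_mgf// -(ge0_integral_has_law (Q := normal_prob m s) mY lY (mexp t) (pexp t)).
  exists m, 0; split => [|t]; first by rewrite eqxx.
  rewrite (ge0_integral_has_law (Q := \d_(m : measurableTypeR R)) mY lY (mexp t) (pexp t)).
  rewrite integral_dirac//; last exact: mexp.
  rewrite diracE in_setT mul1e.
  by rewrite expr0n/= mul0r mul0r addr0 mulrC.
have hm : has_mgf P Y.
  split => // t; apply/integrableP; split.
    apply/measurable_EFinP; apply: measurableT_comp => //; exact: measurable_funM.
  under eq_integral do rewrite /= ger0_norm ?expR_ge0//.
  by rewrite I ltry.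
by exists m, s; split => // t; rewrite /Rintegral I.
Qed.

Lemma mean_sqr_eq0 (f : T -> R) : tame P f -> \int[P]_w (f w ^+ 2) = 0 ->
  {ae P, forall w, f w = 0}.
Proof.
move=> tf f0.
have : (\int[P]_w `|(f w ^+ 2)%:E| = 0)%E.
  under eq_integral do rewrite /= ger0_norm ?sqr_ge0//.
  have fin : (\int[P]_w (f w ^+ 2)%:E)%E \is a fin_num.
    by apply: integrable_fin_num => //; exact: tame_integrableX.
  by rewrite -(fineK fin); congr EFin.
move=> /(ae_eq_integral_abs P measurableT _).1 h.
have /h : measurable_fun setT (fun w => (f w ^+ 2)%:E).
  by apply/measurable_EFinP; apply: measurable_funX; exact: tf.1.
apply: filterS => w /(_ I) [] /eqP.
by rewrite expf_eq0/= => /eqP.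
Qed.

End law_integral.

Section inner_product.
Context {R : realType} (H : normedModType R) (ip : H -> H -> R).
Hypothesis Hip : is_inner_product ip.

Lemma ipDl f g h : ip (f + g) h = ip f h + ip g h.
Proof. by have := ip_linear Hip 1 f g h; rewrite scale1r mul1r. Qed.

Lemma ip0l h : ip 0 h = 0.
Proof. by have := ipDl 0 0 h; rewrite addr0; lra. Qed.

Lemma ipZl a f h : ip (a *: f) h = a * ip f h.
Proof. by have := ip_linear Hip a f 0 h; rewrite addr0 ip0l addr0. Qed.

Lemma ipDr f g h : ip f (g + h) = ip f g + ip f h.
Proof. by rewrite !(ip_sym Hip f) ipDl. Qed.

Lemma ipZr a f h : ip f (a *: h) = a * ip f h.
Proof. by rewrite !(ip_sym Hip f) ipZl. Qed.

Lemma ip0r h : ip h 0 = 0.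
Proof. by rewrite (ip_sym Hip) ip0l. Qed.

Lemma ip_suml (I : Type) (s : seq I) (F : I -> H) h :
  ip (\sum_(i <- s) F i) h = \sum_(i <- s) ip (F i) h.
Proof.
by elim: s => [|i s ih]; rewrite ?big_nil ?ip0l// !big_cons ipDl ih.
Qed.

Lemma ip_sumr (I : Type) (s : seq I) (F : I -> H) h :
  ip h (\sum_(i <- s) F i) = \sum_(i <- s) ip h (F i).
Proof.
by elim: s => [|i s ih]; rewrite ?big_nil ?ip0r// !big_cons ipDr ih.
Qed.

End inner_product.

Section isonormal_theory.
Context {R : realType} (H : normedModType R) (ip : H -> H -> R).
Hypothesis Hip : is_inner_product ip.
Context d (T : measurableType d) (P : probability T R).
Variables (X : H -> {RV P >-> R}) (HX : isonormal ip X).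
Local Notation E f := (\int[P]_w f w).

Let mX h : measurable_fun setT (X h). Proof. exact: measurable_funP. Qed.

Let X_gaussian h : gaussian P (X h).
Proof.
have := isonormal_gaussian HX (fun _ : 'I_1 => 1) (fun _ => h).
by under eq_fun do rewrite big_ord1 mul1r.
Qed.

Lemma isonormal_has_mgf h : has_mgf P (X h).
Proof. by have [m [s []]] := gaussian_mgf (mX h) (X_gaussian h). Qed.

Lemma isonormal_tame h : tame P (X h).
Proof. exact: tame_mgf (isonormal_has_mgf h). Qed.

Lemma isonormal_mean_mul g h : E (fun w => X g w * X h w) = ip g h.
Proof. by have := isonormal_cov HX g h; rewrite unlock /Rintegral => ->. Qed.

(** The parameters are read off the mgf: [mgf_stein0] at [t = 0] gives [m = 0], and [mgf_stein] with
    exponent 1 gives [s^2] as the second moment. The sign of [s] stays undetermined. *)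
Let X_params h : exists s, [/\ s ^+ 2 = `|h| ^+ 2,
  s != 0 -> has_law P (X h) (normal_prob 0 s) &
  forall t, E (fun w => expR (t * X h w)) = expR (s ^+ 2 * t ^+ 2 / 2)].
Proof.
have [m [s [sL eX Xmgf]]] := gaussian_mgf (mX h) (X_gaussian h).
have m0 : m = 0.
  have := mgf_stein0 eX Xmgf 0.
  under eq_Rintegral do rewrite mul0r expR0 mulr1.
  under [in RHS]eq_Rintegral do rewrite mul0r expR0.
  rewrite mean_cst mulr0 addr0 mulr1 => <-.
  by have := isonormal_centered HX h; rewrite unlock /Rintegral => ->.
rewrite m0 in sL Xmgf.
have sh : s ^+ 2 = `|h| ^+ 2.
  have := mgf_stein eX Xmgf 1.
  under eq_Rintegral do rewrite expr1.
  under [in RHS]eq_Rintegral do rewrite mul0r add0r expr0 !mulr1.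
  by rewrite mean_cst isonormal_mean_mul (ip_norm Hip).
by exists s; split => // t; rewrite Xmgf mul0r add0r.
Qed.

Lemma isonormal_mgf h t : E (fun w => expR (t * X h w)) =
  expR (`|h| ^+ 2 * t ^+ 2 / 2).
Proof. by have [s [<-]] := X_params h. Qed.

(** Here [s] may be -1, but the density depends on [s] through [s^2] only. *)
Lemma isonormal_standard h : `|h| = 1 -> standard_gaussian P (X h).
Proof.
move=> h1; have [s [sh sL _]] := X_params h; rewrite h1 expr1n in sh.
have s0 : s != 0 by apply: contra_eq_neq sh => ->; rewrite expr0n eq_sym oner_eq0.
move=> A mA; rewrite (sL s0 A mA) /normal_prob; apply: eq_integral => x _; congr EFin.
by rewrite !normal_pdfE ?oner_eq0// /normal_peak /normal_fun sh expr1n.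
Qed.

(** Linearity is not an axiom: the square of the difference [D] expands by the covariance and has
    mean 0. The identity is therefore almost sure only, with an exceptional set that depends on [a],
    [f] and [g]. *)
Lemma isonormal_linear a f g :
  {ae P, forall w, X (a *: f + g) w = a * X f w + X g w}.
Proof.
have tX := isonormal_tame.
pose D w := X (a *: f + g) w - (a * X f w + X g w).
have tD : tame P D by apply: tameB => //; apply: tameD => //; exact: tameZ.
suff : {ae P, forall w, D w = 0}.
  by apply: filterS => w /eqP; rewrite subr_eq0 => /eqP.
apply: mean_sqr_eq0 => //.
have tXX u v : tame P (fun w => X u w * X v w) by exact: tameM.
pose h := a *: f + g.
transitivity (E (fun w => X h w * X h w + (- (2 * a) * (X h w * X f w) +
   (- 2 * (X h w * X g w) + (a ^+ 2 * (X f w * X f w) +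
   (2 * a * (X f w * X g w) + X g w * X g w)))))).
  by apply: eq_Rintegral => w _; rewrite /D -/h; ring.
do ! (rewrite ?meanD ?meanZ; do ?[by repeat first [exact: tXX | apply: tameZ | apply: tameD]]).
rewrite !isonormal_mean_mul /h !(ipDl Hip, ipZl Hip, ipDr Hip, ipZr Hip).
rewrite (ip_sym Hip g f). by ring.
Qed.

Lemma isonormal0 : {ae P, forall w, X 0 w = 0}.
Proof.
apply: mean_sqr_eq0; first exact: isonormal_tame.
by under eq_Rintegral do rewrite expr2; rewrite isonormal_mean_mul (ip0l Hip).
Qed.

Lemma isonormal_sum (I : Type) (s : seq I) (a : I -> R) (h : I -> H) :
  {ae P, forall w, X (\sum_(i <- s) a i *: h i) w = \sum_(i <- s) a i * X (h i) w}.
Proof.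
elim: s => [|i s ih].
  by have := isonormal0; apply: filterS => w; rewrite !big_nil.
have := isonormal_linear (a i) (h i) (\sum_(j <- s) a j *: h j).
by apply: filterS2 ih => w; rewrite !big_cons => -> ->.
Qed.

End isonormal_theory.

(** * Moments of diagonal quadratic forms *)

Section chaos_moments.
Context {R : realType}.
(* [E (N ^ 2 - 1) ^ i] for [i <= 8] and [N] standard Gaussian; large numerals
   are factored since they are unary. *)
Definition hermite_mean (i : nat) : R :=
  nth 0 [:: 1; 0; 2; 8; 60; 17 * 32; 40 * 151; 96 * (8 * 100 + 23);
    112 * (106 * 100 + 31)] i.

(* Moments [m] of a form with power sums [p] of its coefficients; its cumulants
   are [2 ^ (k - 1) (k - 1)! p k]. *)
Definition chaos_moments (m p : nat -> R) : Prop :=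
  [/\ [/\ m 0 = 1, m 1 = 0 & m 2 = 2 * p 2],
      m 3 = 8 * p 3,
      m 4 = 48 * p 4 + 12 * p 2 ^+ 2,
      m 5 = (3 * 128) * p 5 + 160 * p 2 * p 3 &
  [/\ m 6 = (15 * 256) * p 6 + (45 * 32) * p 4 * p 2 + (5 * 128) * p 3 ^+ 2 +
            120 * p 2 ^+ 3,
      m 7 = (45 * 4 ^+ 5) * p 7 + (63 * 256) * p 5 * p 2 +
            (105 * 128) * p 4 * p 3 + (105 * 32) * p 3 * p 2 ^+ 2 &
      m 8 = (315 * 2 ^+ 11) * p 8 + (105 * 2 ^+ 11) * p 6 * p 2 +
            (84 * 2 ^+ 11) * p 5 * p 3 + (315 * 256) * p 4 ^+ 2 +
            (315 * 128) * p 4 * p 2 ^+ 2 + (35 * 4 ^+ 5) * p 3 ^+ 2 * p 2 +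
            (105 * 16) * p 2 ^+ 4]].

(** The hypothesis is the binomial formula for adding an independent [x (N^2 - 1)]. The closed
    formulas survive because cumulants add, which in each degree is a polynomial identity. *)
Lemma chaos_moments_step (m m' p : nat -> R) (x : R) :
  (forall k, (k <= 8)%N -> m' k =
    \sum_(i < k.+1) 'C(k, i)%:R * x ^+ i * (m (k - i)%N * hermite_mean i)) ->
  chaos_moments m p -> chaos_moments m' (fun k => x ^+ k + p k).
Proof.
move=> step [[m0 m1 m2] m3 m4 m5 [m6 m7 m8]].
have {}step k : (k <= 8)%N -> m' k = \sum_(i <- iota 0 k.+1)
    'C(k, i)%:R * x ^+ i * (m (k - i)%N * hermite_mean i).
  by move=> k8; rewrite step// -(big_mkord xpredT
    (fun i => 'C(k, i)%:R * x ^+ i * (m (k - i)%N * hermite_mean i))) /index_iota subn0.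
rewrite /chaos_moments !step//.
rewrite unlock /= /hermite_mean /= /subn /= m0 m1 m2 m3 m4 m5 m6 m7 m8.
move: (p 2) (p 3) (p 4) (p 5) (p 6) (p 7) (p 8) => p2 p3 p4 p5 p6 p7 p8.
repeat match goal with |- context[binomial ?a ?b] =>
  let v := eval vm_compute in (binomial a b) in change (binomial a b) with v end.
by split; [split|..|split]; ring.
Qed.
End chaos_moments.

Section orthonormal_forms.
Context {R : realType} (H : normedModType R) (ip : H -> H -> R).
Hypothesis Hip : is_inner_product ip.
Context d (T : measurableType d) (P : probability T R).
Variables (X : H -> {RV P >-> R}) (HX : isonormal ip X).
Local Notation E f := (\int[P]_w f w).
Implicit Types (W : T -> R) (v g : H) (vs : seq H) (q : {poly R}).

Let tX h : tame P (X h). Proof. exact: isonormal_tame HX h. Qed.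

Lemma tame_poly q v : tame P (fun w => q.[X v w]).
Proof.
under eq_fun do rewrite horner_coef.
by apply: tame_sum => i; apply: tameZ; exact: tameX.
Qed.

Lemma isonormal_tame_expR g : tame P (fun w => expR (X g w)).
Proof.
have := tame_expR (isonormal_has_mgf HX g) 1.
by under eq_fun do rewrite mul1r.
Qed.

(* Independence of [W] from all [X g] with [g] orthogonal to [vs], tested on
   exponentials only. *)
Definition independent_of_ortho vs W : Prop := tame P W /\
  forall g, {in vs, forall v, ip v g = 0} ->
    E (fun w => W w * expR (X g w)) = E W * expR (`|g| ^+ 2 / 2).

(** The vector [t v + g] is again orthogonal to [vs], and [v] and [g] are orthogonal, so the mean of
    [W e^{X g} e^{t X v}] factors. Hence [W e^{X g} - c] annihilates every [e^{t X v}], and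
    [mgf_zero_moments] turns exponentials of [X v] into polynomials while [X g] stays exponential
    for the next induction step. *)
Lemma independent_of_ortho_mean vs W v q : independent_of_ortho vs W ->
  {in vs, forall u, ip u v = 0} ->
  forall g, {in v :: vs, forall u, ip u g = 0} ->
    E (fun w => W w * q.[X v w] * expR (X g w)) =
    E W * E (fun w => q.[X v w]) * expR (`|g| ^+ 2 / 2).
Proof.
move=> [tW IW] vvs g gv.
have tg := isonormal_tame_expR g.
have ev := isonormal_has_mgf HX v.
have tWg : tame P (fun w => W w * expR (X g w)) by exact: tameM.
pose c := E W * expR (`|g| ^+ 2 / 2).
have mono k : E (fun w => W w * X v w ^+ k * expR (X g w)) = c * E (fun w => X v w ^+ k).
  have tc : tame P (fun w => W w * expR (X g w) - c).
    by apply: tameB => //; exact: tame_cst.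
  have key t : E (fun w => (W w * expR (X g w) - c) * expR (t * X v w)) = 0.
    have te := tame_expR ev t.
    transitivity (E (fun w => W w * expR (X g w) * expR (t * X v w)
       - c * expR (t * X v w))).
      by apply: eq_Rintegral => w _; rewrite mulrBl.
    rewrite meanB ?meanZ; try by [exact: tameM|exact: tameZ|].
    have -> : E (fun w => W w * expR (X g w) * expR (t * X v w)) =
       E (fun w => W w * expR (X (t *: v + g) w)).
      apply: mean_ae.
      - exact: (tameM tWg te).1.
      - exact: (tameM tW (isonormal_tame_expR _)).1.
      have := isonormal_linear Hip HX t v g; apply: filterS => w ->.
      by rewrite -mulrA -expRD addrC.
    rewrite IW; last first.
      move=> u us; rewrite (ipDr Hip) (ipZr Hip) vvs// gv ?mulr0 ?addr0//.
      by rewrite inE us orbT.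
    rewrite (isonormal_mgf Hip HX) /c -!(ip_norm Hip).
    rewrite !(ipDl Hip, ipZl Hip, ipDr Hip, ipZr Hip).
    have vg : ip v g = 0 by rewrite gv// mem_head.
    rewrite (ip_sym Hip g v) vg.
    apply/eqP; rewrite subr_eq0; apply/eqP; rewrite -[RHS]mulrA -expRD.
    by congr (_ * expR _); field.
  have := mgf_zero_moments ev tc key k.
  have -> : E (fun w => (W w * expR (X g w) - c) * X v w ^+ k) =
      E (fun w => W w * X v w ^+ k * expR (X g w) - c * X v w ^+ k).
    by apply: eq_Rintegral => w _; ring.
  rewrite meanB ?meanZ; first by move/eqP; rewrite subr_eq0 => /eqP.
  - exact: tameX.
  - by apply: tameM => //; apply: tameM => //; exact: tameX.
  - by apply: tameZ; exact: tameX.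
have tk k : tame P (fun w => W w * X v w ^+ k * expR (X g w)).
  by apply: tameM => //; apply: tameM => //; exact: tameX.
transitivity (E (fun w => \sum_(i < size q) q`_i *
   (W w * X v w ^+ i * expR (X g w)))).
  apply: eq_Rintegral => w _; rewrite horner_coef mulr_sumr mulr_suml.
  by apply: eq_bigr => i _; ring.
rewrite mean_sum; last by move=> i; exact: tameZ.
transitivity (\sum_(i < size q) q`_i * (c * E (fun w => X v w ^+ i))).
  by apply: eq_bigr => i _; rewrite meanZ// mono.
transitivity (c * E (fun w => \sum_(i < size q) q`_i * X v w ^+ i)).
  rewrite mean_sum; last by move=> i; apply: tameZ; exact: tameX.
  rewrite mulr_sumr; apply: eq_bigr => i _; rewrite meanZ; last exact: tameX.
  by ring.
rewrite /c mulrAC; congr (_ * _ * _).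
by apply: eq_Rintegral => w _; rewrite horner_coef.
Qed.

Lemma independent_of_orthoM vs W v q : independent_of_ortho vs W ->
  {in vs, forall u, ip u v = 0} ->
  independent_of_ortho (v :: vs) (fun w => W w * q.[X v w]) /\
  E (fun w => W w * q.[X v w]) = E W * E (fun w => q.[X v w]).
Proof.
move=> IW vvs; have tq := tame_poly q v; have tW := IW.1.
have EWq : E (fun w => W w * q.[X v w]) = E W * E (fun w => q.[X v w]).
  (* At [g = 0] the exponential is almost surely 1, which leaves the plain factorisation. *)
  have /(independent_of_ortho_mean q IW vvs) : {in v :: vs, forall u, ip u 0 = 0}.
    by move=> u _; rewrite (ip0r Hip).
  rewrite normr0 expr0n/= mul0r expR0 mulr1 => <-.
  apply: mean_ae.
  - exact: (tameM tW tq).1.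
  - exact: (tameM (tameM tW tq) (isonormal_tame_expR _)).1.
  have := isonormal0 Hip HX; apply: filterS => w ->.
  by rewrite expR0 mulr1.
split=> //; split; first exact: tameM.
by move=> g gv; rewrite EWq (independent_of_ortho_mean q IW vvs gv).
Qed.

Lemma independent_of_ortho_sum vs (I : Type) (s : seq I) (c : I -> R)
    (F : I -> T -> R) : (forall i, independent_of_ortho vs (F i)) ->
  independent_of_ortho vs (fun w => \sum_(i <- s) c i * F i w).
Proof.
move=> IF; have tF i : tame P (F i) by exact: (IF i).1.
have tcF i : tame P (fun w => c i * F i w) by exact: tameZ.
split; first exact: tame_sum.
move=> g gv.
have te := isonormal_tame_expR g.
have tFe i : tame P (fun w => F i w * expR (X g w)) by exact: tameM.
transitivity (E (fun w => \sum_(i <- s) c i * (F i w * expR (X g w)))).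
  apply: eq_Rintegral => w _; rewrite mulr_suml; apply: eq_bigr => i _.
  by rewrite mulrA.
rewrite !mean_sum//; last by move=> i; exact: tameZ.
rewrite mulr_suml; apply: eq_bigr => i _; rewrite !meanZ// (IF i).2//.
by rewrite mulrA.
Qed.

Lemma isonormal_stein v q : E (fun w => X v w * q.[X v w]) =
  `|v| ^+ 2 * E (fun w => q^`().[X v w]).
Proof.
have ev := isonormal_has_mgf HX v.
have mgf t : E (fun w => expR (t * X v w)) = expR (0 * t + `|v| ^+ 2 * t ^+ 2 / 2).
  by rewrite mul0r add0r; exact: (isonormal_mgf Hip HX).
have st k : E (fun w => X v w * X v w ^+ k) = `|v| ^+ 2 * k%:R * E (fun w => X v w ^+ k.-1).
  rewrite (mgf_stein ev mgf) -meanZ; last exact: tameX.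
  by apply: eq_Rintegral => w _; rewrite mul0r add0r.
have tk k : tame P (fun w => X v w ^+ k) by exact: tameX.
have tXk k : tame P (fun w => X v w * X v w ^+ k) by exact: tameM.
transitivity (E (fun w => \sum_(i < size q) q`_i * (X v w * X v w ^+ i))).
  apply: eq_Rintegral => w _; rewrite horner_coef mulr_sumr.
  by apply: eq_bigr => i _; ring.
transitivity (E (fun w => \sum_(i < size q) (q`_i * i%:R) * X v w ^+ i.-1) * `|v| ^+ 2).
  rewrite !mean_sum; try by move=> i; exact: tameZ.
  rewrite mulr_suml; apply: eq_bigr => i _; rewrite !meanZ// st; ring.
rewrite mulrC; congr (_ * _); apply: eq_Rintegral => w _.
rewrite -[in RHS](coefK q) poly_def raddf_sum/= horner_sum; apply: eq_bigr => i _.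
rewrite derivZ derivXn hornerZ hornerMn hornerXn -[X in _ = _ * X]mulr_natl.
by rewrite mulrA.
Qed.

(** Integration by parts against [x (x^2 - 1)^{j+1}] yields the recursion
    [a_{j+2} = 2 (j+1) (a_{j+1} + a_j)]. *)
Lemma mean_hermite_pow v i : `|v| = 1 -> (i <= 8)%N ->
  E (fun w => (X v w ^+ 2 - 1) ^+ i) = hermite_mean i.
Proof.
move=> v1.
pose a j := E (fun w => (X v w ^+ 2 - 1) ^+ j).
have tq j : tame P (fun w => (X v w ^+ 2 - 1) ^+ j).
  by apply: tameX; apply: tameB; [exact: tameX|exact: tame_cst].
have a0 : a 0 = 1.
  by rewrite /a; under eq_Rintegral do rewrite expr0; rewrite mean_cst.
have st j := isonormal_stein v ('X * ('X ^+ 2 - 1%:P) ^+ j).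
have a1 : a 1 = 0.
  have := st 0%N; rewrite v1 expr1n mul1r expr0 mulr1 derivX.
  under [in RHS]eq_Rintegral do rewrite hornerC.
  rewrite mean_cst => h.
  transitivity (E (fun w => X v w * ('X : {poly R}).[X v w] - 1)).
    by apply: eq_Rintegral => w _; rewrite hornerX expr1 expr2.
  rewrite meanB ?h ?mean_cst ?subrr//; last exact: tame_cst.
  by apply: tameM => //; exact: tame_poly.
have rec j : a j.+2 = 2 * j.+1%:R * (a j.+1 + a j).
  have := st j.+1; rewrite v1 expr1n mul1r.
  have -> : E (fun w => X v w * ('X * ('X ^+ 2 - 1%:P) ^+ j.+1).[X v w]) =
      a j.+2 + a j.+1.
    rewrite -meanD//; apply: eq_Rintegral => w _.
    rewrite !(hornerM, horner_exp, hornerD, hornerN, hornerX, hornerC, hornerXn) -[j.+2]addn1 exprD expr1.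
    by set b := _ ^+ j.+1; ring.
  have -> : E (fun w => ('X * ('X ^+ 2 - 1%:P) ^+ j.+1)^`().[X v w]) =
      a j.+1 + 2 * j.+1%:R * (a j.+1 + a j).
    have tD := tameD (tq j.+1) (tq j).
    rewrite -(meanD (tq j.+1) (tq j)) -(meanZ _ tD) -(meanD (tq j.+1) (tameZ _ tD)).
    apply: eq_Rintegral => w _.
    rewrite derivM derivX mul1r deriv_exp derivB derivC subr0 derivXn.
    rewrite !(hornerM, horner_exp, hornerD, hornerN, hornerX, hornerC, hornerXn, hornerMn) exprS.
    by set b := _ ^+ j; set n := j.+1%:R; ring.
  by move/eqP; rewrite addrC => /eqP /addrI.
rewrite -/(a i) /hermite_mean.
have a2 : a 2 = 2 by rewrite rec a1 a0; ring.
have a3 : a 3 = 8 by rewrite rec a2 a1; ring.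
have a4 : a 4 = 60 by rewrite rec a3 a2; ring.
have a5 : a 5 = 17 * 32 by rewrite rec a4 a3; ring.
have a6 : a 6 = 40 * 151 by rewrite rec a5 a4; ring.
have a7 : a 7 = 96 * (8 * 100 + 23) by rewrite rec a6 a5; ring.
have a8 : a 8 = 112 * (106 * 100 + 31) by rewrite rec a7 a6; ring.
by case: i => [|[|[|[|[|[|[|[|[|]]]]]]]]].
Qed.

Definition orthonormal_seq vs : Prop :=
  uniq vs /\ {in vs &, forall u v, ip u v = (u == v)%:R}.

Lemma orthonormal_seq_norm vs v : orthonormal_seq vs -> v \in vs -> `|v| = 1.
Proof.
move=> [_ o] vvs; have := o _ _ vvs vvs; rewrite eqxx (ip_norm Hip) => /eqP.
by rewrite -[X in _ == X](expr1n _ 2) eqrXn2// => /eqP.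
Qed.

Lemma orthonormal_seq_cons v vs : orthonormal_seq (v :: vs) ->
  [/\ orthonormal_seq vs, `|v| = 1 & {in vs, forall u, ip u v = 0}].
Proof.
move=> ovs; have v1 := orthonormal_seq_norm ovs (mem_head _ _).
case: ovs => /= /andP[vvs uvs] o; split => //.
  by split => // x y xs ys; apply: o; rewrite inE ?xs ?ys orbT.
move=> u us; rewrite o ?mem_head ?inE ?us ?orbT//.
by case: eqP => // uv; rewrite uv (negbTE vvs) in us.
Qed.

(** Coefficients are indexed by the vectors themselves, so that induction on the list needs no
    reindexing. *)
Definition chaos_form (l : H -> R) vs (w : T) : R :=
  \sum_(v <- vs) l v * (X v w ^+ 2 - 1).

Lemma tame_chaos_form l vs : tame P (chaos_form l vs).
Proof.
apply: tame_sum => v; apply: tameZ.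
by apply: tameB; [exact: tameX|exact: tame_cst].
Qed.

(** The binomial expansion isolates the newest vector, whose polynomial factor
    [independent_of_orthoM] absorbs. *)
Lemma chaos_form_independent l vs k : orthonormal_seq vs ->
  independent_of_ortho vs (fun w => chaos_form l vs w ^+ k).
Proof.
elim: vs k => [|v vs ih] k ovs.
  split; first by apply: tameX; exact: tame_chaos_form.
  move=> g _; rewrite /chaos_form.
  under eq_Rintegral do rewrite big_nil.
  under [in RHS]eq_Rintegral do rewrite big_nil.
  rewrite meanZ; last exact: isonormal_tame_expR.
  rewrite mean_cst; congr (_ * _).
  have := isonormal_mgf Hip HX g 1.
  by under eq_Rintegral do rewrite mul1r; rewrite expr1n mulr1.
have [ovs' v1 vvs] := orthonormal_seq_cons ovs.
rewrite (_ : (fun _ => _) = (fun w => \sum_(i < k.+1) ('C(k, i)%:R * l v ^+ i) *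
   (chaos_form l vs w ^+ (k - i) * (('X ^+ 2 - 1%:P) ^+ i : {poly R}).[X v w]))).
  apply: independent_of_ortho_sum => i.
  exact: (independent_of_orthoM _ (ih (k - i)%N ovs') vvs).1.
apply/funext => w; rewrite /chaos_form big_cons addrC exprDn.
apply: eq_bigr => i _; rewrite !(hornerM, horner_exp, hornerD, hornerN, hornerX, hornerC, hornerXn) exprMn -[LHS]mulr_natl.
by ring.
Qed.

Lemma mean_chaos_form_pow l v vs k : orthonormal_seq (v :: vs) -> (k <= 8)%N ->
  E (fun w => chaos_form l (v :: vs) w ^+ k) =
  \sum_(i < k.+1) 'C(k, i)%:R * l v ^+ i *
     (E (fun w => chaos_form l vs w ^+ (k - i)) * hermite_mean i).
Proof.
move=> ovs k8; have [ovs' v1 vvs] := orthonormal_seq_cons ovs.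
pose q i : {poly R} := ('X ^+ 2 - 1%:P) ^+ i.
have EM i := independent_of_orthoM (q i) (chaos_form_independent l (k - i) ovs') vvs.
transitivity (E (fun w => \sum_(i < k.+1) ('C(k, i)%:R * l v ^+ i) *
   (chaos_form l vs w ^+ (k - i) * (q i).[X v w]))).
  apply: eq_Rintegral => w _; rewrite /chaos_form big_cons addrC exprDn.
  apply: eq_bigr => i _; rewrite !(hornerM, horner_exp, hornerD, hornerN, hornerX, hornerC, hornerXn) exprMn -[LHS]mulr_natl.
  by ring.
rewrite mean_sum; last by move=> i; apply: tameZ; exact: (EM i).1.1.
apply: eq_bigr => i _; rewrite meanZ; last exact: (EM i).1.1.
rewrite (EM i).2 -(mean_hermite_pow v1); last by rewrite (leq_trans _ k8)// -ltnS.
by congr (_ * (_ * _)); apply: eq_Rintegral => w _; rewrite !(hornerM, horner_exp, hornerD, hornerN, hornerX, hornerC, hornerXn).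
Qed.

Lemma mean_chaos_form l vs : orthonormal_seq vs ->
  chaos_moments (fun k => E (fun w => chaos_form l vs w ^+ k))
    (fun k => \sum_(v <- vs) l v ^+ k).
Proof.
elim: vs => [|v vs ih] ovs.
  have H0 k : E (fun w => chaos_form l [::] w ^+ k) = (0 : R) ^+ k.
    by rewrite /chaos_form; under eq_Rintegral do rewrite big_nil; rewrite mean_cst.
  by rewrite /chaos_moments !big_nil !H0; repeat split; ring.
have [ovs' _ _] := orthonormal_seq_cons ovs.
have -> : (fun k => \sum_(u <- v :: vs) l u ^+ k) =
    (fun k => l v ^+ k + \sum_(u <- vs) l u ^+ k).
  by apply/funext => k; rewrite big_cons.
apply: (chaos_moments_step _ (ih ovs')) => k k8.
exact: mean_chaos_form_pow.
Qed.

End orthonormal_forms.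

(** * The real spectral theorem *)

(** Over the complex numbers a real symmetric matrix is hermitian, so its spectral diagonal is real;
    being a root of the characteristic polynomial then descends to the real field. *)
Lemma symmetric_eigenvalue (R : rcfType) n (A : 'M[R]_n.+1) : A^T = A ->
  exists a, eigenvalue A a.
Proof.
move=> AT; pose C : numClosedFieldType := R[i].
pose f : {rmorphism R -> C} := real_complex R.
pose B : 'M[C]_n.+1 := map_mx f A.
have Bherm : B \is hermsymmx.
  apply: realsym_hermsym.
    by apply/is_hermitianmxP; rewrite expr0 scale1r map_mx_id// /B map_trmx AT.
  by apply/mxOverP => i j; rewrite mxE; apply/complex_realP; exists (A i j).
have Breal := hermitian_spectral_diag_real Bherm.
have /hermitian_normalmx/orthomx_spectralP BE := Bherm.
have Punit := spectral_unit B.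
pose a := spectral_diag B 0 0.
have /complex_realP [b ab] : a \is Num.real by apply/mxOverP.
exists b.
suff : eigenvalue B a.
  rewrite !eigenvalue_root_char ab -[char_poly B]/(char_poly (map_mx f A)).
  by rewrite -map_char_poly fmorph_root.
apply/eigenvalueP; exists (row 0 (spectralmx B)).
  have PB : spectralmx B *m B = diag_mx (spectral_diag B) *m spectralmx B.
    by have := congr1 (mulmx (spectralmx B)) BE; rewrite !mulmxA mulmxV// mul1mx.
  by apply/rowP => j; rewrite -row_mul PB mul_diag_mx !mxE.
apply/eqP => P0; have : row 0 (spectralmx B *m invmx (spectralmx B)) = 0.
  by rewrite row_mul P0 mul0mx.
by rewrite mulmxV// => /rowP /(_ 0); rewrite !mxE eqxx => /eqP; rewrite oner_eq0.
Qed.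

(** The reflection [1 - 2 w^T w / |w|^2] with [w = v - e] exchanges [v] and the first basis vector
    [e]; the case [v = e], where [w = 0], is served by the identity. *)
Lemma householder (R : rcfType) n (v : 'rV[R]_(1 + n)) : v *m v^T = 1%:M ->
  exists W : 'M[R]_(1 + n), W *m W^T = 1%:M /\ row 0 W = v.
Proof.
move=> vv; pose e : 'rV[R]_(1 + n) := delta_mx 0 0.
have ee : e *m e^T = 1%:M.
  by rewrite trmx_delta mul_delta_mx; apply/matrixP => i j; rewrite !ord1 !mxE eqxx.
have [->|ve] := eqVneq v e.
  by exists 1%:M; split; [rewrite trmx1 mulmx1|rewrite row1].
pose w := v - e; pose s := (w *m w^T) 0 0.
have sE : w *m w^T = s%:M by rewrite [LHS]mx11_scalar.
have s0 : s != 0.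
  apply: contra_neq ve => s0; apply/eqP; rewrite -subr_eq0; apply/eqP/rowP => i.
  rewrite [RHS]mxE; have := s0; rewrite /s mxE => /eqP.
  rewrite psumr_eq0; last by move=> j _; rewrite !mxE -expr2 sqr_ge0.
  move=> /allP /(_ i); rewrite mem_index_enum => /(_ isT).
  by rewrite /= !mxE -expr2 sqrf_eq0 => /eqP.
pose W : 'M[R]_(1 + n) := 1%:M - (2 / s) *: (w^T *m w).
have WT : W^T = W.
  by rewrite /W linearB/= trmx1 linearZ/= trmx_mul trmxK.
have QQ : (w^T *m w) *m (w^T *m w) = s *: (w^T *m w).
  by rewrite -mulmxA [w *m _]mulmxA sE mul_scalar_mx scalemxAr.
have ve_sym : (e *m v^T) 0 0 = (v *m e^T) 0 0.
  by rewrite -[in LHS](trmxK e) -trmx_mul mxE.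
have sv : s = 2 - 2 * (v *m e^T) 0 0.
  rewrite /s /w linearB/= mulmxBl !mulmxBr vv ee.
  move: (v *m e^T) (e *m v^T) ve_sym => x y yx.
  by rewrite !mxE yx eqxx /=; ring.
exists W; split.
  pose N := (2 / s) *: (w^T *m w).
  have NN : N *m N = N + N.
    rewrite /N -scalemxAl -scalemxAr QQ !scalerA -scalerDl; congr (_ *: _).
    by field.
  rewrite WT /W -/N mulmxBl mul1mx.
  by rewrite mulmxBr mulmx1 NN opprB addrK subrK.
have ew : (e *m w^T) 0 0 = - s / 2.
  have -> : e *m w^T = e *m v^T - 1%:M.
    by rewrite /w [(v - e)^T]linearB/= mulmxBr ee.
  rewrite sv; move: (v *m e^T) (e *m v^T) ve_sym => x y yx.
  by rewrite !mxE yx eqxx /=; field.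
have -> : row 0 W = e *m W by rewrite rowE.
rewrite /W mulmxBr mulmx1 -scalemxAr mulmxA.
rewrite [e *m w^T]mx11_scalar mul_scalar_mx scalerA ew.
rewrite (_ : 2 / s * _ = -1); last by field.
by rewrite scaleN1r opprK /w addrC subrK.
Qed.

(** Deflation: a unit eigenvector becomes the first row of an orthogonal [W], so the first row of
    [W A W^T] is a multiple of the first basis vector; by symmetry so is its first column, and the
    induction applies to the remaining block. *)
Lemma real_spectral (R : rcfType) n (A : 'M[R]_n) : A^T = A ->
  exists (O : 'M[R]_n) (d : 'rV[R]_n),
    O *m O^T = 1%:M /\ A = O^T *m diag_mx d *m O.
Proof.
elim: n A => [|n IH] A AT.
  by exists 1%:M, 0; split; apply/matrixP; case.
have [a /eigenvalueP[v vA v0]] := symmetric_eigenvalue AT.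
pose s := (v *m v^T) 0 0.
have s0 : 0 < s.
  rewrite /s mxE lt_def sumr_ge0 ?andbT; last first.
    by move=> j _; rewrite !mxE -expr2 sqr_ge0.
  rewrite psumr_eq0; last by move=> j _; rewrite !mxE -expr2 sqr_ge0.
  apply: contra v0 => /allP h; apply/eqP/rowP => i; rewrite [RHS]mxE.
  have := h i; rewrite mem_index_enum => /(_ isT).
  by rewrite /= !mxE -expr2 sqrf_eq0 => /eqP.
pose u : 'rV[R]_(1 + n) := (Num.sqrt s)^-1 *: v.
have uA : u *m A = a *: u by rewrite -scalemxAl vA !scalerA mulrC.
have uu : u *m u^T = 1%:M.
  rewrite linearZ/= -scalemxAl -scalemxAr scalerA -expr2 exprVn sqr_sqrtr ?ltW//.
  by rewrite [v *m _]mx11_scalar -/s scale_scalar_mx mulVf// gt_eqF.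
have [W [WW rW]] := householder uu.
have WTW : W^T *m W = 1%:M by apply: mulmx1C.
pose B : 'M[R]_(1 + n) := W *m (A : 'M[R]_(1 + n)) *m W^T.
have BT : B^T = B by rewrite /B !trmx_mul trmxK AT mulmxA.
have rB : row 0 B = a *: delta_mx 0 0.
  rewrite /B -mulmxA row_mul rW mulmxA uA -scalemxAl -rW -row_mul WW.
  by rewrite row1.
have AB : (A : 'M[R]_(1 + n)) = W^T *m B *m W.
  by rewrite /B !mulmxA WTW mul1mx -mulmxA WTW mulmx1.
clearbody B.
have l0 : lshift n 0 = 0 :> 'I_(1 + n) by exact/val_inj.
have Bur : ursubmx B = 0.
  apply/rowP => j; rewrite [RHS]mxE.
  have /rowP/(_ (rshift 1 j)) := rB.
  by rewrite !mxE/= l0 => ->; rewrite mulr0.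
have Bdl : dlsubmx B = 0.
  by rewrite -[LHS]trmxK trmx_dlsub BT Bur trmx0.
have Bul : ulsubmx B = a%:M.
  apply/matrixP => i j; rewrite !ord1.
  have /rowP/(_ (lshift n 0)) := rB.
  by rewrite !mxE/= l0 => ->; rewrite /= mulr1 mulr1n.
have B'T : (drsubmx B)^T = drsubmx B by rewrite trmx_drsub BT.
have [V [d' [OO BE]]] := IH _ B'T.
pose K : 'M[R]_(1 + n) := block_mx 1%:M 0 0 V.
have BK : B = K^T *m diag_mx (row_mx a%:M d') *m K.
  rewrite -[LHS]submxK Bur Bdl Bul {1}BE /K tr_block_mx !trmx0 trmx1.
  rewrite diag_mx_row !mulmx_block.
  rewrite !(mulmx0, mul0mx, mulmx1, mul1mx, addr0, add0r).
  congr block_mx; apply/matrixP => i j; by rewrite !ord1 !mxE eqxx.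
have KK : K *m K^T = 1%:M.
  rewrite /K tr_block_mx !trmx0 trmx1 mulmx_block.
  by rewrite !(mulmx0, mul0mx, mulmx1, addr0, add0r) OO -scalar_mx_block.
exists (K *m W), (row_mx a%:M d'); split.
  rewrite trmx_mul mulmxA -[K *m W *m _]mulmxA WW mulmx1.
  exact: KK.
rewrite trmx_mul !mulmxA -[W^T *m K^T *m _]mulmxA -[W^T *m _ *m K]mulmxA -BK.
exact: AB.
Qed.

(** * Diagonalization of the second chaos *)

Section chaos_diagonalization.
Context {R : realType} (H : normedModType R) (ip : H -> H -> R).
Hypothesis Hip : is_inner_product ip.
Context d (T : measurableType d) (P : probability T R).
Variables (X : H -> {RV P >-> R}) (HX : isonormal ip X).
Local Notation E f := (\int[P]_w f w).

(** A vector with zero residual leaves the family unchanged, so dependent inputs are allowed. The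
    expansion of each [h] is what turns squares of [X h] into a quadratic form in orthonormal
    Gaussians. *)
Lemma gram_schmidt (hs : seq H) : exists2 us, orthonormal_seq ip us &
  {in hs, forall h, h = \sum_(u <- us) ip h u *: u}.
Proof.
elim: hs => [|h hs [us [uu ou] hus]]; first by exists [::].
pose r := h - \sum_(u <- us) ip h u *: u.
have ru : {in us, forall u, ip r u = 0}.
  move=> u uus; rewrite /r (ipDl Hip) -scaleN1r (ipZl Hip) (ip_suml Hip).
  rewrite (bigD1_seq u)//= (ipZl Hip) (ou u u)// eqxx big_seq_cond big1 ?addr0 /=.
    by ring.
  move=> v /andP[vus vu]; rewrite (ipZl Hip) (ou v u)//.
  by rewrite (negbTE vu) mulr0.
have [r0|r0] := eqVneq r 0.
  exists us => // g; rewrite inE => /predU1P[->|]; last exact: hus.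
  by apply/eqP; rewrite -subr_eq0 -/r r0.
have nr : 0 < `|r| by rewrite normr_gt0.
pose e := `|r|^-1 *: r.
have eu u : u \in us -> ip e u = 0 by move=> uus; rewrite /e (ipZl Hip) ru// mulr0.
have ee : ip e e = 1.
  rewrite /e (ipZl Hip) (ipZr Hip) (ip_norm Hip); field.
  by rewrite gt_eqF.
exists (e :: us).
  split=> /=.
    rewrite uu andbT; apply/negP => /eu; rewrite ee => /eqP.
    by rewrite oner_eq0.
  move=> x y; rewrite !inE => /predU1P[->|xus] /predU1P[->|yus].
  - by rewrite ee eqxx.
  - rewrite eu//; case: eqP => // ey; have := eu _ yus.
    by rewrite -ey ee => /eqP; rewrite oner_eq0.
  - rewrite (ip_sym Hip) eu//; case: eqP => // xe; have := eu _ xus.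
    by rewrite xe ee => /eqP; rewrite oner_eq0.
  - exact: ou.
move=> g; rewrite inE big_cons => /predU1P[->|gh].
  have -> : ip h e = `|r|.
    rewrite -{1}[h](subrK (\sum_(u <- us) ip h u *: u)) -/r (ipDl Hip) (ip_suml Hip).
    rewrite big_seq big1 ?addr0; last first.
      by move=> u us_; rewrite (ipZl Hip) (ip_sym Hip u e) eu// mulr0.
    rewrite /e (ipZr Hip) (ip_norm Hip); field.
    by rewrite gt_eqF.
  by rewrite /e scalerA divff ?gt_eqF// scale1r /r subrK.
have -> : ip g e = 0.
  rewrite (hus _ gh) (ip_suml Hip) big_seq big1// => u us_.
  by rewrite (ipZl Hip) (ip_sym Hip u e) eu// mulr0.
by rewrite scale0r add0r; exact: hus.
Qed.

Lemma chaos_diagonalization (m : nat) (c : 'I_m -> R) (h : 'I_m -> H) :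
  (forall i, `|h i| = 1) ->
  exists (vs : seq H) (l : H -> R), orthonormal_seq ip vs /\
  {ae P, forall w, \sum_(i < m) c i * (X (h i) w ^+ 2 - 1) = chaos_form X l vs w}.
Proof.
move=> h1; have [us [uu ou] hus] := gram_schmidt [seq h i | i <- enum 'I_m].
pose r := size us; pose u (j : 'I_r) := us`_j.
pose b i j := ip (h i) (u j).
have hE i : h i = \sum_(j < r) b i j *: u j.
  have hi : h i \in [seq h i | i <- enum 'I_m] by apply: map_f; rewrite mem_enum.
  by rewrite {1}(hus _ hi) (big_nth 0) big_mkord.
have uuE j k : ip (u j) (u k) = (j == k)%:R.
  by rewrite ou ?mem_nth// nth_uniq.
pose M : 'M[R]_r := \matrix_(j, k) \sum_(i < m) c i * b i j * b i k.
have MT : M^T = M.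
  apply/matrixP => j k; rewrite !mxE; apply: eq_bigr => i _; by ring.
have [Q [D [QQ ME]]] := real_spectral MT.
pose v k := \sum_(j < r) Q k j *: u j.
have vv k k' : ip (v k) (v k') = (k == k')%:R.
  have := congr1 (fun N : 'M[R]_r => N k k') QQ; rewrite !mxE => <-.
  rewrite /v (ip_suml Hip); apply: eq_bigr => j _.
  rewrite (ipZl Hip) (ip_sumr Hip) (bigD1 j)//= (ipZr Hip) uuE eqxx mulr1.
  rewrite big1 ?addr0 ?mxE// => i ij.
  by rewrite (ipZr Hip) uuE eq_sym (negbTE ij) mulr0.
have vinj : injective v.
  move=> k k' vk; have := vv k k'; rewrite vk vv eqxx; case: eqP => // _ /eqP.
  by rewrite oner_eq0.
have nv k : `|v k| = 1.
  have := vv k k; rewrite eqxx (ip_norm Hip) => /eqP.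
  by rewrite -[X in _ == X](expr1n _ 2) eqrXn2// => /eqP.
pose vs := [seq v k | k <- enum 'I_r].
(* The coefficients must be a function on [H]: this quadratic form returns the eigenvalue [D 0 k] at
   [v k] without inverting the indexing. *)
pose l g := \sum_(k < r) D 0 k * ip g (v k) ^+ 2.
have lv k : l (v k) = D 0 k.
  rewrite /l (bigD1 k)//= vv eqxx expr1n mulr1 big1 ?addr0// => i ik.
  by rewrite vv eq_sym (negbTE ik) expr0n/= mulr0.
exists vs, l; split.
  split; first by rewrite map_inj_uniq// enum_uniq.
  move=> _ _ /mapP[k _ ->] /mapP[k' _ ->].
  by rewrite vv (inj_eq vinj).
have formE w : chaos_form X l vs w = \sum_(k < r) D 0 k * (X (v k) w ^+ 2 - 1).
  rewrite /chaos_form big_map big_enum/=.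
  by apply: eq_bigr => k _; rewrite lv.
have sqE : {ae P, forall w, \sum_(i < m) c i * X (h i) w ^+ 2 =
    \sum_(k < r) D 0 k * X (v k) w ^+ 2}.
  have aeh : {ae P, forall w i, X (h i) w = \sum_(j < r) b i j * X (u j) w}.
    apply: filter_forall => i; have := isonormal_sum Hip HX (index_enum 'I_r) (b i) u.
    by rewrite -hE.
  have aev : {ae P, forall w k, X (v k) w = \sum_(j < r) Q k j * X (u j) w}.
    by apply: filter_forall => k; exact: (isonormal_sum Hip HX).
  apply: filterS2 aeh aev => w Xh Xv.
  pose x : 'rV[R]_r := \row_j X (u j) w.
  transitivity ((x *m M *m x^T) 0 0).
    rewrite !mxE.
    transitivity (\sum_(i < m) \sum_(k < r) \sum_(j < r)
        x 0 j * (c i * b i j * b i k) * x 0 k).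
      apply: eq_bigr => i _; rewrite Xh expr2 mulrA mulr_sumr; apply: eq_bigr => k _.
      rewrite mulrAC mulr_sumr; apply: eq_bigr => j _.
      by rewrite !mxE; ring.
    rewrite exchange_big/=; apply: eq_bigr => k _; rewrite !mxE.
    rewrite exchange_big/= mulr_suml; apply: eq_bigr => j _.
    by rewrite !mxE mulr_sumr mulr_suml.
  have -> : x *m M *m x^T = (x *m Q^T) *m diag_mx D *m (x *m Q^T)^T.
    by rewrite ME trmx_mul trmxK !mulmxA.
  rewrite mxE; apply: eq_bigr => k _; rewrite Xv mul_mx_diag !mxE.
  have -> : \sum_(j < r) x 0 j * Q^T j k = \sum_(j < r) Q k j * X (u j) w.
    by apply: eq_bigr => j _; rewrite !mxE mulrC.
  by ring.
have tX := isonormal_tame HX.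
(* The constants [-1] match because the traces do. Taking expectations in [sqE] proves this, since
   [X g ^+ 2] has mean 1 for unit [g]. *)
have trE : \sum_(i < m) c i = \sum_(k < r) D 0 k.
  have XX g : `|g| = 1 -> E (fun w => X g w ^+ 2) = 1.
    move=> g1; under eq_Rintegral do rewrite expr2.
    by rewrite (isonormal_mean_mul HX) (ip_norm Hip) g1 expr1n.
  transitivity (E (fun w => \sum_(i < m) c i * X (h i) w ^+ 2)).
    rewrite mean_sum; last by move=> i; apply: tameZ; exact: tameX.
    by apply: eq_bigr => i _; rewrite meanZ ?XX ?mulr1//; exact: tameX.
  transitivity (E (fun w => \sum_(k < r) D 0 k * X (v k) w ^+ 2)).
    apply: mean_ae => //.
    - by apply: measurable_sum => i; apply: measurable_funM => //; exact: measurable_funX.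
    - by apply: measurable_sum => i; apply: measurable_funM => //; exact: measurable_funX.
  rewrite mean_sum; last by move=> i; apply: tameZ; exact: tameX.
  by apply: eq_bigr => i _; rewrite meanZ ?XX ?mulr1//; exact: tameX.
apply: filterS sqE => w sw; rewrite formE.
under eq_bigr do rewrite mulrBr mulr1.
under [RHS]eq_bigr do rewrite mulrBr mulr1.
by rewrite !sumrB sw trE.
Qed.

End chaos_diagonalization.

(** * Approximation by normalised forms and the eighth moment *)

Section power_inequalities.
Context {R : realType}.
Implicit Types x y A e : R.

(** If both arguments are at most [A] in absolute value, [6 A^5 |x - y|] bounds the difference, and
    [2 b <= e + b^2 / e] with [b = 3 A^5 |x - y|] makes it quadratic. Otherwise the larger one
    exceeds [A], and since [p + 2 <= 8] the eighth powers can pay for the factor [A^2]. *)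
Lemma pow_sub_le (p : nat) x y A e : (p <= 6)%N -> ~~ odd p -> 1 <= A -> 0 < e ->
  `|x ^+ p - y ^+ p| <=
    e + 9 * A ^+ 10 / e * (x - y) ^+ 2 + (x ^+ 8 + y ^+ 8) / A ^+ 2.
Proof.
move=> p6 podd A1 e0.
have A0 : 0 < A by rewrite (lt_le_trans ltr01).
have e8 (z : R) : 0 <= z ^+ 8 by rewrite exprn_even_ge0.
pose M := Num.max `|x| `|y|.
have M0 : 0 <= M by rewrite le_max normr_ge0.
have xM : `|x| <= M by rewrite le_max lexx.
have yM : `|y| <= M by rewrite le_max lexx orbT.
have [MA|AM] := leP M A.
  have d0 := normr_ge0 (x - y).
  have h : `|x ^+ p - y ^+ p| <= `|x - y| * (6 * A ^+ 5).
    rewrite subrXX normrM ler_wpM2l// (le_trans (ler_norm_sum _ _ _))//.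
    apply: (@le_trans _ _ (\sum_(i < p) A ^+ 5)).
      apply: ler_sum => i _; rewrite normrM !normrX.
      apply: (@le_trans _ _ (A ^+ (p.-1 - i) * A ^+ i)).
        rewrite ler_pM ?exprn_ge0// lerXn2r ?nnegrE ?(ltW A0)//.
          by rewrite (le_trans xM).
        by rewrite (le_trans yM).
      rewrite -exprD ler_weXn2l// subnK; last first.
        by rewrite -ltnS (leq_trans (ltn_ord i))// leqSpred.
      by have := leq_sub2r 1 p6; rewrite subn1.
    rewrite sumr_const card_ord -[leLHS]mulr_natl ler_wpM2r ?exprn_ge0 ?(ltW A0)//.
    by rewrite ler_nat.
  apply: (le_trans h); rewrite -(real_normK (num_real (x - y))).
  have e8x := e8 x; have e8y := e8 y.
  have h2 : 0 <= (x ^+ 8 + y ^+ 8) / A ^+ 2.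
    by rewrite divr_ge0 ?addr_ge0// exprn_ge0// ltW.
  rewrite -[leLHS]addr0 lerD//.
  have -> : 9 * A ^+ 10 / e * `|x - y| ^+ 2 = (3 * A ^+ 5 * `|x - y|) ^+ 2 / e.
    by field; rewrite gt_eqF.
  move: (`|x - y|) (A ^+ 5) => a b.
  rewrite -(ler_pM2r e0) [leRHS]mulrDl divfK ?gt_eqF//.
  by have := sqr_ge0 (e - 3 * b * a); nra.
have Ax : 0 <= 9 * A ^+ 10 / e * (x - y) ^+ 2.
  by rewrite mulr_ge0 ?sqr_ge0// divr_ge0 ?(ltW e0)// mulr_ge0// exprn_ge0// ltW.
rewrite -[leLHS]add0r lerD ?addr_ge0 ?(ltW e0)//.
have M8 : M ^+ 8 <= x ^+ 8 + y ^+ 8.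
  rewrite /M; case: (leP `|x| `|y|) => _; rewrite -normrX ger0_norm//.
    by rewrite lerDr.
  by rewrite lerDl.
rewrite ler_pdivlMr ?exprn_gt0//; apply: (le_trans _ M8).
have M1 : 1 <= M by rewrite (le_trans A1)// ltW.
apply: (@le_trans _ _ (M ^+ p * M ^+ 2)); last first.
  by rewrite -exprD ler_weXn2l// addn2.
rewrite ler_pM ?exprn_ge0 ?(ltW A0)//; last first.
  by rewrite lerXn2r ?nnegrE ?(ltW A0)// ltW.
have xp : 0 <= x ^+ p <= M ^+ p.
  rewrite exprn_even_ge0//= -[x ^+ p]ger0_norm ?exprn_even_ge0// normrX.
  by rewrite lerXn2r ?nnegrE.
have yp : 0 <= y ^+ p <= M ^+ p.
  rewrite exprn_even_ge0//= -[y ^+ p]ger0_norm ?exprn_even_ge0// normrX.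
  by rewrite lerXn2r ?nnegrE.
by rewrite ler_norml; lra.
Qed.

(** Either [x^2 <= 4 y^2], or [|x - y|] exceeds [|x| / 2]; then one factor of the truncated power is
    charged to the distance and the other three to [n]. *)
Lemma min_pow_le (n : nat) x y :
  Num.min (x ^+ 2) n%:R ^+ 4 <= 4 ^+ 4 * y ^+ 8 + 4 * n%:R ^+ 3 * (x - y) ^+ 2.
Proof.
have n0 : 0 <= n%:R :> R by [].
have x0 : 0 <= x ^+ 2 by exact: sqr_ge0.
have m0 : 0 <= Num.min (x ^+ 2) n%:R by rewrite le_min x0.
have [xy|xy] := leP (x ^+ 2) (4 * y ^+ 2).
  rewrite -[leLHS]addr0 lerD//; last by rewrite mulr_ge0 ?sqr_ge0// mulr_ge0// exprn_ge0.
  apply: (@le_trans _ _ ((4 * y ^+ 2) ^+ 4)).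
    by rewrite lerXn2r ?nnegrE// ?(le_trans x0)// ge_min xy.
  by rewrite exprMn -exprM.
have y8 : 0 <= 4 ^+ 4 * y ^+ 8 by rewrite mulr_ge0 ?exprn_even_ge0 ?exprn_ge0 ?ler0n.
rewrite -[leLHS]add0r; apply: lerD => //.
apply: (@le_trans _ _ (n%:R ^+ 3 * x ^+ 2)).
  rewrite [leLHS]exprSr ler_pM ?exprn_ge0// ?ge_min ?lexx//.
  by rewrite lerXn2r ?nnegrE// ge_min lexx orbT.
rewrite -[leRHS]mulrA [leRHS]mulrCA ler_wpM2l ?exprn_ge0//.
by nra.
Qed.

Lemma trunc_pow_le (k : nat) x A : (k <= 3)%N -> 1 <= A ->
  0 <= x ^+ (2 * k) - Num.min (x ^+ 2) A ^+ k <= x ^+ 8 / A.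
Proof.
move=> k3 A1; have A0 : 0 < A by rewrite (lt_le_trans ltr01).
have x0 : 0 <= x ^+ 2 by exact: sqr_ge0.
rewrite exprM; have [xA|Ax] := leP (x ^+ 2) A.
  by rewrite subrr lexx/= divr_ge0 ?(ltW A0)// exprn_even_ge0.
rewrite subr_ge0 lerXn2r ?nnegrE ?(ltW A0) ?(ltW Ax)//=.
rewrite (@le_trans _ _ ((x ^+ 2) ^+ k))//; first by rewrite gerBl exprn_ge0// ltW.
rewrite ler_pdivlMr//; apply: (@le_trans _ _ ((x ^+ 2) ^+ k * x ^+ 2)).
  by apply: ler_wpM2l; [exact: exprn_ge0|exact: ltW].
rewrite -exprSr -[8%N]/(2 * 4)%N [x ^+ (2 * 4)]exprM.
by rewrite ler_weXn2l// (le_trans A1)// ltW.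
Qed.

End power_inequalities.

Section expectation_bridge.
Context {R : realType} d (T : measurableType d) (P : probability T R).
Local Notation E f := (\int[P]_w f w).
Implicit Types f g : T -> R.

Lemma ge0_integrable f : measurable_fun setT f -> (forall w, 0 <= f w) ->
  (\int[P]_w (f w)%:E < +oo)%E -> P.-integrable setT (EFin \o f).
Proof.
move=> mf f0 fy; apply/integrableP; split; first exact/measurable_EFinP.
by under eq_integral do rewrite /= ger0_norm//.
Qed.

Lemma expectationE f : P.-integrable setT (EFin \o f) -> 'E_P[f]%E = (E f)%:E.
Proof. by move=> fi; rewrite unlock /Rintegral fineK//; exact: integrable_fin_num. Qed.

Lemma sqr_integrableB f g : measurable_fun setT f -> measurable_fun setT g ->
  P.-integrable setT (EFin \o (fun w => f w ^+ 2)) ->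
  P.-integrable setT (EFin \o (fun w => g w ^+ 2)) ->
  P.-integrable setT (EFin \o (fun w => (f w - g w) ^+ 2)).
Proof.
move=> mf mg if2 ig2.
apply: (@le_integrable_real _ _ _ _ _ (fun w => 2 * f w ^+ 2 + 2 * g w ^+ 2)).
- by apply: measurable_funX; exact: measurable_funB.
- move=> w; rewrite ger0_norm ?sqr_ge0//.
  by have := sqr_ge0 (f w + g w); nra.
- by apply: integrableD_real; exact: integrableZ_real.
Qed.

End expectation_bridge.

Section chaos_approximation.
Context {R : realType} (H : normedModType R) (ip : H -> H -> R).
Hypothesis Hip : is_inner_product ip.
Context d (T : measurableType d) (P : probability T R).
Variables (X : H -> {RV P >-> R}) (HX : isonormal ip X).
Local Notation E f := (\int[P]_w f w).

Definition unit_form (l : H -> R) (vs : seq H) : Prop :=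
  orthonormal_seq ip vs /\ \sum_(v <- vs) l v ^+ 2 = 2^-1.

(** Deliberately crude: with [p 2 = 1/2] and the other power sums at most 1 in absolute value, the
    formula for [m 8] totals less than [2 ^ 20]. *)
Definition eighth_moment_bound : R := 2 ^+ 21.

Lemma unit_form_moments l vs : unit_form l vs ->
  let p k := \sum_(v <- vs) l v ^+ k in
  [/\ E (fun w => chaos_form X l vs w ^+ 2) = 1,
      E (fun w => chaos_form X l vs w ^+ 4) = 48 * p 4 + 3,
      E (fun w => chaos_form X l vs w ^+ 6) =
        (15 * 256) * p 6 + 720 * p 4 + (5 * 128) * p 3 ^+ 2 + 15 &
      E (fun w => chaos_form X l vs w ^+ 8) <= eighth_moment_bound].
Proof.
move=> [ovs l2] p; have [[_ _ M2] _ M4 _ [M6 _ M8]] := mean_chaos_form Hip HX l ovs.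
have pk k : `|p k.+2| <= 1.
  rewrite /p (le_trans (ler_norm_sum _ _ _))//.
  apply: (@le_trans _ _ (\sum_(v <- vs) l v ^+ 2)); last by rewrite l2 invf_le1// ler1n.
  rewrite big_seq [leRHS]big_seq; apply: ler_sum => v vvs.
  rewrite -[k.+2]addn2 exprD normrM (ger0_norm (sqr_ge0 (l v))).
  rewrite ler_piMl ?sqr_ge0// normrX exprn_ile1//.
  have lv2 : l v ^+ 2 <= 1.
    apply: (@le_trans _ _ (\sum_(v <- vs) l v ^+ 2)); last by rewrite l2 invf_le1// ler1n.
    rewrite (bigD1_seq v)//= ?ovs.1// lerDl sumr_ge0// => u _.
    exact: sqr_ge0.
  by rewrite -(@expr_le1 _ 2)// real_normK ?num_real.
split.
- by rewrite M2 l2 divff.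
- by rewrite M4 l2 /p; field.
- by rewrite M6 l2 /p; field.
have q3 := pk 1%N; have q4 := pk 2%N; have q5 := pk 3%N; have q6 := pk 4%N.
have q8 := pk 6%N.
rewrite M8 l2 -/(p 8) -/(p 6) -/(p 5) -/(p 4) -/(p 3) /eighth_moment_bound.
have p33 : p 3 ^+ 2 <= 1 by rewrite -real_normK ?num_real// expr_le1.
have p44 : p 4 ^+ 2 <= 1 by rewrite -real_normK ?num_real// expr_le1.
have p53 : p 5 * p 3 <= 1.
  by rewrite (le_trans (ler_norm _))// normrM mulr_ile1.
have p4' := le_trans (ler_norm (p 4)) q4; have p6' := le_trans (ler_norm (p 6)) q6.
have p8' := le_trans (ler_norm (p 8)) q8.
move: (p 3 ^+ 2) (p 4 ^+ 2) (p 4) (p 6) (p 8) p33 p44 p53 p4' p6' p8' => a b c e f.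
rewrite -(mulrA (84 * _)); move: (p 5 * p 3) => g.
by rewrite !expr2 !exprS expr0; lra.
Qed.

Variables (F : {RV P >-> R}) (FC : second_wiener_chaos X F).
Hypothesis F2 : ('E_P[fun w => (F w ^+ 2)%R] = 1)%E.

Let mF : measurable_fun setT F. Proof. exact: measurable_funP. Qed.

Lemma chaos_sqr_integrable : P.-integrable setT (EFin \o (fun w => F w ^+ 2)).
Proof.
apply: ge0_integrable; first exact: measurable_funX.
  by move=> w; exact: sqr_ge0.
by have := F2; rewrite unlock => ->; exact: ltry.
Qed.

Lemma chaos_mean_sqr : E (fun w => F w ^+ 2) = 1.
Proof. by have := F2; rewrite expectationE ?chaos_sqr_integrable// => -[]. Qed.

Lemma chaos_dist_integrable f : tame P f ->
  P.-integrable setT (EFin \o (fun w => (F w - f w) ^+ 2)).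
Proof.
move=> tf; apply: sqr_integrableB => //; first exact: tf.1.
- exact: chaos_sqr_integrable.
- exact: tame_integrableX.
Qed.

Let chaos_form_approx e : 0 < e -> exists l vs, orthonormal_seq ip vs /\
  E (fun w => (F w - chaos_form X l vs w) ^+ 2) < e.
Proof.
move=> e0; have [m [c [h [h1 Fe]]]] := FC e0.
have [vs [l [ovs ae_eq]]] := chaos_diagonalization Hip HX c h1.
exists l, vs; split => //.
have tG : tame P (fun w => \sum_(i < m) c i * (X (h i) w ^+ 2 - 1)).
  apply: tame_sum => i; apply: tameZ; apply: tameB; last exact: tame_cst.
  by apply: tameX; exact: (isonormal_tame HX).
have tS := tame_chaos_form HX l vs.
rewrite -lte_fin; apply: le_lt_trans Fe.
rewrite expectationE ?chaos_dist_integrable// lee_fin le_eqVlt; apply/orP; left.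
apply/eqP/mean_ae.
- by apply: measurable_funX; apply: measurable_funB => //; exact: tS.1.
- by apply: measurable_funX; apply: measurable_funB => //; exact: tG.1.
by apply: filterS ae_eq => w ->.
Qed.

(** The approximating form only has variance near 1; dividing by its standard deviation [s] restores
    the norm, at a price controlled by [(s - 1)^2 <= (s^2 - 1)^2]. *)
Lemma unit_form_approx e : 0 < e -> exists l vs, unit_form l vs /\
  E (fun w => (F w - chaos_form X l vs w) ^+ 2) < e.
Proof.
(* The variance will be within [6 t] of 1, so [t <= 1/12] keeps it above 1/2. The final cost
   [2 t^2 + 72 t^2] is at most [74 e / 84]. *)
move=> e0; pose t := Num.min (12^-1) (e / 7).
have t0 : 0 < t by rewrite lt_min invr_gt0 ltr0n/= divr_gt0.
have t12 : t <= 12^-1 by rewrite ge_min lexx.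
have te : t <= e / 7 by rewrite ge_min lexx orbT.
have [l [vs [ovs Ft]]] := chaos_form_approx (exprn_gt0 2 t0).
pose S := chaos_form X l vs.
have tS : tame P S := tame_chaos_form HX l vs.
pose s2 := E (fun w => S w ^+ 2).
have iF := chaos_sqr_integrable.
have iS : P.-integrable setT (EFin \o (fun w => S w ^+ 2)) by exact: tame_integrableX.
have iFS := chaos_dist_integrable tS.
have s2E : s2 = 2 * \sum_(v <- vs) l v ^+ 2.
  by have [[_ _ h]] := mean_chaos_form Hip HX l ovs.
have s2t : `|s2 - 1| <= 6 * t.
  (* The values 1 and -1 of [u] give the two sides. The product in [S^2 - F^2 = - (F - S) (F + S)]
     is split by Young's inequality with weight [t], matched to a squared distance below [t^2]. *)
  have aux (u : R) : u ^+ 2 = 1 ->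
      u * (s2 - 1) <= (2 * t)^-1 * E (fun w => (F w - S w) ^+ 2) +
         (4 * t + t * E (fun w => (F w - S w) ^+ 2)).
    move=> u2.
    have i1 := integrableZ_real (2 * t)^-1 iFS.
    have i2 := integrableZ_real t iFS.
    have i3 := integrableZ_real (4 * t) iF.
    have i4 := integrableB_real iS iF.
    have i5 := integrableZ_real u i4.
    have i6 := integrableD_real i3 i2.
    have i7 := integrableD_real i1 i6.
    suff : E (fun w => u * (S w ^+ 2 - F w ^+ 2)) <=
        E (fun w => (2 * t)^-1 * (F w - S w) ^+ 2 +
          (4 * t * F w ^+ 2 + t * (F w - S w) ^+ 2)).
      by rewrite RintegralZl// RintegralB// !RintegralD// !RintegralZl//
        chaos_mean_sqr mulr1.
    apply: le_Rintegral => //.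
    move=> w _; set x := F w; set y := S w.
    have h1 : u * (y ^+ 2 - x ^+ 2) = - (u * (x - y)) * (x + y) by ring.
    have h2 : (x - y) ^+ 2 = (u * (x - y)) ^+ 2 by rewrite exprMn u2 mul1r.
    rewrite h1 {1}h2; set z := u * (x - y).
    have h3 : - z * (x + y) <= (2 * t)^-1 * z ^+ 2 + t / 2 * (x + y) ^+ 2.
      rewrite -subr_ge0.
      have -> : (2 * t)^-1 * z ^+ 2 + t / 2 * (x + y) ^+ 2 - - z * (x + y) =
         (2 * t)^-1 * (z + t * (x + y)) ^+ 2 by field; rewrite gt_eqF.
      by rewrite mulr_ge0 ?sqr_ge0// invr_ge0 mulr_ge0// ltW.
    apply: (le_trans h3); rewrite lerD2l.
    have h4 : (x + y) ^+ 2 <= 8 * x ^+ 2 + 2 * (x - y) ^+ 2.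
      by have := sqr_ge0 (3 * x - y); nra.
    have : t / 2 * (x + y) ^+ 2 <= t / 2 * (8 * x ^+ 2 + 2 * (x - y) ^+ 2).
      by rewrite ler_wpM2l// divr_ge0// ltW.
    by move=> /le_trans; apply; rewrite le_eqVlt; apply/orP; left; apply/eqP; field.
  have bnd : (2 * t)^-1 * E (fun w => (F w - S w) ^+ 2) +
         (4 * t + t * E (fun w => (F w - S w) ^+ 2)) <= 6 * t.
    have D0 : 0 <= E (fun w => (F w - S w) ^+ 2).
      by apply: Rintegral_ge0 => w _; exact: sqr_ge0.
    have h1 : (2 * t)^-1 * E (fun w => (F w - S w) ^+ 2) <= t / 2.
      rewrite ler_pdivrMl ?mulr_gt0//.
      rewrite (_ : 2 * t * (t / 2) = t ^+ 2); last by field.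
      exact: ltW.
    have h2 : t * E (fun w => (F w - S w) ^+ 2) <= t.
      rewrite ler_piMr ?(ltW t0)// (le_trans (ltW Ft))// exprn_ile1 ?(ltW t0)//.
      by rewrite (le_trans t12)// invf_le1// ler1n.
    lra.
  have a1 := le_trans (aux 1 (expr1n _ _)) bnd.
  have a2 : -1 * (s2 - 1) <= 6 * t.
    by apply: le_trans bnd; apply: aux; rewrite sqrrN expr1n.
  by rewrite ler_norml; lra.
have s2half : 2^-1 <= s2 by move: s2t; rewrite ler_norml; lra.
have s2_gt0 : 0 < s2 by rewrite (lt_le_trans _ s2half)// invr_gt0.
pose s := Num.sqrt s2.
have ss : s ^+ 2 = s2 by rewrite sqr_sqrtr// ltW.
have s_gt0 : 0 < s by rewrite sqrtr_gt0.
have sn0 : s != 0 by rewrite gt_eqF.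
pose l' v := l v / s.
have l'2 : \sum_(v <- vs) l' v ^+ 2 = 2^-1.
  rewrite (eq_bigr (fun v => l v ^+ 2 * (s ^+ 2)^-1)); last first.
    by move=> v _; rewrite /l' exprMn exprVn.
  rewrite -mulr_suml ss s2E; field.
  by move: s2_gt0; rewrite s2E pmulr_rgt0// => /gt_eqF ->.
exists l', vs; split; first by split.
have SE w : chaos_form X l' vs w = S w / s.
  rewrite /S /chaos_form mulr_suml; apply: eq_bigr => v _.
  by rewrite /l'; ring.
have s1 : (s - 1) ^+ 2 <= 36 * t ^+ 2.
  have h : (s2 - 1) ^+ 2 <= (6 * t) ^+ 2.
    rewrite -(real_normK (num_real (s2 - 1))) lerXn2r ?nnegrE//.
    by rewrite mulr_ge0// ltW.
  apply: (@le_trans _ _ ((s2 - 1) ^+ 2)); last by rewrite (le_trans h)// exprMn; lra.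
  rewrite -ss (_ : s ^+ 2 - 1 = (s - 1) * (s + 1)); last by ring.
  rewrite exprMn ler_peMr ?sqr_ge0// exprn_ege1// lerDr ltW//.
have i1 := integrableZ_real 2 iFS.
have i2 := integrableZ_real (2 * (s - 1) ^+ 2 / s ^+ 2) iS.
apply: (@le_lt_trans _ _ (E (fun w => 2 * (F w - S w) ^+ 2 +
   2 * (s - 1) ^+ 2 / s ^+ 2 * S w ^+ 2))).
  apply: le_Rintegral => //.
  - by apply: chaos_dist_integrable; exact: (tame_chaos_form HX).
  - exact: integrableD_real.
  move=> w _; rewrite SE.
  have -> : 2 * (s - 1) ^+ 2 / s ^+ 2 * S w ^+ 2 = 2 * (S w - S w / s) ^+ 2.
    by field.
  by have := sqr_ge0 ((F w - S w) - (S w - S w / s)); nra.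
rewrite RintegralD// !RintegralZl// -/s2 -ss divfK ?expf_neq0//.
have : t ^+ 2 <= 12^-1 * (e / 7) by rewrite expr2 ler_pM// ltW.
by lra.
Qed.

Lemma chaos_form_tame_unit l vs : tame P (chaos_form X l vs).
Proof. exact: tame_chaos_form HX l vs. Qed.

(** The [+ 1] absorbs the approximation error at each truncation level. *)
Definition chaos_eighth_bound : R := 4 ^+ 4 * eighth_moment_bound + 1.

(** Stands in for hypercontractivity. At truncation level [n] the approximating form may depend on
    [n], and is chosen so close that [4 n^3 E (F - S)^2 <= 1]; monotone convergence then removes the
    truncation. *)
Lemma chaos_eighth : P.-integrable setT (EFin \o (fun w => F w ^+ 8)) /\
  E (fun w => F w ^+ 8) <= chaos_eighth_bound.
Proof.
pose g n w := Num.min (F w ^+ 2) n%:R ^+ 4.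
have g0 n w : 0 <= g n w.
  by rewrite exprn_ge0// le_min sqr_ge0/=.
have mg n : measurable_fun setT (g n).
  by apply: measurable_funX; apply: measurable_minr => //; exact: measurable_funX.
have gub n w : g n w <= n%:R ^+ 4.
  by rewrite lerXn2r ?nnegrE// ?ge_min ?lexx ?orbT// le_min sqr_ge0/=.
have ig n : P.-integrable setT (EFin \o g n).
  by apply: tame_integrable; apply: (@tame_bounded _ _ _ _ _ (n%:R ^+ 4)) => // w;
    rewrite ger0_norm.
have gb n : E (g n) <= chaos_eighth_bound.
  have c0 : 0 < 4 * n%:R ^+ 3 + 1 :> R by rewrite ltr_wpDl// mulr_ge0// exprn_ge0.
  have [l [vs [ul Fe]]] := unit_form_approx (divr_gt0 (@ltr01 R) c0).
  have tS := chaos_form_tame_unit l vs.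
  have [_ _ _ S8] := unit_form_moments ul.
  have i1 := integrableZ_real (4 ^+ 4) (tame_integrableX 8 tS).
  have i2 := integrableZ_real (4 * n%:R ^+ 3) (chaos_dist_integrable tS).
  apply: (@le_trans _ _ (E (fun w => 4 ^+ 4 * chaos_form X l vs w ^+ 8 +
      4 * n%:R ^+ 3 * (F w - chaos_form X l vs w) ^+ 2))).
    apply: le_Rintegral => //; first exact: integrableD_real.
    by move=> w _; exact: min_pow_le.
  rewrite RintegralD// !RintegralZl//; last 2 first.
  - exact: chaos_dist_integrable.
  - exact: tame_integrableX.
  rewrite lerD//; first by rewrite ler_wpM2l// exprn_ge0.
  move: Fe; rewrite ltr_pdivlMr// mulrC => /ltW; apply: le_trans.
  rewrite ler_wpM2r ?lerDl//.
  by apply: Rintegral_ge0 => w _; exact: sqr_ge0.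
have F8 : (\int[P]_w (F w ^+ 8)%:E <= chaos_eighth_bound%:E)%E.
  have lim_g w : limn (fun n => (g n w)%:E) = (F w ^+ 8)%:E.
    apply/cvg_lim => //; apply: cvg_near_cst.
    exists (Num.truncn (F w ^+ 2)).+1 => // n /= hn.
    rewrite /g min_l -?exprM// ltW// (lt_le_trans (truncnS_gt _))// ler_nat.
    exact: hn.
  under eq_integral do rewrite -lim_g.
  rewrite monotone_convergence//; last 3 first.
  - by move=> n; exact/measurable_EFinP.
  - by move=> n w _; rewrite lee_fin.
  - move=> w _ m n mn; rewrite lee_fin lerXn2r ?nnegrE ?le_min ?sqr_ge0//=.
    by rewrite ge_min lexx/= ge_min ler_nat mn orbT.
  apply: lime_le.
    apply: ereal_nondecreasing_is_cvgn => m n mn; apply: ge0_le_integral => //.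
    - by move=> w _; rewrite lee_fin.
    - exact/measurable_EFinP.
    - exact/measurable_EFinP.
    move=> w _; rewrite lee_fin lerXn2r ?nnegrE ?le_min ?sqr_ge0//=.
    by rewrite ge_min lexx/= ge_min ler_nat mn orbT.
  apply: nearW => n; have := gb n; rewrite -lee_fin /Rintegral fineK//.
  exact: integrable_fin_num (ig n).
have iF8 : P.-integrable setT (EFin \o (fun w => F w ^+ 8)).
  apply: ge0_integrable; first exact: measurable_funX.
    by move=> w; rewrite exprn_even_ge0.
  by rewrite (le_lt_trans F8)// ltry.
split => //; rewrite -lee_fin /Rintegral fineK//.
exact: integrable_fin_num iF8.
Qed.

End chaos_approximation.

(** * The sixth-degree functional *)

Section chaos_moments_limit.
Context {R : realType} (H : normedModType R) (ip : H -> H -> R).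
Hypothesis Hip : is_inner_product ip.
Context d (T : measurableType d) (P : probability T R).
Variables (X : H -> {RV P >-> R}) (HX : isonormal ip X).
Local Notation E f := (\int[P]_w f w).

Definition P6_defect (l : H -> R) (vs : seq H) : R :=
  (15 * 256) * (\sum_(v <- vs) l v ^+ 2 * (l v ^+ 2 - 4^-1) ^+ 2) +
  (5 * 128) * (\sum_(v <- vs) l v ^+ 3) ^+ 2.

Lemma P6_defect_ge0 l vs : 0 <= P6_defect l vs.
Proof.
apply: addr_ge0; apply: mulr_ge0; rewrite ?sqr_ge0 ?mulr_ge0 ?ler0n//.
by apply: sumr_ge0 => v _; apply: mulr_ge0; exact: sqr_ge0.
Qed.

Lemma mean_P6 (f : T -> R) : measurable_fun setT f ->
  (forall k, (k <= 3)%N -> P.-integrable setT (EFin \o (fun w => f w ^+ (2 * k)))) ->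
  P.-integrable setT (EFin \o (fun w => P6 (f w))) /\
  E (fun w => P6 (f w)) =
    E (fun w => f w ^+ 6) - 55 * E (fun w => f w ^+ 4) +
      331 * E (fun w => f w ^+ 2) - 61.
Proof.
move=> mf fi.
have i2 := fi 1%N isT; have i4 := fi 2 isT; have i6 := fi 3 isT.
have i4' := integrableZ_real 55 i4; have i2' := integrableZ_real 331 i2.
have ic : P.-integrable setT (EFin \o (fun _ : T => 61 : R)).
  exact: finite_measure_integrable_cst.
have i64 := integrableB_real i6 i4'; have i642 := integrableD_real i64 i2'.
split; first exact: integrableB_real i642 ic.
rewrite /P6 (RintegralB measurableT i642 ic) (RintegralD measurableT i64 i2').
rewrite (RintegralB measurableT i6 i4') (RintegralZl 55 measurableT i4).
by rewrite (RintegralZl 331 measurableT i2) (mean_cst P 61).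
Qed.

Lemma mean_P6_form l vs : unit_form ip l vs ->
  E (fun w => P6 (chaos_form X l vs w)) = P6_defect l vs.
Proof.
move=> ul; have tS := tame_chaos_form HX l vs.
have [_ ->] := mean_P6 tS.1 (fun k _ => tame_integrableX (2 * k) tS).
have [-> -> -> _] := unit_form_moments Hip HX ul.
have l2 := ul.2; rewrite /P6_defect.
have -> : \sum_(v <- vs) l v ^+ 2 * (l v ^+ 2 - 4^-1) ^+ 2 =
    \sum_(v <- vs) l v ^+ 6 - 2^-1 * (\sum_(v <- vs) l v ^+ 4) +
    16^-1 * \sum_(v <- vs) l v ^+ 2.
  rewrite !mulr_sumr -sumrB -big_split/=; apply: eq_bigr => v _.
  by field.
by rewrite l2; field.
Qed.

Variables (F : {RV P >-> R}) (FC : second_wiener_chaos X F).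
Hypothesis F2 : ('E_P[fun w => (F w ^+ 2)%R] = 1)%E.

Let mF : measurable_fun setT F. Proof. exact: measurable_funP. Qed.

Lemma chaos_integrable_even k : (k <= 3)%N ->
  P.-integrable setT (EFin \o (fun w => F w ^+ (2 * k))).
Proof.
move=> k3; have [iF8 _] := chaos_eighth Hip HX FC F2.
apply: (@le_integrable_real _ _ _ _ _ (fun w => 1 + F w ^+ 8)).
- exact: measurable_funX.
- move=> w; have F8 : 0 <= F w ^+ 8 by rewrite exprn_even_ge0.
  rewrite ger0_norm; last by rewrite exprM exprn_ge0// sqr_ge0.
  have x0 : 0 <= F w ^+ 2 by rewrite sqr_ge0.
  rewrite exprM; have [x1|x1] := leP (F w ^+ 2) 1.
    by apply: (@le_trans _ _ 1); [exact: exprn_ile1|rewrite lerDl].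
  rewrite -[leLHS]add0r lerD// -[8%N]/(2 * 4)%N [F w ^+ (2 * 4)]exprM.
  by rewrite ler_weXn2l// ?(ltW x1)// (leq_trans k3).
- apply: integrableD_real => //; exact: finite_measure_integrable_cst.
Qed.

(** Uniform eighth moments upgrade [L^2] closeness to closeness of the lower even moments; one [t]
    serves all unit forms. *)
Lemma chaos_moment_close k e : (k <= 3)%N -> 0 < e ->
  exists2 t, 0 < t & forall l vs, unit_form ip l vs ->
    E (fun w => (F w - chaos_form X l vs w) ^+ 2) < t ->
    `|E (fun w => F w ^+ (2 * k)) - E (fun w => chaos_form X l vs w ^+ (2 * k))| <= e.
Proof.
move=> k3 e0; have [iF8 F8] := chaos_eighth Hip HX FC F2.
pose B : R := chaos_eighth_bound + eighth_moment_bound.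
have B0 : 0 <= B by rewrite /B /chaos_eighth_bound /eighth_moment_bound !addr_ge0 ?mulr_ge0 ?exprn_ge0.
(* As [A >= 1] and [A >= 3 B / e], the tail term [B / A^2] of [pow_sub_le] is at most [e / 3]. *)
pose A : R := 1 + 3 * B / e.
have A1 : 1 <= A by rewrite lerDl divr_ge0 ?mulr_ge0// ltW.
have A0 : 0 < A by rewrite (lt_le_trans ltr01).
have e3 : 0 < e / 3 by rewrite divr_gt0.
pose C := 9 * A ^+ 10 / (e / 3).
have C0 : 0 < C by rewrite divr_gt0// mulr_gt0// exprn_gt0.
exists ((e / 3) / C); first by rewrite divr_gt0.
move=> l vs ul Ft; have tS := tame_chaos_form HX l vs.
have [_ _ _ S8] := unit_form_moments Hip HX ul.
have iD := chaos_dist_integrable F2 tS.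
have iS8 := tame_integrableX 8 tS.
have iF := chaos_integrable_even k3; have iS := tame_integrableX (2 * k) tS.
have j1 := integrableZ_real C iD.
have j2 := integrableD_real iF8 iS8.
have j3 := integrableZ_real (A ^+ 2)^-1 j2.
have jc : P.-integrable setT (EFin \o (fun _ : T => e / 3)).
  exact: finite_measure_integrable_cst.
have j4 := integrableD_real jc j1; have j5 := integrableD_real j4 j3.
have iFS := integrableB_real iF iS.
rewrite -(RintegralB measurableT iF iS) (le_trans (le_normr_Rintegral measurableT iFS))//.
apply: (@le_trans _ _ (E (fun w => e / 3 + C * (F w - chaos_form X l vs w) ^+ 2 +
   (A ^+ 2)^-1 * (F w ^+ 8 + chaos_form X l vs w ^+ 8)))).
  apply: le_Rintegral => //.
    exact: integrable_norm iFS.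
  move=> w _; rewrite [(A ^+ 2)^-1 * _]mulrC; apply: pow_sub_le => //.
  - by rewrite -[6%N]/(2 * 3)%N leq_mul2l.
  - by rewrite oddM.
rewrite (RintegralD measurableT j4 j3) (RintegralD measurableT jc j1).
rewrite (RintegralZl _ measurableT iD) (RintegralZl _ measurableT j2).
rewrite (RintegralD measurableT iF8 iS8) (mean_cst P (e / 3)).
have h1 : C * E (fun w => (F w - chaos_form X l vs w) ^+ 2) <= e / 3.
  by rewrite -ler_pdivlMl// mulrC ltW.
have h2 : (A ^+ 2)^-1 * (E (fun w => F w ^+ 8) + E (fun w => chaos_form X l vs w ^+ 8))
    <= e / 3.
  rewrite ler_pdivrMl ?exprn_gt0// (@le_trans _ _ B)//; first exact: lerD.
  apply: (@le_trans _ _ (A * (e / 3))).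
    rewrite /A mulrDl mul1r.
    rewrite (_ : 3 * B / e * (e / 3) = B); last by field; rewrite gt_eqF.
    by rewrite lerDr ltW.
  by rewrite ler_wpM2r ?(ltW e3)// expr2 ler_peMr// ltW.
lra.
Qed.

Lemma chaos_mean_P6 : P.-integrable setT (EFin \o (fun w => P6 (F w))) /\
  E (fun w => P6 (F w)) =
    E (fun w => F w ^+ 6) - 55 * E (fun w => F w ^+ 4) + 270.
Proof.
have [i ->] := mean_P6 mF chaos_integrable_even; split => //.
by rewrite (chaos_mean_sqr F2); lra.
Qed.

Lemma chaos_approx e : 0 < e -> exists l vs, [/\ unit_form ip l vs,
  E (fun w => (F w - chaos_form X l vs w) ^+ 2) < e &
  `|E (fun w => P6 (F w)) - P6_defect l vs| <= e].
Proof.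
(* 56 = 1 + 55 adds the weights of the sixth and fourth moments; the second moments agree
   exactly. *)
move=> e0; have e56 : 0 < e / 56 by rewrite divr_gt0.
have [t4 t40 H4] := @chaos_moment_close 2 _ isT e56.
have [t6 t60 H6] := @chaos_moment_close 3 _ isT e56.
have t0 : 0 < Num.min e (Num.min t4 t6) by rewrite !lt_min e0 t40 t60.
have [l [vs [ul]]] := unit_form_approx Hip HX FC F2 t0.
rewrite !lt_min => /and3P[Fe F4 F6].
exists l, vs; split => //.
have {}H4 := H4 _ _ ul F4; have {}H6 := H6 _ _ ul F6.
have tS := tame_chaos_form HX l vs.
have [_ SE] := mean_P6 tS.1 (fun k _ => tame_integrableX (2 * k) tS).
have [S2 _ _ _] := unit_form_moments Hip HX ul.
rewrite -mean_P6_form// SE S2 chaos_mean_P6.2.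
move: H4 H6; rewrite !ler_norml.
rewrite -[(2 * 2)%N]/4%N -[(2 * 3)%N]/6%N.
move: (E (fun w => F w ^+ 4)) (E (fun w => chaos_form X l vs w ^+ 4)) => a4 b4.
move: (E (fun w => F w ^+ 6)) (E (fun w => chaos_form X l vs w ^+ 6)) => a6 b6.
lra.
Qed.

End chaos_moments_limit.

(** * Rounding the coefficients to 0, 1/2 or -1/2 *)

Section rounding.
Context {R : realType}.
Implicit Types x : R.

(** A nearest zero of [x (x^2 - 1/4)]; the cut at 1/4 is the midpoint. *)
Definition round_half x : R :=
  if `|x| < 4^-1 then 0 else if 0 < x then 2^-1 else - 2^-1.

(** With [u = x^2 - 1/4], the factor [x^2 >= 1/16] gives [u^2 <= 16 D], and [x + 1/2 >= 3/4] gives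
    [|x - 1/2| <= 4/3 |u|]. Hence 29, just above [256 / 9], and 2200, just above [16 * 137]. *)
Let half_close x : 4^-1 <= x <= 1 ->
  let D := x ^+ 2 * (x ^+ 2 - 4^-1) ^+ 2 in
  [/\ (x - 2^-1) ^+ 2 <= 29 * D,
      `|x ^+ 2 - 4^-1| <= 4^-1 / 25 + 2200 * D &
      `|x ^+ 3 - 8^-1| <= 4^-1 / 25 + 2200 * D].
Proof.
move=> /andP[x4 x1] D.
pose u := x ^+ 2 - 4^-1.
have x0 : 0 < x by rewrite (lt_le_trans _ x4)// invr_gt0.
have uE : u = (x - 2^-1) * (x + 2^-1) by rewrite /u; field.
have Du : u ^+ 2 <= 16 * D.
  rewrite /D -/u mulrA ler_peMl ?sqr_ge0//.
  by nra.
have h1 : (x - 2^-1) ^+ 2 <= 16 / 9 * u ^+ 2.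
  rewrite uE exprMn mulrCA ler_peMr ?sqr_ge0//; nra.
have u0 : 0 <= u ^+ 2 by exact: sqr_ge0.
have h2 : `|u| <= 100^-1 + 25 * u ^+ 2.
  have := sqr_ge0 (5 * u - 10^-1); have := sqr_ge0 (5 * u + 10^-1).
  by rewrite ler_norml; clearbody u; move=> *; apply/andP; split; nra.
split.
- by apply: (le_trans h1); lra.
- by apply: (le_trans h2); lra.
have -> : x ^+ 3 - 8^-1 = (x - 2^-1) * (x ^+ 2 + x / 2 + 4^-1) by field.
have h3 : `|x - 2^-1| <= 4 / 3 * `|u|.
  rewrite uE normrM mulrCA ler_peMr// (gtr0_norm (x := x + _)); last by rewrite addr_gt0// invr_gt0.
  by lra.
have h4 : `|(x - 2^-1) * (x ^+ 2 + x / 2 + 4^-1)| <= 7 / 3 * `|u|.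
  rewrite normrM; apply: (@le_trans _ _ (4 / 3 * `|u| * (7 / 4))); last by lra.
  rewrite ler_pM// ger0_norm; first by nra.
  by rewrite !addr_ge0 ?sqr_ge0 ?divr_ge0 ?invr_ge0// ltW.
apply: (le_trans h4).
have h5 : 7 / 3 * `|u| <= 100^-1 + 137 * u ^+ 2.
  by rewrite -(real_normK (num_real u)); have := sqr_ge0 (`|u| - 7 / 822); nra.
by apply: (le_trans h5); lra.
Qed.

(** Near 1/2 and -1/2 the errors are of order [sqrt D], which has no good sum over many
    coefficients. Young's inequality trades them for a multiple of [D] plus a constant, and the
    constant is charged through [t^2 / 25] only to coefficients not rounded to 0; near 0 the bound
    [x^2 <= 29 D] suffices. *)
Lemma round_half_close x : `|x| <= 1 ->
  let D := x ^+ 2 * (x ^+ 2 - 4^-1) ^+ 2 in let t := round_half x in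
  [/\ (x - t) ^+ 2 <= 29 * D,
      `|x ^+ 2 - t ^+ 2| <= t ^+ 2 / 25 + 2200 * D &
      `|x ^+ 3 - t ^+ 3| <= t ^+ 2 / 25 + 2200 * D].
Proof.
move=> x1 D t; rewrite /t /round_half; case: ifPn => [x4|].
  rewrite expr0n/= expr0n/= !subr0 mul0r add0r.
  have x2 : x ^+ 2 <= 16^-1.
    rewrite -(real_normK (num_real x)) (_ : 16^-1 = (4^-1) ^+ 2); last by field.
    by rewrite lerXn2r ?nnegrE ?invr_ge0// ltW.
  have x20 : 0 <= x ^+ 2 by exact: sqr_ge0.
  have h : x ^+ 2 <= 29 * D.
    rewrite /D mulrCA ler_peMr//.
    have : 3 / 16 <= 4^-1 - x ^+ 2 by lra.
    by move: (x ^+ 2) => y; nra.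
  split => //.
    by rewrite ger0_norm//; lra.
  rewrite exprSr normrM (ger0_norm x20) (le_trans (ler_piMr _ x1))//; lra.
rewrite -leNgt; case: ifPn => [x0|].
  rewrite (gtr0_norm x0) => x4; rewrite (gtr0_norm x0) in x1.
  have -> : (2^-1 : R) ^+ 2 = 4^-1 by field.
  have -> : (2^-1 : R) ^+ 3 = 8^-1 by field.
  by apply: half_close; rewrite x4.
rewrite -leNgt => x0; rewrite (ler0_norm x0) => x4; rewrite (ler0_norm x0) in x1.
have -> : (- 2^-1 : R) ^+ 2 = 4^-1 by field.
have -> : (- 2^-1 : R) ^+ 3 = - 8^-1 by field.
have := @half_close (- x); rewrite x4 x1 => /(_ isT); rewrite sqrrN => -[h1 h2 h3].
split => //.
- by rewrite (_ : (x - - 2^-1) ^+ 2 = (- x - 2^-1) ^+ 2)//; ring.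
- rewrite (_ : x ^+ 3 - - 8^-1 = - ((- x) ^+ 3 - 8^-1)); last by ring.
  by rewrite normrN.
Qed.

Lemma round_half_cases x :
  [\/ round_half x = 0, round_half x = 2^-1 | round_half x = - 2^-1].
Proof.
rewrite /round_half; case: ifP => _; first by constructor 1.
by case: ifP => _; [constructor 2|constructor 3].
Qed.

Section sums.
Context {I : eqType} (l : I -> R) (s : seq I).
Local Notation t v := (round_half (l v)).

Let h0 : 0 < 2^-1 :> R. Proof. by rewrite invr_gt0. Qed.

Let pos v := t v == 2^-1.
Let neg v := t v == - 2^-1.

Let posneg v : pos v -> neg v = false.
Proof. by rewrite /pos /neg => /eqP ->; apply/eqP; lra. Qed.

Let sumE (f : R -> R) (g : I -> R) : f 0 = 0 ->
  \sum_(v <- s) f (t v) * g v =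
  f 2^-1 * (\sum_(v <- s | pos v) g v) + f (- 2^-1) * (\sum_(v <- s | neg v) g v).
Proof.
move=> f0; elim: s => [|v s' ih]; first by rewrite !big_nil !mulr0 addr0.
rewrite !big_cons ih; have [tv|tv|tv] := round_half_cases (l v).
- rewrite /pos /neg tv f0 mul0r add0r.
  rewrite (_ : (0 == 2^-1 :> R) = false); last by apply/eqP; lra.
  by rewrite (_ : (0 == - 2^-1 :> R) = false)//; apply/eqP; lra.
- have pv : pos v by rewrite /pos tv.
  by rewrite pv (posneg pv) tv mulrDr addrA.
- have nv : neg v by rewrite /neg tv.
  have -> : pos v = false by rewrite /pos tv; apply/eqP; lra.
  by rewrite nv tv mulrDr addrCA.
Qed.

(** Let [n] and [m] count the coefficients rounded to 1/2 and to -1/2. The square sum gives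
    [|1/2 - (n+m)/4| <= (n+m)/100 + 1/25], which forces [n + m = 2]; the cubic sum then gives
    [|n - m| < 2], hence [n = m = 1]. *)
Lemma round_half_pair : uniq s -> \sum_(v <- s) l v ^+ 2 = 2^-1 ->
  let D := \sum_(v <- s) l v ^+ 2 * (l v ^+ 2 - 4^-1) ^+ 2 in
  2200 * D <= 25^-1 -> (\sum_(v <- s) l v ^+ 3) ^+ 2 <= 20^-1 ^+ 2 ->
  \sum_(v <- s) (l v - t v) ^+ 2 <= 29 * D /\
  exists u v, [/\ u \in s, v \in s, u != v &
    forall g, \sum_(v <- s) t v * g v = 2^-1 * g u - 2^-1 * g v].
Proof.
move=> us l2 D D1 l3.
have lv1 v : v \in s -> `|l v| <= 1.
  move=> vs; rewrite -(@expr_le1 _ 2)// real_normK ?num_real//.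
  apply: (@le_trans _ _ 2^-1); last by rewrite invf_le1// ler1n.
  rewrite -l2 (bigD1_seq v)//= lerDl sumr_ge0// => u _; exact: sqr_ge0.
split.
  rewrite /D mulr_sumr big_seq [leRHS]big_seq; apply: ler_sum => v vs.
  by have [] := round_half_close (lv1 v vs).
pose T2 := \sum_(v <- s) t v ^+ 2; pose T3 := \sum_(v <- s) t v ^+ 3.
have bnd k : (forall v, v \in s -> `|l v ^+ k - t v ^+ k| <= t v ^+ 2 / 25 +
      2200 * (l v ^+ 2 * (l v ^+ 2 - 4^-1) ^+ 2)) ->
    `|\sum_(v <- s) l v ^+ k - \sum_(v <- s) t v ^+ k| <= T2 / 25 + 2200 * D.
  move=> h; rewrite -sumrB (le_trans (ler_norm_sum _ _ _))// /T2 /D mulr_suml mulr_sumr.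
  by rewrite -big_split/= big_seq [leRHS]big_seq; apply: ler_sum => v /h.
have b2 : `|2^-1 - T2| <= T2 / 25 + 2200 * D.
  by rewrite -l2; apply: bnd => v vs; have [] := round_half_close (lv1 v vs).
have b3 : `|\sum_(v <- s) l v ^+ 3 - T3| <= T2 / 25 + 2200 * D.
  by apply: bnd => v vs; have [] := round_half_close (lv1 v vs).
pose n := count pos s; pose m := count neg s.
have cnt a : \sum_(v <- s | a v) (1 : R) = (count a s)%:R.
  by rewrite big_const_seq iter_addr_0.
have T2E : T2 = (n + m)%N%:R / 4.
  rewrite /T2; under eq_bigr do rewrite -[t _ ^+ 2]mulr1.
  by rewrite (@sumE (fun x => x ^+ 2) (fun=> 1)) ?expr0n// !cnt natrD; field.
have T3E : T3 = (n%:R - m%:R) / 8.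
  rewrite /T3; under eq_bigr do rewrite -[t _ ^+ 3]mulr1.
  by rewrite (@sumE (fun x => x ^+ 3) (fun=> 1)) ?expr0n// !cnt; field.
have T2b : (1%:R : R) < (n + m)%N%:R < (3%:R : R).
  move: D1 b2; rewrite T2E ler_norml; clearbody D.
  move: ((n + m)%N%:R : R) (2200 * D) => b a a1 /andP[h1 h2].
  by apply/andP; split; lra.
have nm : (n + m)%N = 2.
  by move: T2b; rewrite !ltr_nat; case: (n + m)%N => [|[|[|]]].
have T2h : T2 = 2^-1 by rewrite T2E nm; field.
have l3' : `|\sum_(v <- s) l v ^+ 3| <= 20^-1.
  by rewrite -(@ler_pXn2r _ 2) ?nnegrE ?invr_ge0// real_normK ?num_real.
have T3b : `|n%:R - m%:R| < (2 : R).
  move: D1 b3 l3'; rewrite T2h T3E !ler_norml ltr_norml.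
  by move: (2200 * D) (n%:R - m%:R : R) (\sum_(v <- s) _) => a b c; lra.
have n1 : n = 1%N.
  clearbody n m; move: T3b nm; rewrite ltr_norml => /andP[h1 h2].
  case: n h1 h2 {T3E T2b T2E} => [|[|[|n]]] h1 h2 //; case: m h1 h2 => [|[|[|m]]]//= h1 h2 _; exfalso; lra.
have m1 : m = 1%N by move: nm; rewrite n1 add1n => -[].
move: n1 m1; rewrite /n /m -!size_filter => n1 m1.
case En : (seq.filter pos s) n1 => [//|u [|//]] _.
case Em : (seq.filter neg s) m1 => [//|v [|//]] _.
have : u \in seq.filter pos s by rewrite En mem_head.
have : v \in seq.filter neg s by rewrite Em mem_head.
rewrite !mem_filter => /andP[nv vs] /andP[pu us'].
exists u, v; split => //.
  by apply: contraTneq nv => <-; rewrite posneg.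
move=> g; rewrite (@sumE id g)// -[in X in _ * X + _]big_filter En -[in X in _ + _ * X]big_filter Em !big_seq1.
by rewrite mulNr.
Qed.

End sums.

End rounding.

(** * Independence and laws of products *)

Section independence.
Context {R : realType} d (T : measurableType d) (P : probability T R).
Local Notation E f := (\int[P]_w f w).

Lemma mean_indic (A : set T) : measurable A -> E (fun w => \1_A w) = fine (P A).
Proof. by move=> mA; rewrite /Rintegral integral_indic// setIT. Qed.

(** [key] replaces the exponentials of one variable by an indicator while carrying a function of the
    other. It runs once per variable, the second time with an indicator as the carried function.
    Centring that function turns factorisation into vanishing, to which [cos_transform_zero]
    applies. *)
Lemma mgf_independent (Y Z : T -> R) : has_mgf P Y -> has_mgf P Z ->
  (forall t s, E (fun w => expR (t * Y w) * expR (s * Z w)) =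
    E (fun w => expR (t * Y w)) * E (fun w => expR (s * Z w))) ->
  independent_RV P Y Z.
Proof.
move=> eY eZ YZ A B mA mB; have mY := eY.1; have mZ := eZ.1.
have key (U V : T -> R) (C : set R) (f : R -> R) : has_mgf P U ->
    measurable C -> measurable_fun setT V -> tame P (fun w => f (V w)) ->
    (forall s, E (fun w => f (V w) * expR (s * U w)) =
      E (fun w => f (V w)) * E (fun w => expR (s * U w))) ->
    E (fun w => f (V w) * \1_C (U w)) = E (fun w => f (V w)) * E (fun w => \1_C (U w)).
  move=> eU mC mV tf h; set c := E (fun w => f (V w)).
  have tI : tame P (fun w => (\1_C (U w) : R)).
    apply: (@tame_bounded _ _ _ _ _ 1); first by apply: measurableT_comp; [exact: measurable_indic|exact: eU.1].
    by move=> w; rewrite indicE; case: (_ \in _); rewrite ?normr1 ?normr0.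
  have te s := tame_expR eU s.
  have tW : tame P (fun w => f (V w) - c) by apply: tameB => //; exact: tame_cst.
  have : E (fun w => (f (V w) - c) * \1_C (U w)) = 0.
    apply: (cos_transform_zero tW) => //; first exact: eU.1.
    move=> t x; apply: (mgf_zero_cos eU) => // s.
    under eq_Rintegral do rewrite mulrBl.
    rewrite meanB; [|exact: tameM|exact: tameZ].
    by rewrite h meanZ// subrr.
  under eq_Rintegral do rewrite mulrBl.
  rewrite meanB; [|exact: tameM|exact: tameZ].
  by rewrite meanZ// => /eqP; rewrite subr_eq0 => /eqP.
have tIZ : tame P (fun w => (\1_B (Z w) : R)).
  apply: (@tame_bounded _ _ _ _ _ 1); first by apply: measurableT_comp; [exact: measurable_indic|].
  by move=> w; rewrite indicE; case: (_ \in _); rewrite ?normr1 ?normr0.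
have h1 t := key Z Y B (fun y => expR (t * y)) eZ mB mY (tame_expR eY t) (YZ t).
have h2 := key Y Z A \1_B eY mA mZ tIZ.
have mYA : measurable (Y @^-1` A) by rewrite -[X in measurable X]setTI; exact: mY.
have mZB : measurable (Z @^-1` B) by rewrite -[X in measurable X]setTI; exact: mZ.
have {h2} : E (fun w => \1_B (Z w) * \1_A (Y w)) =
    E (fun w => \1_B (Z w)) * E (fun w => \1_A (Y w)).
  apply: h2 => s; rewrite mulrC -h1; apply: eq_Rintegral => w _.
  by rewrite mulrC.
rewrite (_ : (fun w => \1_B (Z w) * \1_A (Y w)) = \1_(Y @^-1` A `&` Z @^-1` B)); last first.
  by apply/funext => w; rewrite indicI mulrC.
rewrite (mean_indic (measurableI _ _ mYA mZB)) (mean_indic mZB) (mean_indic mYA) => h.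
rewrite -[LHS]fineK ?fin_num_measure//; last exact: measurableI.
by rewrite h EFinM !fineK ?fin_num_measure// muleC.
Qed.

End independence.

Section joint_law.
Context {R : realType} d (T : measurableType d) (P : probability T R).
Context (Y1 Y2 : {RV P >-> R}).
Hypothesis Y12 : independent_RV P Y1 Y2.

Let mpair : measurable_fun setT (fun w => (Y1 w, Y2 w)).
Proof. exact: measurable_fun_pair. Qed.

Let pair_mixin := isMeasurableFun.Build _ _ _ _ _ mpair.
Let pairRV : {RV P >-> (R * R)%type} := HB.pack (fun w => (Y1 w, Y2 w)) pair_mixin.

Lemma joint_law C : measurable C ->
  P ((fun w => (Y1 w, Y2 w)) @^-1` C) =
  (distribution P Y1 \x distribution P Y2)%E C.
Proof.
move=> mC.
rewrite (@product_measure_unique _ _ _ _ _ _ _ (distribution P pairRV) _ C mC)//.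
Qed.

Lemma independent_integral_mul (f g : R -> R) :
  measurable_fun setT f -> measurable_fun setT g ->
  (forall x, 0 <= f x) -> (forall x, 0 <= g x) ->
  (\int[P]_w (f (Y1 w) * g (Y2 w))%:E =
   \int[P]_w (f (Y1 w))%:E * \int[P]_w (g (Y2 w))%:E)%E.
Proof.
move=> mf mg f0 g0.
pose h (z : R * R) := (f z.1 * g z.2)%:E.
have mh : measurable_fun setT h.
  apply/measurable_EFinP; apply: measurable_funM.
    by apply: (measurableT_comp mf); exact: measurable_fst.
  by apply: (measurableT_comp mg); exact: measurable_snd.
have h0 z : (0 <= h z)%E by rewrite lee_fin mulr_ge0.
rewrite -(@ge0_integral_distribution _ _ _ _ _ P pairRV h)//.
rewrite (eq_measure_integral (distribution P Y1 \x distribution P Y2)%E); last first.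
  by move=> A mA _; rewrite -[RHS]joint_law.
rewrite fubini_tonelli1//.
have mf' : measurable_fun setT (fun x => (f x)%:E) by exact/measurable_EFinP.
have mg' : measurable_fun setT (fun x => (g x)%:E) by exact/measurable_EFinP.
rewrite -(@ge0_integral_distribution _ _ _ _ _ P Y1 (fun x => (f x)%:E))//.
rewrite -(@ge0_integral_distribution _ _ _ _ _ P Y2 (fun x => (g x)%:E))//.
have fE x : (0 <= (f x)%:E)%E by rewrite lee_fin.
have gE x : (0 <= (g x)%:E)%E by rewrite lee_fin.
rewrite muleC -(ge0_integralZl _ measurableT mf')//; last exact: integral_ge0.
apply: eq_integral => x _; rewrite /fubini_F /h /= muleC -(ge0_integralZl _ measurableT mg')//.
Qed.

End joint_law.

(** Lets a product built on one probability space replace [N1 * N2] on another: the joint law of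
    independent variables is a product measure, fixed by its values on rectangles. *)
Lemma independent_mul_law {R : realType} d (T : measurableType d)
  (P : probability T R) (Y1 Y2 : {RV P >-> R})
  d' (T' : measurableType d') (P' : probability T' R) (Z1 Z2 : {RV P' >-> R})
  (Q1 Q2 : set R -> \bar R) :
  independent_RV P Y1 Y2 -> independent_RV P' Z1 Z2 ->
  has_law P Y1 Q1 -> has_law P' Z1 Q1 -> has_law P Y2 Q2 -> has_law P' Z2 Q2 ->
  forall A, measurable A ->
    P ((fun w => Y1 w * Y2 w) @^-1` A) = P' ((fun w => Z1 w * Z2 w) @^-1` A).
Proof.
move=> iY iZ Y1l Z1l Y2l Z2l A mA.
pose C := (fun z : R * R => z.1 * z.2) @^-1` A.
have mC : measurable C.
  by rewrite -[C]setTI; apply: measurable_funM.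
have -> : (fun w => Y1 w * Y2 w) @^-1` A = (fun w => (Y1 w, Y2 w)) @^-1` C by [].
have -> : (fun w => Z1 w * Z2 w) @^-1` A = (fun w => (Z1 w, Z2 w)) @^-1` C by [].
rewrite (joint_law iY mC) (joint_law iZ mC); apply: product_measure_unique => // B D mB mD.
apply: (etrans (product_measure1E _ _ mB mD)).
by congr (_ * _)%E; [transitivity (Q1 B); [exact: Z1l|exact/esym/Y1l]|
  transitivity (Q2 D); [exact: Z2l|exact/esym/Y2l]].
Qed.

(** * Moments of the product of two standard Gaussians *)

Section standard_gaussian.
Context {R : realType} d (T : measurableType d) (P : probability T R).
Context (N : {RV P >-> R}) (HN : standard_gaussian P N).
Local Notation E f := (\int[P]_w f w).

Lemma standard_gaussian_mgf :
  has_mgf P N /\ forall t, E (fun w => expR (t * N w)) = expR (0 * t + 1 * t ^+ 2 / 2).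
Proof.
have I t : (\int[P]_w (expR (t * N w))%:E = (expR (0 * t + 1 * t ^+ 2 / 2))%:E)%E.
  have := @normal_prob_mgf R 0 1 t (oner_neq0 _).
  rewrite expr1n => <-; apply: (ge0_integral_has_law (Q := normal_prob 0 1)
    (f := fun x => (expR (t * x))%:E)) => //.
  by apply/measurable_EFinP; apply: measurableT_comp => //; exact: measurable_funM.
split; last by move=> t; rewrite /Rintegral I.
split => // t; apply/integrableP; split.
  by apply/measurable_EFinP; apply: measurableT_comp => //; exact: measurable_funM.
under eq_integral do rewrite /= ger0_norm ?expR_ge0//.
by rewrite I ltry.
Qed.

Lemma standard_gaussian_moment k :
  E (fun w => N w ^+ k.+2) = k.+1%:R * E (fun w => N w ^+ k).
Proof.
have [eN mN] := standard_gaussian_mgf; have tN := tame_mgf eN.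
under eq_Rintegral do rewrite exprS.
rewrite (mgf_stein eN mN) -meanZ; last exact: tameX.
by apply: eq_Rintegral => w _; rewrite mul0r add0r mul1r.
Qed.

Lemma standard_gaussian_even_moment k :
  (\int[P]_w (N w ^+ (2 * k))%:E = (\prod_(i < k) (2 * i + 1)%:R)%:E)%E.
Proof.
have tN := tame_mgf standard_gaussian_mgf.1.
rewrite -[LHS]fineK; last by apply: integrable_fin_num => //; exact: (tame_integrableX _ tN).
congr EFin; rewrite -/(Rintegral _ _ _); elim: k => [|k ih].
  by rewrite big_ord0; under eq_Rintegral do rewrite expr0; exact: mean_cst.
by rewrite mulnS add2n standard_gaussian_moment ih big_ord_recr/= mulrC addn1.
Qed.

End standard_gaussian.

Section gaussian_product.
Context {R : realType} d (T : measurableType d) (P : probability T R).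
Context (N1 N2 F : {RV P >-> R}).
Hypotheses (HN1 : standard_gaussian P N1) (HN2 : standard_gaussian P N2).
Hypotheses (N12 : independent_RV P N1 N2) (FE : forall w, F w = N1 w * N2 w).
Local Notation E f := (\int[P]_w f w).

Lemma gaussian_product_moment k :
  P.-integrable setT (EFin \o (fun w => F w ^+ (2 * k))) /\
  E (fun w => F w ^+ (2 * k)) = (\prod_(i < k) (2 * i + 1)%:R) ^+ 2.
Proof.
have x0 (x : R) : 0 <= x ^+ (2 * k) by rewrite exprM exprn_ge0 ?sqr_ge0.
have mx : measurable_fun setT (fun x : R => x ^+ (2 * k)) by exact: measurable_funX.
have I : (\int[P]_w (F w ^+ (2 * k))%:E = ((\prod_(i < k) (2 * i + 1)%:R) ^+ 2)%:E)%E.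
  under eq_integral do rewrite FE exprMn.
  rewrite (independent_integral_mul N12 mx mx x0 x0).
  by rewrite !standard_gaussian_even_moment// -EFinM expr2.
split; last by rewrite /Rintegral I.
by apply: ge0_integrable => //; [exact: measurable_funX|rewrite I ltry].
Qed.

Lemma gaussian_product_moments :
  [/\ E (fun w => F w ^+ 2) = 1, E (fun w => F w ^+ 4) = 9,
      E (fun w => F w ^+ 6) = 225 & E (fun w => F w ^+ 8) = 225 * 49].
Proof.
have m := fun k => (gaussian_product_moment k).2.
split; [rewrite (m 1%N)|rewrite (m 2%N)|rewrite (m 3%N)|rewrite (m 4%N)];
  rewrite !big_ord_recr big_ord0/=; ring.
Qed.

Lemma gaussian_product_P6 : 'E_P[fun w => P6 (F w)]%E = 0%E.
Proof.
have i := fun k => (gaussian_product_moment k).1.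
have [m2 m4 m6 _] := gaussian_product_moments.
have [iP6 mP6] := mean_P6 (@measurable_funPT _ _ _ _ F) (fun k _ => i k).
by rewrite expectationE// mP6 m2 m4 m6; congr EFin; ring.
Qed.

End gaussian_product.

(** * Coupling a finite form with a Gaussian product *)

Section isonormal_coupling.
Context {R : realType} (H : normedModType R) (ip : H -> H -> R).
Hypothesis Hip : is_inner_product ip.
Context d (T : measurableType d) (P : probability T R).
Context (X : H -> {RV P >-> R}) (HX : isonormal ip X).
Local Notation E f := (\int[P]_w f w).

(** Orthogonality removes the cross term from the squared norm of [t g + s h], so the joint mgf
    factors. *)
Lemma isonormal_independent g h : ip g h = 0 -> independent_RV P (X g) (X h).
Proof.
move=> gh; have eg := isonormal_has_mgf HX g; have eh := isonormal_has_mgf HX h.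
apply: mgf_independent => // t s.
have mX k : measurable_fun setT (X k) by exact: measurable_funPT.
pose f := \sum_(i <- [:: (t, g); (s, h)]) i.1 *: i.2.
have -> : E (fun w => expR (t * X g w) * expR (s * X h w)) =
    E (fun w => expR (1 * X f w)).
  apply: mean_ae.
  - by apply: measurable_funM; [exact: (tame_expR eg t).1|exact: (tame_expR eh s).1].
  - exact: (tame_expR (isonormal_has_mgf HX f) 1).1.
  have := isonormal_sum Hip HX [:: (t, g); (s, h)] fst snd.
  apply: filterS => w; rewrite -/f => ->.
  by rewrite !big_cons big_nil addr0 mul1r expRD.
rewrite !(isonormal_mgf Hip HX) -expRD; congr expR.
rewrite -!(ip_norm Hip) /f !big_cons big_nil addr0/= !(ipDl Hip, ipDr Hip, ipZl Hip, ipZr Hip).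
by rewrite (ip_sym Hip h g) gh; field.
Qed.

(** The threshold 1/20 yields the hypotheses of [round_half_pair]: [2200 / 3840 / 20 < 1/25] and
    [1 / 640 / 20 < 1/400]. The product [X g * X h] is almost surely the rounded form, so the cost
    is twice the sum of the [(l - t)^2], at most [58 D], well below the [3840 D] contained in the
    defect. *)
Lemma unit_form_coupling l vs : unit_form ip l vs -> P6_defect l vs <= 20^-1 ->
  exists g h, [/\ `|g| = 1, `|h| = 1, ip g h = 0 &
    E (fun w => (chaos_form X l vs w - X g w * X h w) ^+ 2) <= P6_defect l vs].
Proof.
move=> [ovs l2] def; set D := \sum_(v <- vs) l v ^+ 2 * (l v ^+ 2 - 4^-1) ^+ 2.
have D0 : 0 <= D.
  by rewrite sumr_ge0// => v _; rewrite mulr_ge0// sqr_ge0.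
have S0 : 0 <= (\sum_(v <- vs) l v ^+ 3) ^+ 2 by exact: sqr_ge0.
have [h1 [u [v [us vs' uv tg]]]] : \sum_(v <- vs) (l v - round_half (l v)) ^+ 2 <= 29 * D /\
    exists u v, [/\ u \in vs, v \in vs, u != v & forall g,
      \sum_(v <- vs) round_half (l v) * g v = 2^-1 * g u - 2^-1 * g v].
  apply: (round_half_pair ovs.1 l2); move: def; rewrite /P6_defect -/D.
    by move: D D0 (_ ^+ 2) S0 => a a0 b b0; lra.
  by move: D D0 (_ ^+ 2) S0 => a a0 b b0; lra.
pose t v := round_half (l v).
have c0 : Num.sqrt 2 != 0 :> R by rewrite sqrtr_eq0 -ltNge.
pose c : R := (Num.sqrt 2)^-1.
have c2 : c * c = 2^-1 by rewrite /c -invfM -expr2 sqr_sqrtr.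
have [_ o] := ovs.
have uu := o _ _ us us; have vv := o _ _ vs' vs'.
have uv0 := o _ _ us vs'; have vu0 := o _ _ vs' us.
rewrite eqxx/= in uu; rewrite eqxx/= in vv; rewrite (negbTE uv)/= in uv0.
rewrite eq_sym (negbTE uv)/= in vu0.
(* [g] and [h] are [u + v] and [u - v] divided by [sqrt 2], written as sums so that [isonormal_sum]
   applies. *)
pose g := \sum_(i <- [:: (c, u); (c, v)]) i.1 *: i.2.
pose h := \sum_(i <- [:: (c, u); (- c, v)]) i.1 *: i.2.
have ipE := (ipDl Hip, ipDr Hip, ipZl Hip, ipZr Hip).
have norm1 k : ip k k = 1 -> `|k| = 1.
  rewrite (ip_norm Hip) => /eqP.
  by rewrite -[X in _ == X](expr1n _ 2) eqrXn2// => /eqP.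
exists g, h; split.
- apply: norm1; rewrite /g !big_cons big_nil addr0/= !ipE uu vv uv0 vu0.
  by rewrite !(mulr0, mulr1, addr0, add0r) c2; field.
- apply: norm1; rewrite /h !big_cons big_nil addr0/= !ipE uu vv uv0 vu0.
  by rewrite !(mulr0, mulr1, addr0, add0r) mulrNN c2; field.
- rewrite /g /h !big_cons big_nil !addr0/= !ipE uu vv uv0 vu0.
  by rewrite !(mulr0, mulr1, addr0, add0r) mulrN subrr.
have mX k : measurable_fun setT (X k) by exact: measurable_funPT.
have tS k := tame_chaos_form HX k vs.
rewrite (@mean_ae _ _ _ _ _ (fun w => chaos_form X (fun v => l v - t v) vs w ^+ 2)).
- have [[_ _ ->] _ _ _ _] := mean_chaos_form Hip HX (fun v => l v - t v) ovs.
  rewrite (le_trans (ler_wpM2l _ h1))// /P6_defect -/D.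
  by clear -D0 S0; move: (D) D0 (_ ^+ 2) S0 => a a0 b b0; lra.
- apply: measurable_funX; apply: measurable_funB; first exact: (tS l).1.
  exact: measurable_funM.
- exact: (tameX 2 (tS _)).1.
have gE := isonormal_sum Hip HX [:: (c, u); (c, v)] fst snd.
have hE := isonormal_sum Hip HX [:: (c, u); (- c, v)] fst snd.
apply: filterS2 gE hE => w; rewrite -/g -/h => -> ->.
congr (_ ^+ 2); rewrite !big_cons big_nil !addr0/=.
rewrite (_ : _ * _ = c * c * (X u w ^+ 2 - X v w ^+ 2)); last by ring.
have -> : chaos_form X (fun v => l v - t v) vs w =
    chaos_form X l vs w - \sum_(v <- vs) t v * (X v w ^+ 2 - 1).
  by rewrite /chaos_form -sumrB; apply: eq_bigr => k _; rewrite mulrBl.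
by rewrite (tg (fun v => X v w ^+ 2 - 1)) c2; ring.
Qed.

End isonormal_coupling.

(** * Couplings *)

Section transfer.
Context {R : realType} d (T : measurableType d) (P : probability T R).
Context d' (T' : measurableType d') (Q : probability T' R).
Context (F : {RV P >-> R}) (Y : {RV Q >-> R}).
Hypothesis YF : has_law Q Y (distribution P F).

Lemma has_law_mean_ge0 (f : R -> R) : measurable_fun setT f ->
  (forall x, 0 <= f x) -> P.-integrable setT (EFin \o (fun w => f (F w))) ->
  Q.-integrable setT (EFin \o (fun w => f (Y w))) /\
  \int[Q]_w f (Y w) = \int[P]_w f (F w).
Proof.
move=> mf f0 iF.
have mF : measurable_fun setT F by exact: measurable_funPT.
have mY : measurable_fun setT Y by exact: measurable_funPT.
have mf' : measurable_fun setT (fun x => (f x)%:E) by exact/measurable_EFinP.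
have I : (\int[Q]_w (f (Y w))%:E = \int[P]_w (f (F w))%:E)%E.
  have fE x : (0 <= (f x)%:E)%E by rewrite lee_fin.
  rewrite -(@ge0_integral_distribution _ _ _ _ _ Q Y _ mf' fE).
  rewrite -(@ge0_integral_distribution _ _ _ _ _ P F _ mf' fE).
  by apply: eq_measure_integral => A mA _; exact: YF.
split; last by rewrite /Rintegral I.
apply: ge0_integrable => //; first exact: measurableT_comp.
rewrite I; have := integrable_fin_num measurableT iF.
by rewrite fin_numE => /andP[_]; rewrite ltey.
Qed.

(** Adding [M] makes the integrand nonnegative, and the constant cancels. *)
Lemma has_law_mean_bounded (f : R -> R) M : measurable_fun setT f ->
  (forall x, `|f x| <= M) -> \int[Q]_w f (Y w) = \int[P]_w f (F w).
Proof.
move=> mf fM.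
have bint d0 (T0 : measurableType d0) (P0 : probability T0 R) (Z : {RV P0 >-> R}) :
    tame P0 (fun w => f (Z w)).
  by apply: (@tame_bounded _ _ _ _ _ M) => // w; apply: measurableT_comp.
have fM0 x : 0 <= f x + M.
  by have := fM x; rewrite ler_norml -lerBlDr sub0r => /andP[].
have [||_] := @has_law_mean_ge0 (fun x => f x + M) _ fM0.
- exact: measurable_funD.
- by apply: tame_integrable; apply: tameD; [exact: bint|exact: tame_cst].
rewrite (meanD (bint _ _ Q Y) (tame_cst Q M)) (meanD (bint _ _ P F) (tame_cst P M)).
by rewrite !mean_cst => /addIr.
Qed.

End transfer.

Lemma mean_sqrD {R : realType} d (T : measurableType d) (P : probability T R)
    (f g : T -> R) : measurable_fun setT f -> measurable_fun setT g ->
  P.-integrable setT (EFin \o (fun w => f w ^+ 2)) ->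
  P.-integrable setT (EFin \o (fun w => g w ^+ 2)) ->
  P.-integrable setT (EFin \o (fun w => (f w - g w) ^+ 2)) /\
  \int[P]_w ((f w - g w) ^+ 2) <= 2 * \int[P]_w (f w ^+ 2) + 2 * \int[P]_w (g w ^+ 2).
Proof.
move=> mf mg i1 i2; have i := sqr_integrableB mf mg i1 i2; split => //.
have j1 := integrableZ_real 2 i1; have j2 := integrableZ_real 2 i2.
rewrite -(RintegralZl _ measurableT i1) -(RintegralZl _ measurableT i2).
rewrite -(RintegralD measurableT j1 j2); apply: le_Rintegral => //.
  exact: integrableD_real.
by move=> w _; have := sqr_ge0 (f w + g w); nra.
Qed.

Section coupling.
Context {R : realType} (H : normedModType R) (ip : H -> H -> R).
Hypothesis Hip : is_inner_product ip.
Context d (T : measurableType d) (P : probability T R).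
Context (X : H -> {RV P >-> R}) (HX : isonormal ip X).
Context (F : {RV P >-> R}) (FC : second_wiener_chaos X F).
Hypothesis F2 : 'E_P[fun w => (F w ^+ 2)%R]%E = 1%E.
Context d' (T' : measurableType d') (P' : probability T' R).
Context (N1 N2 G : {RV P' >-> R}).
Hypotheses (HN1 : standard_gaussian P' N1) (HN2 : standard_gaussian P' N2).
Hypotheses (N12 : independent_RV P' N1 N2) (GE : forall w, G w = N1 w * N2 w).

Lemma chaos_P6_ge0 : 0 <= \int[P]_w P6 (F w).
Proof.
apply/ler_addgt0Pr => e e0; have [l [vs [_ _]]] := chaos_approx Hip HX FC F2 e0.
rewrite ler_norml => /andP[h _]; have := P6_defect_ge0 l vs; lra.
Qed.

(** The constant is [80 = 4 * 20]. If the approximating form has defect at most 1/20, [F] is paired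
    with [X g * X h] on its own space, at cost at most [2 E P6 + 4 e]. Otherwise [E P6 + e > 1/20],
    so the right side exceeds 4, which bounds the cost of any coupling of two variables of second
    moment 1. *)
Lemma chaos_coupling e : 0 < e ->
  exists (d0 : measure_display) (S : measurableType d0) (Q : probability S R)
    (Y Z : {RV Q >-> R}),
    [/\ has_law Q Y (distribution P F), has_law Q Z (distribution P' G),
        Q.-integrable setT (EFin \o (fun w => (Y w - Z w) ^+ 2)) &
        \int[Q]_w ((Y w - Z w) ^+ 2) <= 80 * (\int[P]_w P6 (F w) + e)].
Proof.
move=> e0; have P60 := chaos_P6_ge0.
have [l [vs [ul Fl]]] := chaos_approx Hip HX FC F2 e0.
rewrite ler_norml => /andP[d1 d2].
have [def|def] := leP (P6_defect l vs) 20^-1.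
  have [g [h [g1 h1 gh def']]] := unit_form_coupling Hip HX ul def.
  have mX k : measurable_fun setT (X k) by exact: measurable_funPT.
  have mZ : measurable_fun setT (fun w => X g w * X h w) by exact: measurable_funM.
  have tZ := tameM (isonormal_tame HX g) (isonormal_tame HX h).
  have tS := tame_chaos_form HX l vs.
  pose Zmix := isMeasurableFun.Build _ _ _ _ _ mZ.
  pose Z : {RV P >-> R} := HB.pack (fun w => X g w * X h w) Zmix.
  exists d, T, P, F, Z; split => //.
  - move=> A mA; rewrite /distribution /pushforward.
    rewrite (_ : (G : T' -> R) = fun w => N1 w * N2 w); last exact/funext.
    apply: (independent_mul_law (isonormal_independent Hip HX gh) N12
      (isonormal_standard Hip HX g1) HN1 (isonormal_standard Hip HX h1) HN2 mA).
  - exact: (chaos_dist_integrable F2 tZ).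
  have iS := chaos_dist_integrable F2 tS.
  have tSZ := tameB tZ tS.
  have mF : measurable_fun setT F by exact: measurable_funPT.
  have [_] := mean_sqrD (measurable_funB mF tS.1) tSZ.1 iS (tame_integrableX 2 tSZ).
  under eq_Rintegral do rewrite opprB addrA subrK.
  under [X in _ <= _ + 2 * X -> _]eq_Rintegral do rewrite -sqrrN opprB.
  move=> /le_trans; apply; lra.
have P1 : P setT = 1%E by exact: probability_setT.
have P'1 : P' setT = 1%E by exact: probability_setT.
have mF : measurable_fun setT F by exact: measurable_funPT.
have mG : measurable_fun setT G by exact: measurable_funPT.
have mY : measurable_fun setT (fun w : T * T' => F w.1).
  by apply: (measurableT_comp mF); exact: measurable_fst.
have mZ : measurable_fun setT (fun w : T * T' => G w.2).
  by apply: (measurableT_comp mG); exact: measurable_snd.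
pose Q : probability (T * T')%type R := (P \x P')%E.
pose Ymix := isMeasurableFun.Build _ _ _ _ _ mY.
pose Zmix := isMeasurableFun.Build _ _ _ _ _ mZ.
pose Y : {RV Q >-> R} := HB.pack (fun w : T * T' => F w.1) Ymix.
pose Z : {RV Q >-> R} := HB.pack (fun w : T * T' => G w.2) Zmix.
have YF : has_law Q Y (distribution P F).
  move=> A mA; rewrite (_ : Y @^-1` A = (F @^-1` A) `*` setT); last first.
    by apply/seteqP; split => [w ?|w []].
  rewrite /Q/= product_measure1E//; last first.
    by rewrite -[X in measurable X]setTI; exact: mF.
  by rewrite [X in (_ * X)%E]P'1 mule1.
have ZG : has_law Q Z (distribution P' G).
  move=> A mA; rewrite (_ : Z @^-1` A = setT `*` (G @^-1` A)); last first.
    by apply/seteqP; split => [w ?|w []].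
  rewrite /Q/= product_measure1E//; last first.
    by rewrite -[X in measurable X]setTI; exact: mG.
  by rewrite [X in (X * _)%E]P1 mul1e.
exists _, _, Q, Y, Z.
have msq : measurable_fun setT (fun x : R => x ^+ 2) by exact: measurable_funX.
have [iY EY] := has_law_mean_ge0 YF msq (@sqr_ge0 _) (chaos_sqr_integrable F2).
have iG := (gaussian_product_moment HN1 HN2 N12 GE 1).1.
have [EG _ _ _] := gaussian_product_moments HN1 HN2 N12 GE.
have [iZ EZ] := has_law_mean_ge0 ZG msq (@sqr_ge0 _) iG.
have [iYZ EYZ] := mean_sqrD mY mZ iY iZ.
split => //; apply: (le_trans EYZ).
rewrite [X in 2 * X + _]EY [X in _ + 2 * X]EZ EG (chaos_mean_sqr F2); lra.
Qed.

End coupling.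

(** * Convergence *)

(** Only [x] is confined to the segment while [y] may leave it: in a coupling only the target
    variable is known to be bounded. Compactness of the segment makes the local radius uniform. *)
Lemma continuous_unif_segment {R : realType} (f : R -> R) (K e : R) :
  continuous f -> 0 < e -> exists2 r, 0 < r &
    forall x y, `|x| <= K -> `|x - y| < r -> `|f x - f y| <= e.
Proof.
move=> cf e0.
have /compact_near_coveringP cK := @segment_compact R (- K) K.
pose Pr (r x : R) := forall y, `|x - y| < r -> `|f x - f y| <= e.
have h : \forall r \near 0^'+, `[- K, K] `<=` Pr r.
  apply: cK => x _.
  have e2 : 0 < e / 2 by rewrite divr_gt0.
  have /cvgrPdist_le/(_ _ e2) := cf x.
  move=> [r /= r0 xr]; have r2 : 0 < r / 2 by rewrite divr_gt0.
  exists (ball x (r / 2), [set t | 0 < t < r / 2]) => /=.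
    split; first exact: nbhsx_ballx.
    near=> t; rewrite /=; apply/andP; split; near: t; first exact: nbhs_right_gt.
    exact: nbhs_right_lt.
  move=> [x' t] /= [xx' /andP[t0 tr]] y x'y.
  have a1 : ball x r x'.
    by rewrite /ball/=; rewrite /ball/= in xx'; lra.
  have a2 : ball x r y.
    rewrite /ball/= in xx' *; rewrite (_ : x - y = (x - x') + (x' - y)); last by ring.
    by rewrite (le_lt_trans (ler_normD _ _))//; lra.
  have b1 := xr _ a1; have b2 := xr _ a2; rewrite /= in b1 b2.
  rewrite (_ : f x' - f y = - (f x - f x') + (f x - f y)); last by ring.
  by rewrite (le_trans (ler_normD _ _))// normrN; lra.
have [r [r0 hr]] : exists r, 0 < r /\ `[- K, K] `<=` Pr r.
  have : \forall r \near 0^'+, (0 : R) < r /\ `[- K, K] `<=` Pr r.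
    near=> r; split; near: r; [exact: nbhs_right_gt|exact: h].
  by move=> /filter_ex.
exists r => // x y xK; apply: hr; rewrite /= in_itv/=.
by move: xK; rewrite ler_norml.
Unshelve. all: by end_near. Qed.

Section convergence.
Context {R : realType} (H : normedModType R) (ip : H -> H -> R).
Hypothesis Hip : is_inner_product ip.
Context d (T : measurableType d) (P : probability T R).
Context (X : H -> {RV P >-> R}) (HX : isonormal ip X).
Context d' (T' : measurableType d') (P' : probability T' R).
Context (N1 N2 G : {RV P' >-> R}).
Hypotheses (HN1 : standard_gaussian P' N1) (HN2 : standard_gaussian P' N2).
Hypotheses (N12 : independent_RV P' N1 N2) (GE : forall w, G w = N1 w * N2 w).
Local Notation E f := (\int[P]_w f w).
Local Notation E' f := (\int[P']_w f w).

Section single.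
Context (F : {RV P >-> R}) (FC : second_wiener_chaos X F).
Hypothesis F2 : 'E_P[fun w => (F w ^+ 2)%R]%E = 1%E.

(** A coupling with slack [t^2 / 80] costs at most [sqrt (80 a + t^2) <= sqrt (80 a) + t], and [t]
    is arbitrary. *)
Lemma wasserstein2_chaos :
  (wasserstein2 (distribution P F) (distribution P' G) <=
    (Num.sqrt 80)%:E * sqrte 'E_P[fun w => P6 (F w)])%E.
Proof.
have [iP6 _] := chaos_mean_P6 Hip HX FC F2; rewrite expectationE//= -EFinM.
have a0 := chaos_P6_ge0 Hip HX FC F2; set a := E (fun w => P6 (F w)) in a0 *.
rewrite -sqrtrM//; apply/lee_addgt0Pr => t t0; rewrite -EFinD.
have e0 : 0 < t ^+ 2 / 80 by rewrite divr_gt0// exprn_gt0.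
have [d0 [S [Q [Y [Z [Yl Zl i YZ]]]]]] :=
  chaos_coupling Hip HX FC F2 HN1 HN2 N12 GE e0.
apply: (@le_trans _ _ (sqrte 'E_Q[fun w => ((Y w - Z w) ^+ 2)%R])%E).
  by apply: ereal_inf_lbound; exists d0, S, Q, Y, Z.
rewrite expectationE//= lee_fin.
apply: (@le_trans _ _ (Num.sqrt (80 * a + t ^+ 2))).
  apply: ler_wsqrtr; apply: (le_trans YZ); rewrite -/a mulrDr.
  by rewrite (_ : 80 * (t ^+ 2 / 80) = t ^+ 2)//; field.
have s0 : 0 <= 80 * a by rewrite mulr_ge0.
rewrite -(@ler_pXn2r _ 2) ?nnegrE ?addr_ge0 ?sqrtr_ge0 ?(ltW t0)//.
rewrite sqr_sqrtr ?addr_ge0 ?sqr_ge0// sqrrD sqr_sqrtr// lerD2r lerDl.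
by rewrite mulrn_wge0// mulr_ge0 ?sqrtr_ge0// ltW.
Qed.

(** The events where [Z] exceeds [K] or [Y] is at least [r] away from [Z] are paid by Chebyshev-type
    quadratic bounds, using [E Z^2 = 1] and the coupling cost; on the rest the modulus [c]
    applies. *)
Lemma chaos_bounded_test (f : R -> R) M r K c e :
  measurable_fun setT f -> (forall x, `|f x| <= M) ->
  0 < r -> 0 < K -> 0 < e ->
  (forall x y, `|x| <= K -> `|x - y| < r -> `|f x - f y| <= c) ->
  `|E (fun w => f (F w)) - E' (fun w => f (G w))| <=
  c + 2 * M / r ^+ 2 * (80 * (E (fun w => P6 (F w)) + e)) + 2 * M / K ^+ 2.
Proof.
move=> mf fM r0 K0 e0 rP.
have [d0 [S [Q [Y [Z [Yl Zl i YZ]]]]]] :=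
  chaos_coupling Hip HX FC F2 HN1 HN2 N12 GE e0.
rewrite -(has_law_mean_bounded Yl mf fM) -(has_law_mean_bounded Zl mf fM).
have M0 : 0 <= M by rewrite (le_trans _ (fM 0)).
have c0 : 0 <= c.
  by have := rP 0 0; rewrite !subrr !normr0 => /(_ (ltW K0) r0).
have tb (U : {RV Q >-> R}) : tame Q (fun w => f (U w)).
  by apply: (@tame_bounded _ _ _ _ _ M) => // w; exact: measurableT_comp.
have iG := (gaussian_product_moment HN1 HN2 N12 GE 1).1.
have [EG _ _ _] := gaussian_product_moments HN1 HN2 N12 GE.
have msq : measurable_fun setT (fun x : R => x ^+ 2) by exact: measurable_funX.
have [iZ EZ] := has_law_mean_ge0 Zl msq (@sqr_ge0 _) iG.
rewrite -meanB//; have tB := tameB (tb Y) (tb Z).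
rewrite (le_trans (le_normr_Rintegral measurableT (tame_integrable tB)))//.
have j1 := integrableZ_real (2 * M / r ^+ 2) i.
have j2 := integrableZ_real (2 * M / K ^+ 2) iZ.
have jc := tame_integrable (tame_cst Q c).
have j3 := integrableD_real jc j1.
apply: (@le_trans _ _ (\int[Q]_w (c + 2 * M / r ^+ 2 * (Y w - Z w) ^+ 2 +
    2 * M / K ^+ 2 * Z w ^+ 2))).
  apply: le_Rintegral => //.
  - exact: (tame_integrable (tame_norm tB)).
  - exact: integrableD_real.
  move=> w _.
  have q1 : 0 <= 2 * M / r ^+ 2 by rewrite divr_ge0 ?sqr_ge0// mulr_ge0.
  have q2 : 0 <= 2 * M / K ^+ 2 by rewrite divr_ge0 ?sqr_ge0// mulr_ge0.
  have p1 := mulr_ge0 q1 (sqr_ge0 (Y w - Z w)).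
  have p2 := mulr_ge0 q2 (sqr_ge0 (Z w)).
  have fYZ : `|f (Y w) - f (Z w)| <= 2 * M.
    by rewrite (le_trans (ler_normB _ _))// mulr_natl mulr2n lerD.
  have big x k : 0 < k -> k <= `|x| -> 2 * M <= 2 * M / k ^+ 2 * x ^+ 2.
    move=> k0 kx; rewrite -mulrA ler_peMr ?mulr_ge0// ler_pdivlMl ?exprn_gt0//.
    by rewrite mulr1 -(real_normK (num_real x)) lerXn2r// nnegrE// ltW.
  have [ZK|KZ] := leP `|Z w| K; last first.
    by have := big _ _ K0 (ltW KZ); lra.
  have [YZr|YZr] := ltP `|Z w - Y w| r.
    by have := rP _ _ ZK YZr; rewrite distrC; lra.
  by have := big _ _ r0 YZr; rewrite -[(Z w - Y w) ^+ 2]sqrrN opprB; lra.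
rewrite (RintegralD measurableT j3 j2) (RintegralD measurableT jc j1) mean_cst.
rewrite (RintegralZl _ measurableT i) (RintegralZl _ measurableT iZ).
rewrite [X in _ + _ * X <= _]EZ EG mulr1 lerD2r lerD2l ler_wpM2l//.
by rewrite divr_ge0 ?sqr_ge0// mulr_ge0.
Qed.

End single.

Section sequence.
Context (F : nat -> {RV P >-> R}) (FC : forall n, second_wiener_chaos X (F n)).
Hypothesis F2 : forall n, 'E_P[fun w => (F n w ^+ 2)%R]%E = 1%E.

Let law_tame (f : R -> R) M d0 (T0 : measurableType d0) (P0 : probability T0 R)
    (Z : {RV P0 >-> R}) : measurable_fun setT f -> (forall x, `|f x| <= M) ->
  tame P0 (fun w => f (Z w)).
Proof.
move=> mf fM; apply: (@tame_bounded _ _ _ _ _ M) => // w.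
exact: measurableT_comp.
Qed.

Lemma cvg_in_distributionE : cvg_in_distribution F G <->
  forall f : R -> R, continuous f -> (exists M, forall x, `|f x| <= M) ->
    E (fun w => f (F n w)) @[n --> \oo] --> E' (fun w => f (G w)).
Proof.
have key (f : R -> R) : continuous f -> (exists M, forall x, `|f x| <= M) ->
    (forall n, 'E_P[fun w => f (F n w)]%E = (E (fun w => f (F n w)))%:E) /\
    'E_P'[fun w => f (G w)]%E = (E' (fun w => f (G w)))%:E.
  move=> cf [M fM]; have mf := continuous_measurable_fun cf.
  by split=> [n|]; apply: expectationE; apply: tame_integrable; exact: law_tame fM.
split=> h f cf bf; have [kn kG] := key f cf bf; have := h f cf bf.
  rewrite kG => /fine_cvg; under eq_fun do rewrite /= kn.
  by [].
move=> hf; rewrite kG; apply: cvg_EFin.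
  by apply: nearW => n; rewrite kn.
by under eq_fun do rewrite /= kn.
Qed.

Lemma cvg_in_distribution_P6 :
  E (fun w => P6 (F n w)) @[n --> \oo] --> 0 -> cvg_in_distribution F G.
Proof.
move=> h; apply/cvg_in_distributionE => f cf [M0 fM0].
pose M := 1 + M0.
have M00 : 0 <= M0 by rewrite (le_trans _ (fM0 0)).
have M1 : 0 < M by rewrite ltr_wpDr.
have fM x : `|f x| <= M by rewrite (le_trans (fM0 x))// lerDr.
apply/cvgrPdist_le => e e0.
have e3 : 0 < e / 3 by rewrite divr_gt0.
(* Each of the three terms of [chaos_bounded_test] receives [e / 3]: [K] is such that
   [2 M / K^2 = e / 3], and in the middle term both [E P6] and the slack are at most [e / 6 / q]. *)
pose K := Num.sqrt (6 * M / e).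
have K2 : K ^+ 2 = 6 * M / e by rewrite sqr_sqrtr// divr_ge0 ?mulr_ge0// ltW.
have K0 : 0 < K by rewrite sqrtr_gt0 divr_gt0// mulr_gt0.
have [r r0 rP] := continuous_unif_segment K cf e3.
pose q := 2 * M / r ^+ 2 * 80.
have q0 : 0 < q by rewrite mulr_gt0// divr_gt0 ?mulr_gt0// exprn_gt0.
have t0 : 0 < e / 6 / q by rewrite !divr_gt0.
have /cvgrPdist_le/(_ _ t0) := h.
apply: filterS => n; rewrite sub0r normrN ger0_norm; last exact: (chaos_P6_ge0 Hip HX (FC n) (F2 n)).
move=> hn; rewrite distrC.
have mf := continuous_measurable_fun cf.
apply: (le_trans (chaos_bounded_test (FC n) (F2 n) mf fM r0 K0 t0 rP)).
rewrite K2 mulrA -/q.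
have -> : 2 * M / (6 * M / e) = e / 3.
  by field; rewrite !gt_eqF.
have : q * (E (fun w => P6 (F n w)) + e / 6 / q) <= q * (e / 6 / q + e / 6 / q).
  by rewrite ler_wpM2l ?(ltW q0)// lerD2r.
rewrite (_ : q * (e / 6 / q + e / 6 / q) = e / 3); last by field; rewrite gt_eqF.
lra.
Qed.

(** Powers are unbounded, so [x^2] is truncated at [A] to obtain a bounded continuous test function;
    eighth moments bound the two truncation errors by [B / A <= e / 2] in total, uniformly in
    [n]. *)
Lemma cvg_in_distribution_moment k : (k <= 3)%N -> cvg_in_distribution F G ->
  E (fun w => F n w ^+ (2 * k)) @[n --> \oo] --> E' (fun w => G w ^+ (2 * k)).
Proof.
move=> k3 /cvg_in_distributionE h; apply/cvgrPdist_le => e e0.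
pose B : R := chaos_eighth_bound + 225 * 49.
have cb0 : 0 <= (chaos_eighth_bound : R).
  have [_ ] := chaos_eighth Hip HX (FC 0%N) (F2 0%N); apply: le_trans.
  by apply: Rintegral_ge0 => w _; rewrite (exprM _ 2 4) exprn_ge0 ?sqr_ge0.
have B0 : 0 <= B by rewrite addr_ge0 ?mulr_ge0 ?ler0n.
pose A : R := 1 + 2 * B / e.
have A1 : 1 <= A by rewrite lerDl divr_ge0 ?mulr_ge0// ltW.
have A0 : 0 < A by rewrite (lt_le_trans ltr01).
pose f (x : R) := Num.min (x ^+ 2) A ^+ k.
have f0 x : 0 <= Num.min (x ^+ 2) A by rewrite le_min sqr_ge0 (ltW A0).
have fM x : `|f x| <= A ^+ k.
  by rewrite ger0_norm ?exprn_ge0// lerXn2r ?nnegrE ?(ltW A0)// ge_min lexx orbT.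
have cf : continuous f.
  move=> x; apply: (@continuous_comp _ _ _ (fun x : R => Num.min (x ^+ 2) A) (fun x => x ^+ k)).
    by apply: continuous_min; [exact: exprn_continuous|exact: cst_continuous].
  exact: exprn_continuous.
have mf := continuous_measurable_fun cf.
have trunc d0 (T0 : measurableType d0) (P0 : probability T0 R) (Z : {RV P0 >-> R}) b :
    P0.-integrable setT (EFin \o (fun w => Z w ^+ (2 * k))) ->
    P0.-integrable setT (EFin \o (fun w => Z w ^+ 8)) ->
    \int[P0]_w (Z w ^+ 8) <= b ->
    `|\int[P0]_w (Z w ^+ (2 * k)) - \int[P0]_w f (Z w)| <= b / A.
  move=> ik i8 Zb.
  have jf := tame_integrable (law_tame Z mf fM).
  have j := integrableB_real ik jf; have j8 := integrableZ_real A^-1 i8.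
  rewrite -(RintegralB measurableT ik jf).
  rewrite (le_trans (le_normr_Rintegral measurableT j))//.
  apply: (@le_trans _ _ (\int[P0]_w (A^-1 * Z w ^+ 8))).
    apply: le_Rintegral => //; first exact: integrable_norm j.
    move=> w _; have /andP[h1 h2] := trunc_pow_le (Z w) k3 A1.
    by rewrite ger0_norm// mulrC.
  by rewrite (RintegralZl _ measurableT i8) mulrC ler_wpM2r// invr_ge0 ltW.
have e2 : 0 < e / 2 by rewrite divr_gt0.
have /cvgrPdist_le/(_ _ e2) := h f cf (ex_intro _ _ fM).
apply: filterS => n hn.
have [iF8 F8] := chaos_eighth Hip HX (FC n) (F2 n).
have iF := chaos_integrable_even Hip HX (FC n) (F2 n) k3.
have gm := gaussian_product_moment HN1 HN2 N12 GE.
have [_ _ _ G8] := gaussian_product_moments HN1 HN2 N12 GE.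
have G8' : E' (fun w => G w ^+ 8) <= 225 * 49 by rewrite G8.
have t1 := trunc _ _ _ _ _ iF iF8 F8.
have t2 := trunc _ _ _ _ _ (gm k).1 (gm 4%N).1 G8'.
have : B / A <= e / 2.
  rewrite ler_pdivrMr// /A mulrDr mulr1.
  rewrite (_ : e / 2 * (2 * B / e) = B); last by field; rewrite gt_eqF.
  by rewrite lerDr ltW.
rewrite /B mulrDl; move: t1 t2 hn; rewrite !ler_norml.
lra.
Qed.

End sequence.

End convergence.

(** * The equivalences and the Wasserstein bound *)

Local Open Scope ereal_scope.

Theorem proposition4p1 (R : realType)
  (H : completeNormedModType R) (ip : H -> H -> R)
  (Hip : is_inner_product ip) (Hsep : separable_space H)
  (d : measure_display) (T : measurableType d) (P : probability T R)
  (X : H -> {RV P >-> R}) (HX : isonormal ip X)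
  (F : nat -> {RV P >-> R})
  (HF : forall n : nat, second_wiener_chaos X (F n))
  (HF2 : forall n : nat, 'E_P[fun w => (F n w ^+ 2)%R] = 1)
  (d' : measure_display) (T' : measurableType d') (P' : probability T' R)
  (N1 N2 : {RV P' >-> R})
  (HN1 : standard_gaussian P' N1) (HN2 : standard_gaussian P' N2)
  (Hindep : independent_RV P' N1 N2)
  (Finf : {RV P' >-> R}) (HFinf : forall w : T', Finf w = (N1 w * N2 w)%R) :
  (forall n : nat, 0 <= 'E_P[fun w => P6 (F n w)]) /\
  'E_P'[fun w => P6 (Finf w)] = 0 /\
  let I := cvg_in_distribution F Finf in
  let II :=
    ('E_P[fun w => (F n w ^+ 4)%R] @[n --> \oo] --> 9%:E) /\
    ('E_P[fun w => (F n w ^+ 6)%R] @[n --> \oo] --> 225%:E) in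
  let III :=
    'E_P[fun w => P6 (F n w)] @[n --> \oo] --> 'E_P'[fun w => P6 (Finf w)] in
  [/\ I <-> II, II <-> III & I <-> III] /\
  exists C : R, (0 < C)%R /\
    forall n : nat,
      wasserstein2 (distribution P (F n)) (distribution P' Finf)
        <= C%:E * sqrte 'E_P[fun w => P6 (F n w)] /\
      C%:E * sqrte 'E_P[fun w => P6 (F n w)]
        <= C%:E * sqrte (('E_P[fun w => (F n w ^+ 6)%R] - 225%:E)
                         - 55%:E * ('E_P[fun w => (F n w ^+ 4)%R] - 9%:E)).
Proof.
have iP6 n := (chaos_mean_P6 Hip HX (HF n) (HF2 n)).1.
have P6E n := (chaos_mean_P6 Hip HX (HF n) (HF2 n)).2.
have ik n := chaos_integrable_even Hip HX (HF n) (HF2 n).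
have EP6 n := expectationE (iP6 n).
have E4 n := expectationE (ik n 2%N isT).
have E6 n := expectationE (ik n 3%N isT).
have [_ G4 G6 _] := gaussian_product_moments HN1 HN2 Hindep HFinf.
have GP6 := gaussian_product_P6 HN1 HN2 Hindep HFinf.
have cvgE (u : nat -> \bar R) (v : nat -> R) l : (forall n, u n = (v n)%:E) ->
    u n @[n --> \oo] --> l%:E <-> v n @[n --> \oo] --> l.
  move=> uv; have -> : u = EFin \o v by exact/funext.
  split=> [/fine_cvg//|vl]; apply: cvg_EFin => //; exact: nearW.
split; first by move=> n; rewrite EP6 lee_fin (chaos_P6_ge0 Hip HX (HF n) (HF2 n)).
split => // I II III.
have I_II : I -> II.
  move=> cvgF.
  have c2 := cvg_in_distribution_moment Hip HX HN1 HN2 Hindep HFinf HF HF2 (isT : (2 <= 3)%N) cvgF.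
  have c3 := cvg_in_distribution_moment Hip HX HN1 HN2 Hindep HFinf HF HF2 (isT : (3 <= 3)%N) cvgF.
  split; [apply/(cvgE _ _ _ E4); rewrite -G4|apply/(cvgE _ _ _ E6); rewrite -G6].
    exact: c2.
  exact: c3.
have II_III : II -> III.
  move=> [/(cvgE _ _ _ E4) c4 /(cvgE _ _ _ E6) c6].
  rewrite /III GP6; apply/(cvgE _ _ _ EP6).
  under eq_fun do rewrite P6E.
  rewrite (_ : 0 = 225 - 55 * 9 + 270)%R; last by ring.
  apply: cvgD; last exact: cvg_cst.
  by apply: cvgB => //; apply: cvgM => //; exact: cvg_cst.
have III_I : III -> I.
  rewrite /III GP6 => /(cvgE _ _ _ EP6) c.
  exact: (cvg_in_distribution_P6 Hip HX HN1 HN2 Hindep HFinf HF HF2).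
split; first by split; split; auto.
exists (Num.sqrt 80); split; first by rewrite sqrtr_gt0.
move=> n; split; first exact: (wasserstein2_chaos Hip HX HN1 HN2 Hindep HFinf (HF n) (HF2 n)).
(* In fact an equality: [E F^2 = 1] leaves the constant [331 - 61 = 270 = 55 * 9 - 225]. *)
rewrite EP6 E4 E6 P6E le_eqVlt; apply/orP; left; apply/eqP; congr (_ * sqrte _).
have sub2 (x y : R) : x%:E - 225%:E - 55%:E * (y%:E - 9%:E) =
    (x - 225 - 55 * (y - 9))%:E by rewrite !EFinB EFinM.
by rewrite sub2; congr EFin; ring.
Qed.
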